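(* Suppose that the heavy-tailed Hölder condition holds for some $\delta\in(0,1]$ and $p\ge2$, that $X^*\neq\emptyset$, that $T$ is pseudo-monotone on $X$, and that the sampling condition holds (all defined in the context). Then either Algorithm 2 stops at iteration $k+1$, in which case $x^k$ is a solution of $\mathrm{VI}(T,X)$, or it generates an infinite sequence $\{x^k\}$ that a.s. is bounded and such that $\lim_{k\to\infty}\mathrm d(x^k,X^* )=0$. In particular, a.s. every cluster point of $\{x^k\}$ belongs to $X^*$.
   Context: Setting. $X\subset\mathbb R^d$ is a nonempty closed convex set, $\mathbf P$ is a probability distribution on $\Xi$, $F:\Xi\times X\to\mathbb R^d$ is a measurable random operator, $\xi\sim\mathbf P$, $T(x):=\mathbb E[F(\xi,x)]$. $\mathrm{VI}(T,X)$: find $x^*\in X$ with $\langle T(x^* ),x-x^*\rangle\ge0$ for all $x\in X$; $X^*$ is its solution set. $\|\cdot\|$ is the Euclidean norm, $\Pi$ the Euclidean projection onto $X$, $\mathrm d(x,C):=\inf_{y\in C}\|x-y\|$. For a sample $\xi^N=\{\xi_j\}_{j=1}^N$, $\widehat F(\xi^N,x):=\frac1N\sum_jF(\xi_j,x)$. Heavy-tailed Hölder condition: there is a random variable $\mathsf L:\Xi\to\mathbb R_+$ such that for almost every $\xi$, $\mathsf L(\xi)\ge1$ and $\|F(\xi,x)-F(\xi,y)\|\le\mathsf L(\xi)\|x-y\|^\delta$ for all $x,y\in X$; and, with $\mathsf a:=1$ if $X$ is compact and $\mathsf a:=2$ for a general $X$, there is $x_*\in X$ with $\mathbb E\|F(\xi,x_*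 )\|^{\mathsf ap}<\infty$ and $\mathbb E[\mathsf L(\xi)^{\mathsf ap}]<\infty$. Pseudo-monotonicity: for all $x,z\in X$, $\langle T(x),z-x\rangle\ge0$ implies $\langle T(z),z-x\rangle\ge0$. Algorithm 2. Choose an initial iterate $x^0\in X$, parameters $\tilde\beta\ge\hat\beta>0$, $\hat\alpha\in(0,1]$, $\lambda,\theta\in(0,1)$, a sequence $\{\beta_k\}\subset[\hat\beta,\tilde\beta]$, and sample sizes $N_k\in\mathbb N$. Given $x^k$, draw $\xi^k=\{\xi^k_j\}_{j=1}^{N_k}$ from $\mathbf P$ and put $g^k:=x^k-\beta_k\widehat F(\xi^k,x^k)$. If $x^k=\Pi(g^k)$, stop (''stops at iteration $k+1$''). Otherwise, with $\bar z^k(\alpha):=\alpha\Pi(g^k)+(1-\alpha)x^k$, let $\alpha_k$ be the maximum $\alpha\in\{\theta^\ell\hat\alpha:\ell\in\mathbb N\cup\{0\}\}$ such that $\langle\widehat F(\xi^k,\bar z^k(\alpha)),x^k-\Pi(g^k)\rangle\ge\frac\lambda{\beta_k}\|x^k-\Pi(g^k)\|^2$. Set $z^k:=\alpha_k\Pi(g^k)+(1-\alpha_k)x^k$, $\gamma_k:=\langle\widehat F(\xi^k,z^k),x^k-z^k\rangle\,\|\widehat F(\xi^k,z^k)\|^{-2}$ and $x^{k+1}:=\Pi[x^k-\gamma_k\widehat F(\xi^k,z^k)]$. Sampling condition: $\{\xi^k_j:k\ge0,1\le j\le N_k\}$ is an i.i.d. sample from $\mathbf P$ and $\sum_{k=0}^\infty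 N_k^{-1/2}<\infty$.
   Formalization: ''Stops at iteration k+1, in which case x^k is a solution'' fails on single paths (a sample may pass the test by chance); it is proved as: if the algorithm stops at k+1 a.s. on an event of the samples before ξ^k, then a.s. on that event x^k solves VI(T,X). *)

(* Defs.v *)
From HB Require Import structures.
From mathcomp Require Import all_boot all_order all_algebra finmap.
From mathcomp Require Import all_classical all_reals all_analysis.

Set Implicit Arguments.
Unset Strict Implicit.
Unset Printing Implicit Defensive.

Import Order.TTheory GRing.Theory Num.Theory.
Import numFieldNormedType.Exports.

Local Open Scope classical_set_scope.
Local Open Scope ring_scope.

Section euclidean.
Context {R : realType} {m : nat}.
Implicit Types (x y z : 'rV[R]_m) (X C : set 'rV[R]_m).

(* The norm [`|x|] of MathComp-Analysis on ['rV_m] is the sup norm, so the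
   Euclidean norm is defined here; both induce the topology of ['rV_m], hence
   [closed], [compact] and [cluster] need no adaptation. *)
Definition inner x y : R := \sum_i x 0 i * y 0 i.

Definition norm2 x : R := Num.sqrt (inner x x).

Definition dist2 x C : R := inf [set norm2 (x - y) | y in C].

(* Single-valued when X is nonempty, closed and convex. *)
Definition proj X y : 'rV[R]_m :=
  xget 0 [set z | X z /\ forall w, X w -> norm2 (y - z) <= norm2 (y - w)].

Definition VI_solutions (T : 'rV[R]_m -> 'rV[R]_m) X : set 'rV[R]_m :=
  [set x | X x /\ forall y, X y -> 0 <= inner (T x) (y - x)].

Definition pseudo_monotone (T : 'rV[R]_m -> 'rV[R]_m) X : Prop :=
  forall x z, X x -> X z -> 0 <= inner (T x) (z - x) -> 0 <= inner (T z) (z - x).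

End euclidean.

Notation borel_rV R m := (g_sigma_algebraType (@open 'rV[R]_m)).

Section random_operator.
Context {R : realType} {m : nat} {d : measure_display} {Xi : measurableType d}.
Variables (P : probability Xi R) (F : Xi -> 'rV[R]_m -> 'rV[R]_m).
Implicit Type X : set 'rV[R]_m.

(* F is a total function in Rocq; only its values on Xi x X matter. *)
Definition measurable_operator X : Prop :=
  measurable_fun ([set: Xi] `*` (X : set (borel_rV R m)))
    (fun u : Xi * borel_rV R m => F u.1 u.2 : borel_rV R m).

Definition mean_operator (x : 'rV[R]_m) : 'rV[R]_m :=
  \row_i fine 'E_P[fun w => F w x 0 i].

Definition moment_factor X : R := if `[< compact X >] then 1 else 2.

Definition heavy_tailed_holder X (delta p : R) : Prop :=
  exists L : {RV P >-> R},
    [/\ forall w, 0 <= L w,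
        \forall w \ae P, 1 <= L w /\ forall x y, X x -> X y ->
          norm2 (F w x - F w y) <= L w * norm2 (x - y) `^ delta &
        exists2 xs, X xs &
          ('E_P[(fun w => norm2 (F w xs) `^ (moment_factor X * p))%R] < +oo)%E /\
          ('E_P[(fun w => L w `^ (moment_factor X * p))%R] < +oo)%E].

Definition empirical_mean (n : nat) (s : 'I_n -> Xi) (x : 'rV[R]_m) : 'rV[R]_m :=
  n%:R^-1 *: \sum_(j < n) F (s j) x.

End random_operator.

(* The algorithm along one realization [s] of all the samples. *)
Section algorithm.
Context {R : realType} {m : nat} {d : measure_display} {Xi : measurableType d}.
Variables (F : Xi -> 'rV[R]_m -> 'rV[R]_m) (X : set 'rV[R]_m).
Variables (alphahat lambda theta : R) (beta : nat -> R) (N : nat -> nat).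
Variables (x0 : 'rV[R]_m) (s : forall k, 'I_(N k) -> Xi).
Implicit Types (k : nat) (x : 'rV[R]_m) (a : R).

Let Fhat k := empirical_mean F (@s k).

Definition prox_point k x : 'rV[R]_m := proj X (x - beta k *: Fhat k x).

Definition trial_point k x a : 'rV[R]_m := a *: prox_point k x + (1 - a) *: x.

Definition accepted_steps k x : set R :=
  [set a | (exists l : nat, a = theta ^+ l * alphahat) /\
    lambda / beta k * norm2 (x - prox_point k x) ^+ 2 <=
      inner (Fhat k (trial_point k x a)) (x - prox_point k x)].

Definition is_linesearch_step k x a : Prop :=
  accepted_steps k x a /\ forall b, accepted_steps k x b -> b <= a.

Definition linesearch_step k x : R := xget 0 (is_linesearch_step k x).

Definition next_iterate k x : 'rV[R]_m :=
  let z := trial_point k x (linesearch_step k x) in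
  let gamma := inner (Fhat k z) (x - z) * norm2 (Fhat k z) ^- 2 in
  proj X (x - gamma *: Fhat k z).

(* Defined for every k; meaningful only as long as [continues_at] holds at all
   earlier indices. *)
Fixpoint iterate k : 'rV[R]_m :=
  if k is j.+1 then next_iterate j (iterate j) else x0.

Definition continues_at k : Prop :=
  iterate k <> prox_point k (iterate k) /\
  exists a, is_linesearch_step k (iterate k) a.

(* The algorithm reaches the iterate of index k and stops at iteration k+1. *)
Definition stops_at k : Prop :=
  (forall j, (j < k)%N -> continues_at j) /\
  iterate k = prox_point k (iterate k).

End algorithm.

Section sampling.
Context {R : realType} {d d' : measure_display}.
Context {Xi : measurableType d} {Om : measurableType d'}.
Variables (P : probability Xi R) (Pr : probability Om R).

Definition mutually_independent (I : choiceType) (Y : I -> {RV Pr >-> Xi}) : Prop :=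
  forall (J : {fset I}) (A : I -> set Xi), (forall i, measurable (A i)) ->
    Pr (\bigcap_(i in [set` J]) (Y i @^-1` A i)) =
    (\prod_(i <- J) Pr (Y i @^-1` A i))%E.

Variables (N : nat -> nat) (xi : forall k, 'I_(N k) -> {RV Pr >-> Xi}).

Definition iid_sample : Prop :=
  (forall k (j : 'I_(N k)) A, measurable A -> distribution Pr (@xi k j) A = P A) /\
  mutually_independent (fun i : {k : nat & 'I_(N k)} => xi (tagged i)).

(* The sigma-algebra generated by the samples drawn before iteration k+1; the
   iterate of index k is measurable with respect to it. The stopping test at x^k
   uses a fresh sample independent of it: on a single realization the test may
   succeed by chance at a point x^k which solves only the VI of the empirical
   mean. Stopping identifies a solution of VI(T, X) on the events A of [past k]
   on which the algorithm stops at iteration k+1 almost surely. *)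
Definition past (k : nat) : set_system Om :=
  <<s [set B | exists j (i : 'I_(N j)) A,
        [/\ (j < k)%N, measurable A & B = @xi j i @^-1` A]] >>.

End sampling.

(* Main.v *)
(* Let xs solve VI(T, X). By pseudo-monotonicity <T z, z - xs> >= 0 on X, so that
   one iteration satisfies a perturbed Fejér inequality
     |x_{k+1} - xs|^2 + D_k^2 <= |x_k - xs|^2 + c |Fhat_k z_k - T z_k| |z_k - xs|,
   with D_k the length of the hyperplane projection step. Since z_k depends on the
   sample of iteration k, the error is bounded by the supremum of the deviation
   over a ball, of mean O((1 + radius) / sqrt N_k): chaining over dyadic grids turns
   the Hölder condition into a bound on it with second moments only. When X is
   unbounded, z_k may leave the ball of radius comparable to 1 + |x_k - xs|, but
   only if the deviation at x_k is large, which fourth moments make rare. The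
   iterate x_k is independent of the sample of iteration k, so that the mean error
   is at most c (1 + E |x_k - xs|^2) / sqrt N_k; as these coefficients are summable,
   Gronwall's inequality bounds E |x_k - xs|^2, and almost surely the errors are
   summable. Hence almost surely the iterates are bounded and D_k tends to 0. By the
   line search the residual x_k - Pi(g_k) tends to 0 as well, and with the uniform
   convergence of Fhat_k on balls <T x_k, y - x_k> >= - o(1) for every y in X.

   If the algorithm stops almost surely on an event of the past, then by
   independence x_k is a fixed point of the test for almost every fresh sample;
   averaging the resulting inequalities <Fhat_k x_k, y - x_k> >= 0 gives VI(T, X). *)

Require Import Defs.
From HB Require Import structures.
From mathcomp Require Import all_boot all_order all_algebra finmap.
From mathcomp Require Import all_classical all_reals all_analysis.
From mathcomp Require Import measurable_realfun ring lra zify.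

Set Implicit Arguments.
Unset Strict Implicit.
Unset Printing Implicit Defensive.

Import Order.TTheory GRing.Theory Num.Theory.
Import numFieldNormedType.Exports.
(* [all_classical] exports another [proj]. *)
Import Defs.

Local Open Scope classical_set_scope.
Local Open Scope ring_scope.


(** * Independence and expectations *)

(** With second moments only, the usual maximal inequality based on exponential moments is out of
    reach. It is replaced by an induction over the samples on the potential t ln(sum_j exp(S_j /
    t)), which is smooth for the sup norm whatever the size of the increments: a sample with
    envelope g costs at most 4 g^2 / t, and t is tuned to sqrt N times the scale of the level. In
    the chaining sum the logarithm of the cardinality grows linearly with the level, against a
    geometric decay of the increments.

    The Hölder bound holds on X only, and off a null set. All estimates are made for an operator
    composed with the projection onto X and set to zero on that null set, which is measurable and
    Hölder everywhere. Almost surely no sample meets the null set, and both operators then generate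
    the same path. *)

Section independence.
Context {R : realType} {d1 d2 d' : measure_display}.
Context {T1 : measurableType d1} {T2 : measurableType d2}.
Context {Om : measurableType d'} (Pr : probability Om R).

Definition independent_maps (U : Om -> T1) (V : Om -> T2) : Prop :=
  forall A B, measurable A -> measurable B ->
    Pr (U @^-1` A `&` V @^-1` B) = (Pr (U @^-1` A) * Pr (V @^-1` B))%E.

(** The law of the pair [(U, V)] agrees with the product of the two laws on rectangles, hence
    everywhere, and Tonelli's theorem applies to the product. *)
Lemma ge0_integral_independent (U : Om -> T1) (V : Om -> T2)
    (h : T1 * T2 -> \bar R) :
  measurable_fun setT U -> measurable_fun setT V -> independent_maps U V ->
  measurable_fun setT h -> (forall z, 0 <= h z)%E ->
  (\int[Pr]_w h (U w, V w) = \int[Pr]_w \int[Pr]_w' h (U w, V w'))%E.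
Proof.
move=> mU mV UV mh h0.
pose UX : {mfun Om >-> T1} := HB.pack U (isMeasurableFun.Build _ _ _ _ _ mU).
pose VX : {mfun Om >-> T2} := HB.pack V (isMeasurableFun.Build _ _ _ _ _ mV).
have mW : measurable_fun setT (fun w => (U w, V w)).
  exact: measurable_fun_pair.
pose WX : {mfun Om >-> (T1 * T2)%type} :=
  HB.pack (fun w => (U w, V w)) (isMeasurableFun.Build _ _ _ _ _ mW).
pose m1 : probability T1 R := distribution Pr UX.
pose m2 : probability T2 R := distribution Pr VX.
pose m12 : probability (T1 * T2)%type R := distribution Pr WX.
have m12E X : measurable X -> (m1 \x m2)%E X = m12 X.
  by apply: product_measure_unique => A B mA mB; rewrite -UV.
transitivity (\int[m12]_z h z)%E.
  by rewrite ge0_integral_distribution.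
transitivity (\int[m1 \x m2]_z h z)%E.
  by apply: eq_measure_integral => A mA _; exact/esym/m12E.
rewrite fubini_tonelli1// ge0_integral_distribution//=; last 2 first.
- exact: measurable_fun_fubini_tonelli_F.
- by move=> x; apply: integral_ge0 => y _; exact: h0.
apply: eq_integral => w _; rewrite /fubini_F /= ge0_integral_distribution//.
exact: measurableT_comp.
Qed.

Lemma measurable_integral_section (V : Om -> T2) (h : T1 * T2 -> \bar R) :
  measurable_fun setT V -> measurable_fun setT h -> (forall z, 0 <= h z)%E ->
  measurable_fun setT (fun u => \int[Pr]_w h (u, V w))%E.
Proof.
move=> mV mh h0.
pose VX : {mfun Om >-> T2} := HB.pack V (isMeasurableFun.Build _ _ _ _ _ mV).
rewrite (_ : (fun _ => _) = fubini_F (distribution Pr VX) h).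
  exact: measurable_fun_fubini_tonelli_F.
apply/funext => u; rewrite /fubini_F ge0_integral_distribution//.
exact: measurableT_comp.
Qed.

(* The law of a pair of independent maps is a product measure, so that an almost
   sure property of the pair holds almost surely in each variable separately. *)
Lemma ae_independent (U : Om -> T1) (V : Om -> T2) (B : set (T1 * T2)) :
  measurable_fun setT U -> measurable_fun setT V -> independent_maps U V ->
  measurable B -> (\forall w \ae Pr, B (U w, V w)) ->
  \forall w \ae Pr, \forall w' \ae Pr, B (U w, V w').
Proof.
move=> mU mV UV mB aeB.
have mCB : measurable (~` B) by exact: measurableC.
(* The iterated integral of the indicator of the exceptional set vanishes; a nonnegative function of
   zero integral is zero almost everywhere, first in [w], then in [w']. *)
pose h z : \bar R := (\1_(~` B) z)%:E.
have mh : measurable_fun setT h.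
  by apply/measurable_EFinP; exact: measurable_indic.
have h0 z : (0 <= h z)%E by rewrite lee_fin.
have hE z : (h z = 0 <-> B z)%E.
  rewrite /h indicE; split => [|Bz].
    case: (boolP (z \in ~` B)) => [_ [] /eqP|]; first by rewrite oner_eq0.
    by rewrite notin_setE => /contrapT.
  by rewrite memNset//= => /(_ Bz).
have I0 : (\int[Pr]_w \int[Pr]_w' h (U w, V w') = 0)%E.
  rewrite -ge0_integral_independent//.
  rewrite (ae_eq_integral (cst 0%E))//; first by rewrite integral0.
    by apply: (measurableT_comp mh); exact: measurable_fun_pair.
  by apply: filterS aeB => w Bw _; apply/hE.
have mhV u : measurable_fun setT (fun w' => h (u, V w')).
  by apply: (measurableT_comp mh); exact: measurable_fun_pair.
pose H u : \bar R := (\int[Pr]_w' h (u, V w'))%E.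
have H0 u : (0 <= H u)%E by apply: integral_ge0.
have mH : measurable_fun setT (fun w => H (U w)).
  by apply: (measurableT_comp _ mU); exact: measurable_integral_section.
have /ae_eq_integral_abs : (\int[Pr]_w `|H (U w)| = 0)%E.
  by rewrite -[RHS]I0; apply: eq_integral => w _; rewrite gee0_abs.
move=> /(_ measurableT mH); apply: filterS => w /(_ I) Hw0.
have /ae_eq_integral_abs : (\int[Pr]_w' `|h (U w, V w')| = 0)%E.
  by rewrite -[RHS]Hw0; apply: eq_integral => w' _; rewrite gee0_abs.
by move=> /(_ measurableT (mhV _)); apply: filterS => w' /(_ I) /hE.
Qed.

End independence.

(** * Sigma-algebras generated by parts of the sample *)

Section subfamilies.
Context {R : realType} {d d' : measure_display}.
Context {Xi : measurableType d} {Om : measurableType d'} (Pr : probability Om R).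
Context {I : choiceType} (Y : I -> {RV Pr >-> Xi}).

Definition events_of (D : set I) : set_system Om :=
  [set B | exists i A, [/\ D i, measurable A & B = Y i @^-1` A]].

(** [Om] with a smaller sigma-algebra, as a type of its own: measurability with respect to the
    samples in [D] becomes [measurable_fun] on this type, and the identity from [Om] is the random
    element carrying their information. *)
Definition sigma_of (D : set I) := g_sigma_algebraType (events_of D).

(** Unlike [events_of D] in general, closed under intersection, as the uniqueness of measures
    requires. *)
Let cylinders (D : set I) : set_system Om :=
  [set B | exists (J : {fset I}) (A : I -> set Xi),
     [/\ [set` J] `<=` D, forall i, measurable (A i) &
         B = \bigcap_(i in [set` J]) (Y i @^-1` A i)]].

Lemma sigma_of_measurable D (B : set (sigma_of D)) :
  measurable B -> measurable (B : set Om).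
Proof.
apply: smallest_sub; first exact: sigma_algebra_measurable.
move=> _ [i [A [_ mA ->]]].
by rewrite -[X in measurable X]setTI; exact: measurable_funP.
Qed.

Lemma measurable_of_subfamily D : measurable_fun [set: Om] (id : Om -> sigma_of D).
Proof. by move=> _ B mB; rewrite setTI; exact: (sigma_of_measurable mB). Qed.

Lemma measurable_fun_sigma_of D {d2} {T2 : measurableType d2} (S : sigma_of D -> T2) :
  measurable_fun setT S -> measurable_fun [set: Om] (S : Om -> T2).
Proof.
move=> mS _ B mB; have := mS measurableT B mB; rewrite !setTI.
exact: sigma_of_measurable.
Qed.

Lemma measurable_sample (D : set I) i : D i ->
  measurable_fun [set: sigma_of D] (Y i : sigma_of D -> Xi).
Proof.
by move=> Di _ A mA; rewrite setTI; apply: sub_sigma_algebra; exists i, A.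
Qed.

Lemma measurable_sigma_ofS (D E : set I) : D `<=` E ->
  measurable_fun [set: sigma_of E] (id : sigma_of E -> sigma_of D).
Proof.
move=> DE _ B mB; rewrite setTI; move: B mB.
apply: smallest_sub; first exact: smallest_sigma_algebra.
move=> _ [i [A [Di mA ->]]]; apply: sub_sigma_algebra.
by exists i, A; split => //; exact: DE.
Qed.

Let cylinders_setI D : setI_closed (cylinders D).
Proof.
move=> _ _ [J [A [JD mA ->]]] [K [B [KD mB ->]]].
exists (J `|` K)%fset, (fun i => (if i \in J then A i else setT) `&`
                                 (if i \in K then B i else setT)); split.
- by move=> i /=; rewrite in_fsetU => /orP[/JD|/KD].
- by move=> i; apply: measurableI; case: ifP.
- apply/seteqP; split => w.
    move=> [Jw Kw] i /= _; split.
      by case: ifP => // iJ; exact: Jw.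
    by case: ifP => // iK; exact: Kw.
  move=> w_JK; split => i /= iJ.
    by have := w_JK i; rewrite /= in_fsetU iJ => /(_ isT)[].
  by have := w_JK i; rewrite /= in_fsetU iJ orbT => /(_ isT)[].
Qed.

Let cylinders_measurable D B : cylinders D B -> measurable B.
Proof.
move=> [J [A [_ mA ->]]]; apply: fin_bigcap_measurable => [|i _].
  exact: finite_fset.
by rewrite -[X in measurable X]setTI; exact: measurable_funP.
Qed.

Let sigma_of_cylinders D : <<s events_of D>> `<=` <<s cylinders D>>.
Proof.
apply: sub_sigma_algebra2 => _ [i [A [Di mA ->]]].
exists [fset i]%fset, (fun=> A); split => //.
  by move=> j /=; rewrite in_fset1 => /eqP ->.
apply/seteqP; split => [w Aw j /=|w /(_ i)/=]; first by rewrite in_fset1 => /eqP ->.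
by rewrite in_fset1 eqxx => /(_ isT).
Qed.

(** Both sides are finite measures in [A]; they agree on the pi-system [G], which contains [setT],
    hence on the sigma-algebra it generates. *)
Let indep_extend (G : set_system Om) (B : set Om) :
  setI_closed G -> G `<=` measurable -> measurable B -> G setT ->
  (forall A, G A -> Pr (A `&` B) = (Pr A * Pr B)%E) ->
  forall A, <<s G>> A -> Pr (A `&` B) = (Pr A * Pr B)%E.
Proof.
move=> GI Gm mB GT GB A sA.
pose q : {nonneg R} := NngNum (fine_ge0 (measure_ge0 Pr B)).
have qE : (q%:num)%:E = Pr B by rewrite /= fineK// fin_num_measure.
rewrite muleC -qE.
pose m1 : {measure set Om -> \bar R} := mrestr Pr mB.
pose m2 : {measure set Om -> \bar R} := mscale q Pr.
apply: (g_sigma_algebra_measure_unique G Gm (fun=> setT) _ _ m1 m2) => //.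
- by apply/seteqP; split => // w _; exists 0%N.
- by move=> C GC; rewrite /= /mrestr GB// /mscale qE muleC.
- by move=> k; rewrite /= /mrestr setTI; exact: le_lt_trans (probability_le1 _ mB) (ltry _).
Qed.

(** The product rule is extended from cylinders to sigma-algebras in one argument, then in the
    other. Two cylinders over disjoint families intersect in a cylinder over the union of the index
    sets, to which mutual independence applies. *)
Lemma independent_sigma_of (D E : set I) :
  mutually_independent Y -> D `&` E = set0 ->
  independent_maps Pr (id : Om -> sigma_of D) (id : Om -> sigma_of E).
Proof.
move=> indY DE0 A B /sigma_of_cylinders mA mB; rewrite !preimage_id.
have cylT F : cylinders F setT.
  by exists fset0, (fun=> setT); split => //; apply/seteqP; split.
have cm F := @cylinders_measurable F.
apply: (indep_extend (@cylinders_setI D) (cm D) (sigma_of_measurable mB)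
  (cylT D) _ mA) => {mA A} A cA.
rewrite setIC muleC.
apply: (indep_extend (@cylinders_setI E) (cm E) (cm D _ cA) (cylT E) _
  (sigma_of_cylinders mB)) => {mB}.
move=> {}B; case: cA => J [A' [JD mA' ->]] [K [B' [KE mB' ->]]].
have JK i : i \in J -> i \in K -> False.
  by move=> /JD Di /KE Ei; have : (D `&` E) i by []; rewrite DE0.
pose C i := if i \in J then A' i else B' i.
have -> : \bigcap_(i in [set` K]) (Y i @^-1` B' i) `&`
    \bigcap_(i in [set` J]) (Y i @^-1` A' i) =
    \bigcap_(i in [set` (J `|` K)%fset]) (Y i @^-1` C i).
  apply/seteqP; split => w.
    move=> [Kw Jw] i /=; rewrite in_fsetU /C; case: ifPn => [iJ _|_ /= iK].
      exact: Jw.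
    exact: Kw.
  move=> w_JK; split => i /= iJ; have := w_JK i; rewrite /= in_fsetU iJ ?orbT.
    by rewrite /C; case: ifPn => [/JK/(_ iJ)//|_ /(_ isT)].
  by rewrite /C iJ => /(_ isT).
rewrite !indY//; last by move=> i; rewrite /C; case: ifP.
rewrite (big_fsetID _ (mem J))/= muleC; congr (_ * _)%E.
  rewrite (_ : [fset _ | _ in _ & _]%fset = K); last first.
    apply/fsetP => i; rewrite !inE /=.
    by case: (boolP (i \in J)) => //= iJ; rewrite ?andbT ?andbF//; apply/esym/negP/JK.
  by apply: eq_big_seq => i iK; rewrite /C; case: ifPn => // /JK/(_ iK).
rewrite (_ : [fset _ | _ in _ & _]%fset = J); last first.
  by apply/fsetP => i; rewrite !inE /=; case: (i \in J); rewrite ?andbF.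
by apply: eq_big_seq => i iJ; rewrite /C iJ.
Qed.

End subfamilies.

(** * A maximal inequality for sample sums *)

Section log_sum_exp.
Context {R : realType}.

(** Inverting exp(-y) >= 1 - y gives exp(y) <= 1 / (1 - y), and (1 + y + 2 y^2)(1 - y) = 1 + y^2 (1
    - 2 y). *)
Lemma expR_le_quadratic (y : R) : y <= 2^-1 -> expR y <= 1 + y + 2 * y ^+ 2.
Proof.
move=> y_half; rewrite -[y in expR y]opprK expRN.
have e_ge : 1 - y <= expR (- y) by exact: expR_ge1Dx.
apply: (@le_trans _ _ (1 - y)^-1).
  by rewrite lef_pV2// posrE ?expR_gt0//; lra.
rewrite -[leLHS]mul1r ler_pdivrMr; last by lra.
have : 0 <= y ^+ 2 * (1 - 2 * y) by rewrite mulr_ge0 ?sqr_ge0//; lra.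
nra.
Qed.

Context {J : finType} (j0 : J).

(** The gradient of the log-sum-exp function at [x]. *)
Definition softmax (x : J -> R) (j : J) : R := expR (x j) / \sum_i expR (x i).

Lemma sum_expR_gt0 (x : J -> R) : 0 < \sum_i expR (x i).
Proof.
by rewrite (bigD1 j0)//= ltr_wpDr ?expR_gt0// sumr_ge0.
Qed.

Lemma softmaxE (x : J -> R) j :
  softmax x j = expR (x j - ln (\sum_i expR (x i))).
Proof. by rewrite expRB lnK// posrE sum_expR_gt0. Qed.

Lemma softmax_ge0 (x : J -> R) j : 0 <= softmax x j.
Proof. by rewrite /softmax divr_ge0 ?expR_ge0// ltW// sum_expR_gt0. Qed.

Lemma sum_softmax (x : J -> R) : \sum_j softmax x j = 1.
Proof. by rewrite -mulr_suml divff// gt_eqF// sum_expR_gt0. Qed.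

Lemma softmax_le1 (x : J -> R) j : softmax x j <= 1.
Proof.
rewrite -(sum_softmax x) (bigD1 j)//= lerDl sumr_ge0// => i _.
exact: softmax_ge0.
Qed.

(* The log-sum-exp function is smooth for the sup norm, uniformly in the number
   of coordinates. *)
Lemma ln_sum_expR_smooth (x y : J -> R) (b : R) : (forall j, `|y j| <= b) ->
  ln (\sum_j expR (x j + y j)) <=
  ln (\sum_j expR (x j)) + \sum_j softmax x j * y j + 4 * b ^+ 2.
Proof.
move=> yb; set Z := \sum_j expR (x j); set m := \sum_j softmax x j * y j.
have Z0 : 0 < Z := sum_expR_gt0 x.
have p0 := softmax_ge0 x; have p1 := sum_softmax x.
set W := \sum_j softmax x j * expR (y j).
have EZW : \sum_j expR (x j + y j) = Z * W.
  rewrite mulr_sumr; apply: eq_bigr => j _.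
  by rewrite expRD /softmax -/Z mulrA mulrCA divff ?gt_eqF// mulr1.
have b0 : 0 <= b by exact: le_trans (yb j0).
have W0 : 0 < W by rewrite -(pmulr_rgt0 _ Z0) -EZW sum_expR_gt0.
rewrite EZW lnM ?posrE// -addrA lerD2l.
have [b_half|b_half] := leP b 2^-1.
  have : W <= 1 + (m + 2 * b ^+ 2).
    rewrite (_ : 1 + _ = \sum_j softmax x j * (1 + y j + 2 * b ^+ 2)).
      apply: ler_sum => j _; rewrite ler_wpM2l//.
      have yj : y j <= b by rewrite (le_trans (ler_norm _)).
      apply: le_trans (expR_le_quadratic (le_trans yj b_half)) _.
      rewrite lerD2l ler_wpM2l// -real_normK ?num_real//.
      by rewrite lerXn2r ?nnegrE.
    under [RHS]eq_bigr do rewrite mulrDr mulrDr mulr1.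
    by rewrite !big_split/= -/m -[X in _ = _ + X]mulr_suml p1 mul1r addrA.
  move=> /le_trans-/(_ _ (expR_ge1Dx _)); rewrite -ler_ln ?posrE ?expR_gt0//.
  by rewrite expRK => /le_trans; apply; rewrite lerD2l ler_wpM2r ?sqr_ge0//; lra.
(* For b > 1/2 crude bounds are enough: both ln W and -m are at most b, and 2 b <= 4 b^2. *)
have Wb : W <= expR b.
  rewrite -[leRHS]mul1r -p1 mulr_suml; apply: ler_sum => j _.
  by rewrite ler_wpM2l// ler_expR (le_trans (ler_norm _)).
have mb : - b <= m.
  rewrite -[leLHS]mul1r -p1 mulr_suml; apply: ler_sum => j _.
  by rewrite ler_wpM2l// lerNl (le_trans _ (yb j))// -normrN ler_norm.
have : ln W <= b by rewrite -[leRHS]expRK ler_ln// posrE expR_gt0.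
nra.
Qed.

End log_sum_exp.

(** * Calculus of upper bounds on expectations *)

Section mean_bounds.
Context {R : realType} {d : measure_display} {T : measurableType d}.
Context (mu : probability T R).
Implicit Types (f g : T -> R) (a b k : R).

(** Integrability is part of the bound, so that bounds add and scale without side conditions. *)
Definition mean_le f a : Prop :=
  mu.-integrable setT (EFin \o f) /\ (\int[mu]_x (f x)%:E <= a%:E)%E.

Lemma mean_le_measurable f a : mean_le f a -> measurable_fun setT f.
Proof. by move=> [/integrableP[/measurable_EFinP]]. Qed.

Lemma mean_leW f a b : a <= b -> mean_le f a -> mean_le f b.
Proof. by move=> ab [fi fa]; split => //; rewrite (le_trans fa)// lee_fin. Qed.

Lemma mean_le_cst a : mean_le (cst a) a.
Proof.
split; first by apply: finite_measure_integrable_cst.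
rewrite [leLHS](integral_cst mu measurableT a%:E).
by have /= -> := probability_setT mu; rewrite mule1.
Qed.

Lemma mean_leD f g a b : mean_le f a -> mean_le g b ->
  mean_le (fun x => f x + g x) (a + b).
Proof.
move=> [fi fa] [gi gb]; split; first exact: (integrableD _ fi gi).
under eq_integral do rewrite EFinD.
by rewrite integralD// EFinD leeD.
Qed.

Lemma mean_leZ f a k : 0 <= k -> mean_le f a -> mean_le (fun x => k * f x) (k * a).
Proof.
move=> k0 [fi fa]; split; first exact: (integrableZl _ k fi).
under eq_integral do rewrite EFinM.
by rewrite integralZl// EFinM lee_wpmul2l ?lee_fin.
Qed.

Lemma mean_le_sum (I : Type) (s : seq I) (f : I -> T -> R) (a : I -> R) :
  (forall i, mean_le (f i) (a i)) ->
  mean_le (fun x => \sum_(i <- s) f i x) (\sum_(i <- s) a i).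
Proof.
move=> fa; elim: s => [|i s IHs].
  rewrite big_nil (_ : (fun _ => _) = cst 0); first exact: mean_le_cst.
  by apply/funext => x; rewrite big_nil.
rewrite big_cons (_ : (fun _ => _) = (fun x => f i x + \sum_(j <- s) f j x)).
  exact: mean_leD.
by apply/funext => x; rewrite big_cons.
Qed.

Lemma mean_le_dom f g a : measurable_fun setT g -> (forall x, `|g x| <= f x) ->
  mean_le f a -> mean_le g a.
Proof.
move=> mg gf [fi fa].
have gi : mu.-integrable setT (EFin \o g).
  apply: le_integrable fi => //; first exact/measurable_EFinP.
  by move=> x _; rewrite /= lee_fin (le_trans (gf x))// ler_norm.
split => //; apply: le_trans fa; apply: le_integral => // x _.
by rewrite /= lee_fin (le_trans (ler_norm _)).
Qed.

Lemma mean_le_ge0 f a : (forall x, 0 <= f x) -> mean_le f a -> 0 <= a.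
Proof.
move=> f0 [_ fa]; rewrite -lee_fin (le_trans _ fa)//.
by apply: integral_ge0 => x _; rewrite lee_fin.
Qed.

Lemma ge0_mean_leP f a : measurable_fun setT f -> (forall x, 0 <= f x) ->
  (\int[mu]_x (f x)%:E <= a%:E)%E -> mean_le f a.
Proof.
move=> mf f0 fa; split => //; apply/integrableP; split; first exact/measurable_EFinP.
under eq_integral do rewrite /= ger0_norm//.
exact: le_lt_trans fa (ltry _).
Qed.

Lemma mean_le_finite f : measurable_fun setT f -> (forall x, 0 <= f x) ->
  (\int[mu]_x (f x)%:E < +oo)%E -> exists a, mean_le f a.
Proof.
move=> mf f0 foo; exists (fine (\int[mu]_x (f x)%:E)); apply: ge0_mean_leP => //.
by rewrite fineK// ge0_fin_numE// integral_ge0// => x _; rewrite lee_fin.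
Qed.

End mean_bounds.

(** * Expectations of products of independent variables *)

Section independent_products.
Context {R : realType} {d1 d2 d' : measure_display}.
Context {T1 : measurableType d1} {T2 : measurableType d2}.
Context {Om : measurableType d'} (Pr : probability Om R).

Lemma ge0_integral_independent_mul (U : Om -> T1) (V : Om -> T2)
    (f : T1 -> R) (g : T2 -> R) :
  measurable_fun setT U -> measurable_fun setT V -> independent_maps Pr U V ->
  measurable_fun setT f -> measurable_fun setT g ->
  (forall x, 0 <= f x) -> (forall y, 0 <= g y) ->
  (\int[Pr]_w (f (U w) * g (V w))%:E =
   \int[Pr]_w (f (U w))%:E * \int[Pr]_w (g (V w))%:E)%E.
Proof.
move=> mU mV UV mf mg f0 g0.
pose h (z : T1 * T2) : \bar R := (f z.1 * g z.2)%:E.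
have mh : measurable_fun setT h.
  by apply/measurable_EFinP/measurable_funM; apply: measurableT_comp.
have h0 z : (0 <= h z)%E by rewrite lee_fin mulr_ge0.
have mfU : measurable_fun setT (fun w => (f (U w))%:E).
  by apply/measurable_EFinP; exact: measurableT_comp.
have mgV : measurable_fun setT (fun w => (g (V w))%:E).
  by apply/measurable_EFinP; exact: measurableT_comp.
have fU0 w : [set: Om] w -> (0 <= (f (U w))%:E)%E by rewrite lee_fin.
have gV0 w : [set: Om] w -> (0 <= (g (V w))%:E)%E by rewrite lee_fin.
have I0 : (0 <= \int[Pr]_w (g (V w))%:E)%E by exact: integral_ge0.
rewrite (ge0_integral_independent mU mV UV mh h0)/= -ge0_integralZr//.
by apply: eq_integral => w _; rewrite -ge0_integralZl// lee_fin.
Qed.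

(** The nonnegative case applied to absolute values yields integrability, after which Fubini's
    theorem applies to the product of the two laws. *)
Lemma integral_independent_mul (U : Om -> T1) (V : Om -> T2) (f : T1 -> R) (g : T2 -> R) :
  measurable_fun setT U -> measurable_fun setT V -> independent_maps Pr U V ->
  measurable_fun setT f -> measurable_fun setT g ->
  Pr.-integrable setT (EFin \o (f \o U)) -> Pr.-integrable setT (EFin \o (g \o V)) ->
  Pr.-integrable setT (EFin \o (fun w => f (U w) * g (V w))) /\
  (\int[Pr]_w (f (U w) * g (V w))%:E =
   \int[Pr]_w (f (U w))%:E * \int[Pr]_w (g (V w))%:E)%E.
Proof.
move=> mU mV UV mf mg fi gi.
have mUV : measurable_fun setT (fun w => (U w, V w)) by exact: measurable_fun_pair.
have hi : Pr.-integrable setT (EFin \o (fun w => f (U w) * g (V w))).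
  apply/integrableP; split.
    by apply/measurable_EFinP/measurable_funM; apply: measurableT_comp.
  under eq_integral do rewrite /= normrM.
  have mnf : measurable_fun setT (fun x => `|f x|) by exact: measurableT_comp.
  have mng : measurable_fun setT (fun y => `|g y|) by exact: measurableT_comp.
  rewrite (ge0_integral_independent_mul mU mV UV mnf mng)//.
  move/integrableP : fi => [_ /= fi]; move/integrableP : gi => [_ /= gi].
  by apply: lte_mul_pinfty; rewrite ?ge0_fin_numE ?integral_ge0.
split => //.
pose UX : {mfun Om >-> T1} := HB.pack U (isMeasurableFun.Build _ _ _ _ _ mU).
pose VX : {mfun Om >-> T2} := HB.pack V (isMeasurableFun.Build _ _ _ _ _ mV).
pose WX : {mfun Om >-> (T1 * T2)%type} :=
  HB.pack (fun w => (U w, V w)) (isMeasurableFun.Build _ _ _ _ _ mUV).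
pose m1 : probability T1 R := distribution Pr UX.
pose m2 : probability T2 R := distribution Pr VX.
pose m12 : probability (T1 * T2)%type R := distribution Pr WX.
have m12E X : measurable X -> (m1 \x m2)%E X = m12 X.
  by apply: product_measure_unique => A B mA mB; rewrite -UV.
pose h (z : T1 * T2) : \bar R := (f z.1 * g z.2)%:E.
have mh : measurable_fun setT h.
  by apply/measurable_EFinP/measurable_funM; apply: measurableT_comp.
have E12 : (\int[m12]_z h z = \int[Pr]_w (f (U w) * g (V w))%:E)%E.
  by rewrite integral_distribution.
rewrite -E12 (eq_measure_integral (m1 \x m2)%E); last first.
  by move=> A mA _; exact/esym/m12E.
rewrite -integral12_prod_meas1; last first.
  apply/integrableP; split => //.
  rewrite (eq_measure_integral m12); last by move=> A mA _; exact: m12E.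
  rewrite ge0_integral_distribution//; last exact: measurableT_comp.
  by have /integrableP[_] := hi.
have gi2 : m2.-integrable setT (EFin \o g).
  apply: integrable_pushforward => //; exact/measurable_EFinP.
have E2 : (\int[m2]_y (g y)%:E = \int[Pr]_w (g (V w))%:E)%E.
  by rewrite integral_distribution//; exact/measurable_EFinP.
have E1 : (\int[m1]_y (f y)%:E = \int[Pr]_w (f (U w))%:E)%E.
  by rewrite integral_distribution//; exact/measurable_EFinP.
have fi1 : m1.-integrable setT (EFin \o f).
  apply: integrable_pushforward => //; exact/measurable_EFinP.
rewrite -E1 -E2 -(fineK (integrable_fin_num _ gi2))// -integralZr//.
apply: eq_integral => x _; rewrite fineK ?(integrable_fin_num _ gi2)//.
by rewrite -integralZl.
Qed.

End independent_products.

(** * Sums over an i.i.d. sample *)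

Section iid_sums.
Context {R : realType} {d d' : measure_display}.
Context {Xi : measurableType d} {Om : measurableType d'}.
Context {P : probability Xi R} {Pr : probability Om R}.
Context {I : choiceType} (Y : I -> {RV Pr >-> Xi}).
Hypothesis indY : mutually_independent Y.
Hypothesis lawY : forall i A, measurable A -> distribution Pr (Y i) A = P A.

Lemma ge0_integral_sample i (f : Xi -> \bar R) :
  measurable_fun setT f -> (forall x, 0 <= f x)%E ->
  (\int[Pr]_w f (Y i w) = \int[P]_x f x)%E.
Proof.
move=> mf f0; rewrite -(ge0_integral_distribution (Y i))//.
by apply: eq_measure_integral => A mA _; exact: lawY.
Qed.

Lemma integrable_sample i (f : Xi -> R) : P.-integrable setT (EFin \o f) ->
  Pr.-integrable setT (EFin \o (f \o Y i)).
Proof.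
move=> /integrableP[mf fi]; apply/integrableP; split.
  exact: (measurableT_comp mf).
rewrite (@ge0_integral_sample i (fun x => `|(f x)%:E|%E))//.
exact: measurableT_comp.
Qed.

Lemma integral_sample i (f : Xi -> R) : P.-integrable setT (EFin \o f) ->
  (\int[Pr]_w (f (Y i w))%:E = \int[P]_x (f x)%:E)%E.
Proof.
move=> fi; rewrite -(integral_distribution (X := Y i) (f := EFin \o f)).
- by apply: eq_measure_integral => A mA _; exact: lawY.
- exact: measurable_int fi.
- exact: integrable_sample.
Qed.

Lemma mean_le_sample i f a : mean_le P f a -> mean_le Pr (fun w => f (Y i w)) a.
Proof.
by move=> [fi fa]; split; [exact: integrable_sample|rewrite integral_sample].
Qed.

Lemma independent_next (s : seq I) i : i \notin s ->
  independent_maps Pr (id : Om -> sigma_of Y [set` s]) (Y i).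
Proof.
move=> is_ A B mA mB; rewrite preimage_id.
have disj : [set` s] `&` [set i] = set0.
  by apply/seteqP; split => // j /= [js ji]; move: is_; rewrite -ji js.
have mYB : measurable (Y i @^-1` B : set (sigma_of Y [set i])).
  by apply: sub_sigma_algebra; exists i, B.
exact: (independent_sigma_of indY disj mA mYB).
Qed.

(** Stands in for conditioning on the samples in [s]: [S] may be any integrable function of them,
    and [Y i] is a fresh sample. *)
Lemma integral_mul_next (s : seq I) i (S : sigma_of Y [set` s] -> R) (f : Xi -> R) :
  i \notin s -> measurable_fun setT S -> Pr.-integrable [set: Om] (EFin \o S) ->
  P.-integrable setT (EFin \o f) ->
  Pr.-integrable [set: Om] (EFin \o (fun w => S w * f (Y i w))) /\
  (\int[Pr]_w (S w * f (Y i w))%:E =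
   \int[Pr]_w (S w)%:E * \int[P]_x (f x)%:E)%E.
Proof.
move=> is_ mS iS fi; rewrite -(integral_sample i fi).
apply: (integral_independent_mul _ _ (independent_next is_) mS) => //.
- exact: measurable_of_subfamily.
- by apply/measurable_EFinP; exact: measurable_int fi.
- exact: integrable_sample.
Qed.

Definition sample_sum (s : seq I) (f : Xi -> R) (w : Om) : R :=
  \sum_(i <- s) f (Y i w).

Lemma sample_sum_cons i s f w :
  sample_sum (i :: s) f w = f (Y i w) + sample_sum s f w.
Proof. by rewrite /sample_sum big_cons. Qed.

Lemma measurable_sample_sum (D : set I) s f : measurable_fun setT f ->
  {subset s <= D} ->
  measurable_fun [set: sigma_of Y D] (sample_sum s f : sigma_of Y D -> R).
Proof.
move=> mf sD; rewrite /sample_sum.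
have : {in s, forall i, D i} by move=> i /sD; rewrite inE.
elim: s {sD} => [_|i s IHs sD].
  rewrite (_ : (fun _ => _) = cst 0); first exact: measurable_cst.
  by apply/funext => w; rewrite big_nil.
rewrite (_ : (fun _ => _) = fun w => f (Y i w) + \sum_(j <- s) f (Y j w)).
  apply: measurable_funD.
    apply: measurableT_comp => //; apply: measurable_sample.
    by apply: sD; rewrite mem_head.
  by apply: IHs => j js; apply: sD; rewrite in_cons js orbT.
by apply/funext => w; rewrite big_cons.
Qed.

Lemma measurable_sample_sumT s f : measurable_fun setT f ->
  measurable_fun [set: Om] (sample_sum s f).
Proof.
move=> mf.
apply: (@measurable_fun_sigma_of _ _ _ _ _ _ _ Y setT).
by apply: measurable_sample_sum => // i _; rewrite inE.
Qed.

Lemma mean_le_sample_sum s f a : mean_le P f a ->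
  mean_le Pr (sample_sum s f) ((size s)%:R * a).
Proof.
move=> fa; rewrite (_ : (size s)%:R * a = \sum_(i <- s) a).
  by apply: (mean_le_sum s (f := fun i w => f (Y i w))) => i; exact: mean_le_sample.
by rewrite big_const_seq count_predT iter_addr_0 mulr_natl.
Qed.

End iid_sums.

(** * Maximal inequality for finitely many centered functions *)

Section sample_sum_bounds.
Context {R : realType} {d d' : measure_display}.
Context {Xi : measurableType d} {Om : measurableType d'}.
Context {P : probability Xi R} {Pr : probability Om R}.
Context {I : choiceType} {Y : I -> {RV Pr >-> Xi}}.
Hypothesis indY : mutually_independent Y.
Hypothesis lawY : forall i A, measurable A -> distribution Pr (Y i) A = P A.

Lemma mean_le_mul_centered (s : seq I) i (S : sigma_of Y [set` s] -> R) (f : Xi -> R) :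
  i \notin s -> measurable_fun setT S -> Pr.-integrable [set: Om] (EFin \o S) ->
  P.-integrable setT (EFin \o f) -> (\int[P]_x (f x)%:E = 0)%E ->
  mean_le Pr (fun w => S w * f (Y i w)) 0.
Proof.
move=> is_ mS iS fi f0; have [Sfi SfE] := integral_mul_next indY lawY is_ mS iS fi.
by split => //; rewrite SfE f0 mule0.
Qed.

Lemma integrable_of_square (f g : Xi -> R) v : measurable_fun setT f ->
  (forall x, `|f x| <= g x) -> mean_le P (fun x => g x ^+ 2) v ->
  P.-integrable setT (EFin \o f).
Proof.
move=> mf fg gv.
have [] : mean_le P f (1 + v) => //.
apply: mean_le_dom (mean_leD (mean_le_cst P 1) gv) => // x.
rewrite (le_trans (fg x))//= -subr_ge0.
have : 0 <= (g x - 2^-1) ^+ 2 by exact: sqr_ge0.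
nra.
Qed.

(** Induction on the samples, with [ln_sum_expR_smooth] at the sum of the earlier ones. The linear
    term is centered because the softmax weights depend on earlier samples only; the quadratic one
    costs [4 * v / t]. The zero function [f j0] keeps the potential nonnegative, hence integrable by
    domination. *)
Lemma mean_log_sum_exp (J : finType) (j0 : J) (f : J -> Xi -> R) (g : Xi -> R)
    (t v : R) (s : seq I) :
  0 < t -> (forall j, measurable_fun setT (f j)) ->
  (forall j x, `|f j x| <= g x) -> (forall j, \int[P]_x (f j x)%:E = 0)%E ->
  (forall x, f j0 x = 0) -> mean_le P (fun x => g x ^+ 2) v -> uniq s ->
  mean_le Pr (fun w => t * ln (\sum_j expR (sample_sum Y s (f j) w / t)))
    (t * ln #|J|%:R + (size s)%:R * (4 * v / t)).
Proof.
move=> t0 mf fg f0 fj0 gv; elim: s => [_|i s IHs /= /andP[is_ us]].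
  rewrite mul0r addr0 (_ : (fun _ => _) = cst (t * ln #|J|%:R)).
    exact: mean_le_cst.
  apply/funext => w /=; congr (t * ln _).
  under eq_bigr do rewrite /sample_sum big_nil mul0r expR0.
  by rewrite sumr_const.
pose x (w : Om) j := sample_sum Y s (f j) w / t.
have mx (D : set I) j : {subset s <= D} ->
    measurable_fun [set: sigma_of Y D] (fun w : sigma_of Y D => x w j).
  by move=> sD; apply: measurable_funM => //; exact: measurable_sample_sum.
have msum (D : set I) (h : J -> sigma_of Y D -> R) :
    (forall j, measurable_fun setT (h j)) ->
    measurable_fun setT (fun w => \sum_j h j w) by exact: measurable_sum.
have mZ (D : set I) : {subset s <= D} -> measurable_fun [set: sigma_of Y D]
    (fun w : sigma_of Y D => ln (\sum_j expR (x w j))).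
  move=> sD; apply: measurableT_comp => //; apply: msum => j.
  by apply: measurableT_comp => //; exact: mx.
have mp j : measurable_fun [set: sigma_of Y [set` s]]
    (fun w : sigma_of Y [set` s] => softmax (x w) j).
  rewrite (_ : (fun _ => _) =
    (fun w : sigma_of Y [set` s] => expR (x w j - ln (\sum_j expR (x w j))))).
    have sD : {subset s <= [set` s]} by move=> k; rewrite inE.
    by apply: measurableT_comp => //; apply: measurable_funB; [exact: mx|exact: mZ].
  by apply/funext => w; rewrite (softmaxE j0).
have ip j : Pr.-integrable [set: Om] (EFin \o (fun w => softmax (x w) j)).
  have [] : mean_le Pr (fun w => softmax (x w) j) 1 => //.
  apply: mean_le_dom (mean_le_cst Pr 1) => [|w /=]; last first.
    by rewrite ger0_norm ?softmax_le1 ?softmax_ge0.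
  exact: measurable_fun_sigma_of (mp j).
have cross : mean_le Pr (fun w => \sum_j softmax (x w) j * f j (Y i w)) 0.
  rewrite -[X in mean_le _ _ X](_ : \sum_(j : J) 0 = 0); last by rewrite big1.
  apply: mean_le_sum => j; apply: (mean_le_mul_centered is_ (mp j)) => //.
  exact: integrable_of_square (mf j) (fg j) gv.
have quad : mean_le Pr (fun w => 4 / t * g (Y i w) ^+ 2) (4 / t * v).
  apply: mean_leZ; first by rewrite divr_ge0// ltW.
  exact: (mean_le_sample lawY i gv).
have := mean_leD (mean_leD (IHs us) cross) quad.
rewrite addr0 -addrA (_ : (size s)%:R * _ + _ = (size s).+1%:R * (4 * v / t)).
  2: by rewrite -natr1; ring.
apply: mean_le_dom => [|w].
  apply: measurable_funM => //; apply: measurableT_comp => //.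
  apply: measurable_sum => j; apply: measurableT_comp => //.
  by apply: measurable_funM => //; exact: measurable_sample_sumT.
have Phi0 : 0 <= t * ln (\sum_j expR (sample_sum Y (i :: s) (f j) w / t)).
  rewrite mulr_ge0 ?(ltW t0)// ln_ge0// (bigD1 j0)//=.
  rewrite [X in expR (X / t)](_ : _ = 0) ?mul0r ?expR0 ?lerDl ?sumr_ge0//.
  by rewrite /sample_sum big1.
rewrite ger0_norm//.
have fgt j : `|f j (Y i w) / t| <= g (Y i w) / t.
  by rewrite normrM (ger0_norm (x := t^-1)) ?invr_ge0 ?(ltW t0)// ler_wpM2r ?invr_ge0 ?(ltW t0).
have := ln_sum_expR_smooth j0 (x w) fgt.
rewrite -(ler_pM2l t0) => smooth.
under eq_bigr do rewrite sample_sum_cons mulrDl addrC.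
apply: (le_trans smooth); rewrite !mulrDr -addrA -[leRHS]addrA lerD2l lerD//.
  rewrite mulr_sumr; apply: ler_sum => j _.
  by rewrite [f j (Y i w) / t]mulrC mulrCA mulVKf ?gt_eqF.
rewrite (_ : t * _ = 4 / t * g (Y i w) ^+ 2)//.
by rewrite exprMn; field; rewrite gt_eqF.
Qed.

(* The square-root of the sample size times the logarithm of the number of
   functions comes out after optimizing over [t]. *)
Lemma maximal_inequality (J : finType) (f : J -> Xi -> R) (g : Xi -> R)
    (t v : R) (s : seq I) :
  0 < t -> (forall x, 0 <= g x) -> (forall j, measurable_fun setT (f j)) ->
  (forall j x, `|f j x| <= g x) -> (forall j, \int[P]_x (f j x)%:E = 0)%E ->
  mean_le P (fun x => g x ^+ 2) v -> uniq s ->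
  exists2 M : Om -> R,
    mean_le Pr M (t * ln (1 + #|J|.*2)%:R + (size s)%:R * (4 * v / t)) &
    forall j w, `|sample_sum Y s (f j) w| <= M w.
Proof.
move=> t0 g0 mf fg f0 gv us.
(* Both signs of each function turn absolute values into plain maxima, and [None] supplies the zero
   function. *)
pose h (k : option (J * bool)) x : R :=
  if k is Some (j, b) then (-1) ^+ b * f j x else 0.
have hf j w : sample_sum Y s (h (Some (j, false))) w = sample_sum Y s (f j) w.
  by apply: eq_bigr => i _; rewrite /h expr0 mul1r.
have hfN j w : sample_sum Y s (h (Some (j, true))) w = - sample_sum Y s (f j) w.
  by rewrite -sumrN; apply: eq_bigr => i _; rewrite /h expr1 mulN1r.
exists (fun w => t * ln (\sum_k expR (sample_sum Y s (h k) w / t))).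
  rewrite (_ : (1 + _)%N = #|{: option (J * bool)}|); last first.
    by rewrite card_option card_prod card_bool muln2.
  apply: (mean_log_sum_exp (j0 := None) (g := g)) => //.
  - case=> [[j b]|]; last exact: measurable_cst.
    by apply: measurable_funM => //; exact: measurable_cst.
  - case=> [[j b]|] x; first by rewrite /h normrM normrX normrN1 expr1n mul1r.
    by rewrite normr0.
  - case=> [[j b]|] /=; last by rewrite integral0.
    under eq_integral do rewrite EFinM.
    rewrite integralZl// ?f0 ?mule0//.
    exact: integrable_of_square (mf j) (fg j) gv.
move=> j w.
have Mk k : sample_sum Y s (h k) w <= t * ln (\sum_k expR (sample_sum Y s (h k) w / t)).
  rewrite -ler_pdivrMl// mulrC -[leLHS]expRK ler_ln ?posrE ?expR_gt0 ?sum_expR_gt0//.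
  by rewrite (bigD1 k)//= lerDl sumr_ge0.
by rewrite ler_norml lerNl -hfN -hf !Mk.
Qed.

End sample_sum_bounds.

(** * Second and fourth moments of centered sums *)

Section sample_sum_moments.
Context {R : realType} {d d' : measure_display}.
Context {Xi : measurableType d} {Om : measurableType d'}.
Context {P : probability Xi R} {Pr : probability Om R}.
Context {I : choiceType} {Y : I -> {RV Pr >-> Xi}}.
Hypothesis indY : mutually_independent Y.
Hypothesis lawY : forall i A, measurable A -> distribution Pr (Y i) A = P A.

Lemma mean_le_mul_next (s : seq I) i (S : sigma_of Y [set` s] -> R) (f : Xi -> R) a b :
  i \notin s -> measurable_fun setT S ->
  (forall w, 0 <= S w) -> (forall x, 0 <= f x) ->
  mean_le Pr (S : Om -> R) a -> mean_le P f b ->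
  mean_le Pr (fun w => S w * f (Y i w)) (a * b).
Proof.
move=> is_ mS S0 f0 [Si Sa] [fi fb].
have [Sfi SfE] := integral_mul_next indY lawY is_ mS Si fi.
split => //; rewrite SfE EFinM lee_pmul//.
  by apply: integral_ge0 => w _; rewrite lee_fin.
by apply: integral_ge0 => x _; rewrite lee_fin.
Qed.

Context (f : Xi -> R) (v2 v4 : R).
Hypothesis mf : measurable_fun setT f.
Hypothesis f0 : (\int[P]_x (f x)%:E = 0)%E.
Hypothesis fv2 : mean_le P (fun x => f x ^+ 2) v2.

Let fi : P.-integrable setT (EFin \o f).
Proof.
apply: (integrable_of_square mf (fun x => lexx `|f x|) (v := v2)).
by under eq_fun do rewrite real_normK ?num_real//.
Qed.

Let mS (s : seq I) : measurable_fun [set: sigma_of Y [set` s]]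
  (sample_sum Y s f : sigma_of Y [set` s] -> R).
Proof. by apply: measurable_sample_sum => // i; rewrite inE. Qed.

Lemma sample_sum_moment2 s : uniq s ->
  mean_le Pr (fun w => sample_sum Y s f w ^+ 2) ((size s)%:R * v2).
Proof.
elim: s => [_|i s IHs /= /andP[is_ us]].
  rewrite mul0r (_ : (fun _ => _) = cst 0); first exact: mean_le_cst.
  by apply/funext => w; rewrite /sample_sum big_nil expr0n.
have Sint : Pr.-integrable [set: Om] (EFin \o sample_sum Y s f).
  have [] : mean_le Pr (sample_sum Y s f) (1 + (size s)%:R * v2) => //.
  apply: mean_le_dom (mean_leD (mean_le_cst Pr 1) (IHs us)) => [|w /=].
    exact: measurable_sample_sumT.
  set S := sample_sum _ _ _ _; rewrite -(real_normK (num_real S)) -subr_ge0.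
  have : 0 <= (`|S| - 2^-1) ^+ 2 by exact: sqr_ge0.
  nra.
have cross := mean_le_mul_centered indY lawY is_ (@mS s) Sint fi f0.
have sq := mean_le_sample lawY i fv2.
have := mean_leD (mean_leD (IHs us) (mean_leZ (ler0n R 2) cross)) sq.
rewrite mulr0 addr0 -{2}[v2]mul1r -mulrDl natr1.
apply: mean_le_dom => [|w].
  by apply: measurable_funX; exact: measurable_sample_sumT.
rewrite ger0_norm ?sqr_ge0// sample_sum_cons le_eqVlt; apply/orP; left; apply/eqP.
by ring.
Qed.

Hypothesis fv4 : mean_le P (fun x => f x ^+ 4) v4.

(** In (S + y)^4 the term 4 S^3 y is centered and 4 S y^3 <= 2 S^2 y^2 + 2 y^4, which leaves S^4 + 8
    S^2 y^2 + 3 y^4. As S^2 has mean at most n v2, the increment 8 n v2^2 + 3 v4 is covered by the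
    growth of n^2 (4 v2^2 + 3 v4). *)
Lemma sample_sum_moment4 s : uniq s ->
  mean_le Pr (fun w => sample_sum Y s f w ^+ 4)
    ((size s)%:R ^+ 2 * (4 * v2 ^+ 2 + 3 * v4)).
Proof.
have v20 : 0 <= v2 by apply: mean_le_ge0 fv2 => x; exact: sqr_ge0.
have v40 : 0 <= v4 by apply: mean_le_ge0 fv4 => x; rewrite exprn_even_ge0.
elim: s => [_|i s IHs /= /andP[is_ us]].
  rewrite expr0n mul0r (_ : (fun _ => _) = cst 0); first exact: mean_le_cst.
  by apply/funext => w; rewrite /sample_sum big_nil expr0n.
have Sint : Pr.-integrable [set: Om] (EFin \o (fun w => sample_sum Y s f w ^+ 3)).
  have [] : mean_le Pr (fun w => sample_sum Y s f w ^+ 3)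
    (1 + (size s)%:R ^+ 2 * (4 * v2 ^+ 2 + 3 * v4)) => //.
  apply: mean_le_dom (mean_leD (mean_le_cst Pr 1) (IHs us)) => [|w /=].
    by apply: measurable_funX; exact: measurable_sample_sumT.
  set S := sample_sum _ _ _ _.
  rewrite normrX (_ : S ^+ 4 = `|S| ^+ 4); last first.
    by rewrite -normrX ger0_norm// exprn_even_ge0.
  have u0 := normr_ge0 S; have u3 := exprn_ge0 3 u0.
  have [u1|u1] := leP `|S| 1.
    by rewrite (le_trans (exprn_ile1 3 u0 u1))// lerDl exprn_ge0.
  by rewrite [in leRHS]exprSr; nra.
have cross := mean_le_mul_centered indY lawY is_
  (measurable_funX 3 (@mS s)) Sint fi f0.
have quad := mean_le_mul_next is_ (measurable_funX 2 (@mS s))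
  (fun w => sqr_ge0 _) (fun x => sqr_ge0 _) (sample_sum_moment2 us) fv2.
have quart := mean_le_sample lawY i fv4.
have := mean_leD (mean_leD (mean_leD (IHs us) (mean_leZ (ler0n R 4) cross))
  (mean_leZ (ler0n R 8) quad)) (mean_leZ (ler0n R 3) quart).
move=> /(mean_leW (b := (size s).+1%:R ^+ 2 * (4 * v2 ^+ 2 + 3 * v4))) H.
apply: mean_le_dom (H _) => [|w|].
- by apply: measurable_funX; exact: measurable_sample_sumT.
- rewrite ger0_norm ?exprn_even_ge0// sample_sum_cons.
  move: (f (Y i w)) (sample_sum Y s f w) => y S.
  rewrite -subr_ge0 [leRHS](_ : _ = 2 * y ^+ 2 * (S - y) ^+ 2); last by ring.
  by rewrite mulr_ge0 ?sqr_ge0// mulr_ge0 ?sqr_ge0.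
- rewrite -natr1; set n : R := (size s)%:R.
  have n0 : 0 <= n by exact: ler0n.
  have : 0 <= n * v4 by exact: mulr_ge0.
  have : 0 <= v2 ^+ 2 by exact: sqr_ge0.
  nra.
Qed.

End sample_sum_moments.

(** * Euclidean geometry and projections *)

Section euclidean_geometry.
Context {R : realType} {m : nat}.
Implicit Types (x y z : 'rV[R]_m) (a : R).

Lemma coordB x y i : (x - y) 0 i = x 0 i - y 0 i.
Proof. by rewrite !mxE. Qed.

Lemma innerC x y : inner x y = inner y x.
Proof. by apply: eq_bigr => i _; rewrite mulrC. Qed.

Lemma innerDl x y z : inner (x + y) z = inner x z + inner y z.
Proof. by rewrite -big_split; apply: eq_bigr => i _; rewrite mxE mulrDl. Qed.

Lemma innerZl a x y : inner (a *: x) y = a * inner x y.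
Proof. by rewrite mulr_sumr; apply: eq_bigr => i _; rewrite mxE mulrA. Qed.

Lemma innerNl x y : inner (- x) y = - inner x y.
Proof. by rewrite -scaleN1r innerZl mulN1r. Qed.

Lemma innerBl x y z : inner (x - y) z = inner x z - inner y z.
Proof. by rewrite innerDl innerNl. Qed.

Lemma innerDr x y z : inner x (y + z) = inner x y + inner x z.
Proof. by rewrite innerC innerDl !(innerC x). Qed.

Lemma innerZr a x y : inner x (a *: y) = a * inner x y.
Proof. by rewrite innerC innerZl innerC. Qed.

Lemma innerNr x y : inner x (- y) = - inner x y.
Proof. by rewrite innerC innerNl innerC. Qed.

Lemma innerBr x y z : inner x (y - z) = inner x y - inner x z.
Proof. by rewrite innerDr innerNr. Qed.

Lemma innerr0 x : inner x 0 = 0.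
Proof. by rewrite -(scale0r 0) innerZr mul0r. Qed.

Definition innerE := (innerBl, innerBr, innerDl, innerDr, innerNl, innerNr, innerZl, innerZr).

Lemma inner_ge0 x : 0 <= inner x x.
Proof. by apply: sumr_ge0 => i _; rewrite -expr2 sqr_ge0. Qed.

Lemma norm2_ge0 x : 0 <= norm2 x.
Proof. exact: sqrtr_ge0. Qed.

Lemma sqr_norm2 x : norm2 x ^+ 2 = inner x x.
Proof. by rewrite sqr_sqrtr// inner_ge0. Qed.

Lemma sqr_norm2_subZ a x y :
  norm2 (x - a *: y) ^+ 2 = norm2 x ^+ 2 - 2 * a * inner y x + a ^+ 2 * norm2 y ^+ 2.
Proof. by rewrite !sqr_norm2 !innerE (innerC x y); ring. Qed.

Lemma norm2_0 : norm2 (0 : 'rV[R]_m) = 0.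
Proof. by rewrite /norm2 -(scale0r 0) innerZl mul0r sqrtr0. Qed.

Lemma norm2_eq0 x : norm2 x = 0 -> x = 0.
Proof.
move=> x0; apply/rowP => i; rewrite mxE.
have : inner x x = 0 by rewrite -sqr_norm2 x0 expr0n.
move/eqP; rewrite psumr_eq0; last by move=> j _; rewrite -expr2 sqr_ge0.
by move=> /allP/(_ i (mem_index_enum i))/=; rewrite mulf_eq0 orbb => /eqP.
Qed.

Lemma norm2Z a x : norm2 (a *: x) = `|a| * norm2 x.
Proof. by rewrite /norm2 innerZl innerZr mulrA -expr2 sqrtrM ?sqr_ge0// sqrtr_sqr. Qed.

Lemma norm2N x : norm2 (- x) = norm2 x.
Proof. by rewrite -scaleN1r norm2Z normrN1 mul1r. Qed.

Lemma norm2_distC x y : norm2 (x - y) = norm2 (y - x).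
Proof. by rewrite -norm2N opprB. Qed.

Lemma inner_le x y : inner x y <= norm2 x * norm2 y.
Proof.
have [x0|x0] := eqVneq (norm2 x) 0.
  by rewrite x0 mul0r (norm2_eq0 x0) -(scale0r 0) innerZl mul0r.
have [y0|y0] := eqVneq (norm2 y) 0.
  by rewrite y0 mulr0 (norm2_eq0 y0) -(scale0r 0) innerZr mul0r.
have nx : 0 < norm2 x by rewrite lt0r x0 norm2_ge0.
have ny : 0 < norm2 y by rewrite lt0r y0 norm2_ge0.
have := inner_ge0 (norm2 y *: x - norm2 x *: y).
rewrite !innerE -!sqr_norm2 (innerC y x).
set p := inner x y; move: (norm2 x) (norm2 y) nx ny => u v u0 v0.
move=> h; have {h} : 0 <= (u * v) * (2 * (u * v - p)) by move: h; congr (0 <= _); ring.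
by rewrite pmulr_rge0 ?mulr_gt0// pmulr_rge0// subr_ge0.
Qed.

Lemma norm_inner_le x y : `|inner x y| <= norm2 x * norm2 y.
Proof. by rewrite ler_norml inner_le andbT lerNl -innerNl (le_trans (inner_le _ _))// norm2N. Qed.

Lemma norm2D x y : norm2 (x + y) <= norm2 x + norm2 y.
Proof.
rewrite -(@ler_pXn2r _ 2)// ?nnegrE ?addr_ge0 ?norm2_ge0// sqr_norm2 !innerE.
by rewrite -!sqr_norm2 (innerC y x); have := inner_le x y; nra.
Qed.

Lemma norm2_triangle z x y : norm2 (x - y) <= norm2 (x - z) + norm2 (z - y).
Proof. by rewrite (le_trans _ (norm2D _ _))// addrA subrK. Qed.

Lemma norm2B x y : norm2 (x - y) <= norm2 x + norm2 y.
Proof. by rewrite (le_trans (norm2D _ _))// norm2N. Qed.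

Lemma coord_le_norm2 x i : `|x 0 i| <= norm2 x.
Proof.
rewrite -(@ler_pXn2r _ 2)// ?nnegrE ?norm2_ge0// sqr_norm2 real_normK ?num_real//.
rewrite /inner (bigD1 i)//= expr2 lerDl sumr_ge0// => j _.
by rewrite -expr2 sqr_ge0.
Qed.

Lemma norm2_le_sum x : norm2 x <= \sum_i `|x 0 i|.
Proof.
rewrite -(@ler_pXn2r _ 2)// ?nnegrE ?norm2_ge0// ?sumr_ge0//.
rewrite sqr_norm2 expr2 mulr_suml; apply: ler_sum => i _.
rewrite (le_trans (ler_norm _))// normrM ler_wpM2l//.
by rewrite (bigD1 i)//= lerDl sumr_ge0.
Qed.

Lemma mx_norm_le x a : 0 <= a -> (forall i, `|x 0 i| <= a) -> `|x| <= a.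
Proof.
move=> a0 xa; rewrite [leLHS]/Num.norm /= mx_normrE.
by apply/bigmax_leP; split=> // -[i j] _ /=; rewrite (ord1 i).
Qed.

Lemma mx_norm_le_norm2 x : `|x| <= norm2 x.
Proof. by apply: mx_norm_le; [exact: norm2_ge0|exact: coord_le_norm2]. Qed.

Lemma coord_le_mx_norm x i : `|x 0 i| <= `|x|.
Proof.
rewrite [leRHS]/Num.norm /= mx_normrE.
by apply: (le_bigmax _ (fun i : 'I_1 * 'I_m => `|x i.1 i.2|) (0, i)).
Qed.

Lemma norm2_le_mx_norm x : norm2 x <= m%:R * `|x|.
Proof.
apply: le_trans (norm2_le_sum x) _.
rewrite -[m in m%:R]card_ord mulr_natl -sumr_const.
by apply: ler_sum => i _; exact: coord_le_mx_norm.
Qed.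

End euclidean_geometry.

(** * Euclidean projection onto a closed convex set *)

Section projection.
Context {R : realType} {m : nat}.
Implicit Types (x y z w : 'rV[R]_m) (a : R).

Lemma norm2_cvg {T : Type} (F : set_system T) {FF : Filter F}
    (f : T -> 'rV[R]_m) x :
  norm2 (f t - x) @[t --> F] --> (0 : R) -> f @ F --> x.
Proof.
move=> /cvgr0Pnorm_lt fx; apply/cvgrPdist_lt => e e0.
near=> t; rewrite distrC; apply: le_lt_trans (mx_norm_le_norm2 _) _.
rewrite -[ltLHS]ger0_norm ?norm2_ge0//.
by near: t; exact: fx.
Unshelve. all: by end_near. Qed.

Lemma cvg_norm2 {T : Type} (F : set_system T) {FF : Filter F}
    (f : T -> 'rV[R]_m) x :
  f @ F --> x -> norm2 (f t - x) @[t --> F] --> (0 : R).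
Proof.
move=> /cvgrPdist_lt fx; apply/cvgr0Pnorm_lt => e e0.
near=> t; rewrite ger0_norm ?norm2_ge0//.
(* The dimension may be zero, hence the divisor [m.+1]. *)
have m0 : 0 < m.+1%:R :> R by rewrite ltr0n.
apply: le_lt_trans (norm2_le_mx_norm _) _.
apply: (@le_lt_trans _ _ (m.+1%:R * `|f t - x|)).
  by rewrite ler_wpM2r// ler_nat.
rewrite -ltr_pdivlMl// distrC mulrC.
by near: t; apply: fx; rewrite divr_gt0.
Unshelve. all: by end_near. Qed.

Lemma cvg_norm2_nbhs x : norm2 (y - x) @[y --> x] --> (0 : R).
Proof. exact: (@cvg_norm2 _ (nbhs x) (nbhs_filter x) id x (@cvg_id _ _)). Qed.

Lemma continuous_norm2_dist y : continuous (fun z => norm2 (y - z)).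
Proof.
move=> x; apply/(@cvgrPdist_lt _ _ _ (nbhs x)) => e e0.
have /cvgr0Pnorm_lt/(_ e e0) := cvg_norm2_nbhs x.
apply: filterS => z; apply: le_lt_trans; rewrite [leRHS]ger0_norm ?norm2_ge0//.
rewrite ler_norml lerBlDr lerBrDr.
have := norm2_triangle z y x; have := norm2_triangle x y z.
rewrite (norm2_distC x z); move: (norm2 _) (norm2 _) (norm2 _) => p q r.
lra.
Qed.

Context {X : set 'rV[R]_m}.
Hypotheses (X0 : X !=set0) (closedX : closed X) (convexX : convex_set X).

Lemma convex_set_comb a x y : 0 <= a <= 1 -> X x -> X y -> X (a *: x + (1 - a) *: y).
Proof.
move=> /andP[a0 a1] Xx Xy.
have := @convexX x y (Itv01 a0 a1); rewrite !inE; exact.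
Qed.

(** The distance attains its minimum on the compact set of points of [X] no farther from [y] than
    [w0]; the other points of [X] are farther. *)
Lemma projP y : X (proj X y) /\ forall w, X w -> norm2 (y - proj X y) <= norm2 (y - w).
Proof.
suff /(xgetPex 0) : exists z, X z /\ forall w, X w -> norm2 (y - z) <= norm2 (y - w) by [].
have [w0 Xw0] := X0.
pose A := X `&` [set z | norm2 (y - z) <= norm2 (y - w0)].
have cont := @continuous_norm2_dist y.
have cA : compact A.
  apply: bounded_closed_compact.
    exists (norm2 (y - w0) + norm2 y); split; first exact: num_real.
    move=> M ltM z [_ /= zA]; apply: le_trans (mx_norm_le_norm2 _) _.
    rewrite (le_trans _ (ltW ltM))// -(subrK y z) (le_trans (norm2D _ _))// lerD2r.
    by rewrite (@norm2_distC R m z y).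
  apply: closedI => //; apply: closed_comp (@closed_le R (norm2 (y - w0))) => z _.
  exact: cont.
have [|z] := EVT_min_rV _ cA (continuous_subspaceT cont).
  by exists w0; split => /=.
rewrite inE => -[Xz zA] zmin; exists z; split => // w Xw.
have [wA|/ltW wA] := leP (norm2 (y - w)) (norm2 (y - w0)).
  by apply: zmin; rewrite inE.
exact: le_trans wA.
Qed.

Lemma proj_in y : X (proj X y). Proof. by have [] := projP y. Qed.

Lemma proj_inner y w : X w -> inner (y - proj X y) (w - proj X y) <= 0.
Proof.
move=> Xw; have [Xp pmin] := projP y; set p := proj X y in Xp pmin *.
set c := inner _ _; rewrite leNgt; apply/negP => c0.
pose D := norm2 (w - p) ^+ 2; have D0 : 0 <= D by exact: sqr_ge0.
have cD : 0 < c + D by rewrite ltr_wpDr.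
(* Moving from [p] towards [w] by [t], optimality gives 2 c <= t D, whereas this t lies in (0, 1]
   and satisfies t D <= c, even when D = 0. *)
pose t := c / (c + D).
have t0 : 0 < t by rewrite divr_gt0.
have t1 : t <= 1 by rewrite ler_pdivrMr// mul1r lerDl.
have Xt : X (t *: w + (1 - t) *: p) by apply: convex_set_comb; rewrite ?(ltW t0).
have := pmin _ Xt.
rewrite -(@ler_pXn2r _ 2)// ?nnegrE ?norm2_ge0// !sqr_norm2.
rewrite (_ : y - (_ + _) = (y - p) - t *: (w - p)); last first.
  rewrite scalerBr scalerBl scale1r !opprD !opprK !addrA; congr (_ + _).
  by rewrite -!addrA; congr (_ + _); rewrite addrC.
move: (y - p) (w - p) @c @D @t c0 D0 cD t0 t1 Xt => u v c D t c0 D0 cD t0 t1 _.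
rewrite !innerE (innerC v u) -/c -[inner v v]sqr_norm2 -/D => h.
have {h} : 2 * c <= t * D.
  rewrite -(ler_pM2l t0); move: h; rewrite -subr_ge0 => h.
  by rewrite -subr_ge0; move: h; congr (0 <= _); ring.
rewrite /t mulrAC ler_pdivlMr//; nra.
Qed.

Lemma proj_id x : X x -> proj X x = x.
Proof.
move=> Xx; have [_ /(_ x Xx)] := projP x; rewrite subrr norm2_0 => h.
apply/eqP; rewrite eq_sym -subr_eq0; apply/eqP/norm2_eq0/eqP.
by rewrite eq_le h norm2_ge0.
Qed.

Lemma proj_nonexpansive y z : norm2 (proj X y - proj X z) <= norm2 (y - z).
Proof.
have := proj_inner y (proj_in z); have := proj_inner z (proj_in y).
set p := proj X y; set q := proj X z.
have [->|pq0] := eqVneq (norm2 (p - q)) 0; first by rewrite norm2_ge0.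
have {pq0} pq0 : 0 < norm2 (p - q) by rewrite lt0r pq0 norm2_ge0.
move=> h1 h2; rewrite -(ler_pM2r pq0) -expr2 sqr_norm2.
apply: le_trans (inner_le (y - z) (p - q)).
have -> : y - z = (y - p) + (p - q) - (z - q) by rewrite addrA subrK opprB addrA subrK.
move: h2; rewrite -(opprB p q) innerNr oppr_le0 => h2.
rewrite [leRHS]innerBl [X in _ <= X - _]innerDl; move: h1 h2.
by move: (inner (z - q) _) (inner (y - p) _) (inner (p - q) _) => a b c; lra.
Qed.

Lemma proj_dist_le y z : X z -> norm2 (proj X y - z) <= norm2 (y - z).
Proof. by move=> Xz; rewrite -{1}(proj_id Xz) proj_nonexpansive. Qed.

Lemma continuous_proj : continuous (proj X).
Proof.
move=> x; apply: (@norm2_cvg _ (nbhs x) _ (proj X) (proj X x)).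
apply: (squeeze_cvgr _ (cvg_cst 0) (@cvg_norm2_nbhs x)).
by near=> y; rewrite norm2_ge0 proj_nonexpansive.
Unshelve. all: by end_near. Qed.

End projection.

(** * Borel measurability of vector-valued maps *)

Section borel_vectors.
Context {R : realType} {m : nat} {d : measure_display} {T : measurableType d}.

Lemma continuous_measurable_rV (g : 'rV[R]_m -> R) : continuous g ->
  measurable_fun [set: borel_rV R m] (g : borel_rV R m -> R).
Proof.
move=> /continuousP cg; apply: (measurability _ (RGenOpens.measurableE R)).
move=> _ [_ [a [b ->] <-]]; rewrite setTI; apply: sub_sigma_algebra.
exact/cg/interval_open.
Qed.

Lemma continuous_measurable_rV2 (g : 'rV[R]_m -> 'rV[R]_m) : continuous g ->
  measurable_fun [set: borel_rV R m] (g : borel_rV R m -> borel_rV R m).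
Proof.
move=> /continuousP cg; apply: (@measurability _ _ _ (borel_rV R m) _ _ open erefl) => _ [U oU <-].
by rewrite setTI; apply: sub_sigma_algebra; exact: cg.
Qed.

Lemma measurable_coord i : measurable_fun [set: borel_rV R m]
  (fun x : borel_rV R m => x 0 i : R).
Proof. by apply: continuous_measurable_rV; exact: coord_continuous. Qed.

(* Open sets are countable unions of boxes with rational centers and radii. *)
Lemma measurable_rowvec (f : T -> borel_rV R m) :
  (forall i, measurable_fun setT (fun t => f t 0 i : R)) -> measurable_fun setT f.
Proof.
move=> mf; apply: (@measurability _ _ _ (borel_rV R m) _ _ open erefl).
move=> _ [U oU <-]; rewrite setTI.
pose box (c : {ffun 'I_m -> rat} * rat) : set 'rV[R]_m :=
  [set y | forall i, `|y 0 i - ratr (c.1 i)| < ratr c.2].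
have -> : U = \bigcup_(c in [set c | box c `<=` U]) box c.
  apply/seteqP; split => [y Uy|y [c]]; last by move=> /= /[apply].
  have /nbhs_normP[e /= e0 yeU] : nbhs y U by exact: open_nbhs_nbhs.
  have /rat_in_itvoo[r] : 0 < e / 2 by rewrite divr_gt0.
  rewrite in_itv/= => /andP[r0 re].
  have qP i : exists q : rat, `|y 0 i - ratr q| < ratr r.
    have /rat_in_itvoo[q] : y 0 i - ratr r < y 0 i + ratr r by lra.
    rewrite in_itv/= => /andP[q1 q2]; exists q.
    by rewrite ltr_norml; apply/andP; split; lra.
  pose q := [ffun i => sval (cid (qP i))].
  have yq : box (q, r) y by move=> i /=; rewrite ffunE; case: cid.
  exists (q, r) => //= z zq; apply: yeU => /=.
  apply: (@le_lt_trans _ _ (2 * ratr r)); last by lra.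
  apply: mx_norm_le => [|i]; first by lra.
  rewrite !mxE; move: (yq i) (zq i) => /=.
  by rewrite !ltr_norml ler_norml => /andP[? ?] /andP[? ?]; apply/andP; split; lra.
rewrite preimage_bigcup bigcup_mkcond.
apply: countable_bigcupT_measurable => [|c]; first exact: countableP.
case: ifPn => // _.
rewrite (_ : _ @^-1` _ = \bigcap_(i in [set: 'I_m])
    [set t | `|f t 0 i - ratr (c.1 i)| < ratr c.2]); last first.
  by apply/seteqP; split => [t ft i _|t ft i] /=; [exact: ft|exact: ft].
apply: fin_bigcap_measurable => // i _.
have mh : measurable_fun setT (fun t => `|f t 0 i - ratr (c.1 i)|).
  by apply: measurableT_comp => //; exact: measurable_funB.
have := mh measurableT _ (measurable_itv `]-oo, (ratr c.2 : R)[).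
by rewrite setTI; congr measurable; apply/seteqP; split => t /=; rewrite in_itv.
Qed.

Lemma measurable_rowvec_coord (f : T -> borel_rV R m) i :
  measurable_fun setT f -> measurable_fun setT (fun t => f t 0 i : R).
Proof. exact: (measurableT_comp (measurable_coord i)). Qed.

Lemma measurable_inner (f g : T -> borel_rV R m) :
  measurable_fun setT f -> measurable_fun setT g ->
  measurable_fun setT (fun t => inner (f t : 'rV[R]_m) (g t)).
Proof.
move=> mf mg; apply: measurable_sum => i.
by apply: measurable_funM; exact: measurable_rowvec_coord.
Qed.

Lemma measurable_norm2 (f : T -> borel_rV R m) :
  measurable_fun setT f -> measurable_fun setT (fun t => norm2 (f t : 'rV[R]_m)).
Proof.
move=> mf; apply: (measurableT_comp (f := @Num.sqrt R)); last exact: measurable_inner.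
by apply: continuous_measurable_fun; exact: sqrt_continuous.
Qed.

Lemma measurable_rowvecD (f g : T -> borel_rV R m) :
  measurable_fun setT f -> measurable_fun setT g ->
  measurable_fun setT (fun t => (f t : 'rV[R]_m) + g t : borel_rV R m).
Proof.
move=> mf mg; apply: measurable_rowvec => i; under eq_fun do rewrite mxE.
by apply: measurable_funD; exact: measurable_rowvec_coord.
Qed.

Lemma measurable_rowvecZ (a : T -> R) (f : T -> borel_rV R m) :
  measurable_fun setT a -> measurable_fun setT f ->
  measurable_fun setT (fun t => a t *: (f t : 'rV[R]_m) : borel_rV R m).
Proof.
move=> ma mf; apply: measurable_rowvec => i; under eq_fun do rewrite mxE.
by apply: measurable_funM => //; exact: measurable_rowvec_coord.
Qed.

Lemma measurable_rowvecB (f g : T -> borel_rV R m) :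
  measurable_fun setT f -> measurable_fun setT g ->
  measurable_fun setT (fun t => (f t : 'rV[R]_m) - g t : borel_rV R m).
Proof.
move=> mf mg; apply: measurable_rowvec => i; under eq_fun do rewrite coordB.
by apply: measurable_funB; exact: measurable_rowvec_coord.
Qed.

End borel_vectors.

(** * Uniform deviations by chaining *)

Section dyadic_grids.
Context {R : realType} {m : nat} (c : 'rV[R]_m) (rho : R).
Hypothesis rho0 : 0 < rho.

(** Both ends of each side are mesh points, hence 2^n + 1 values per coordinate. *)
Definition grid (n : nat) := {ffun 'I_m -> 'I_(2 ^ n).+1}.

(* [grid n] indexes the points of a dyadic mesh of the cube of center [c] and
   half-side [rho]. *)
Definition grid_point n (a : grid n) : 'rV[R]_m :=
  \row_i (c 0 i - rho + 2 * rho * ((a i)%:R / 2 ^+ n)).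

Definition grid_parent n (a : grid n.+1) : grid n := [ffun i => inord (a i)./2].

(** Rounding down rather than to the nearest point makes the rounding at level n the parent of the
    one at level n + 1. *)
Definition grid_round n (y : 'rV[R]_m) : grid n :=
  [ffun i => inord (Num.truncn (2 ^+ n * ((y 0 i - c 0 i + rho) / (2 * rho))))].

Lemma grid_parentE n (a : grid n.+1) i : grid_parent a i = (a i)./2 :> nat.
Proof.
rewrite ffunE inordK// ltnS -[(2 ^ n)%N]doubleK half_leq//.
by rewrite -mul2n -expnS -ltnS.
Qed.

(** Halving an index drops its parity bit, which moves a coordinate by at most one step of the finer
    mesh. *)
Lemma dist_grid_parent n (a : grid n.+1) :
  norm2 (grid_point a - grid_point (grid_parent a)) <= m%:R * (rho / 2 ^+ n).
Proof.
have p0 : 0 < 2 ^+ n :> R by rewrite exprn_gt0.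
apply: le_trans (norm2_le_mx_norm _) _; rewrite ler_wpM2l//.
apply: mx_norm_le => [|i]; first by rewrite divr_ge0// ltW.
rewrite !mxE grid_parentE.
have -> : (a i)%:R = (odd (a i))%:R + 2 * ((a i)./2)%:R :> R.
  by rewrite -natrM -natrD mul2n odd_double_half.
rewrite exprS.
rewrite (_ : _ - _ = (odd (a i))%:R * (rho / 2 ^+ n)); last first.
  by field; rewrite gt_eqF.
have r0 : 0 <= rho / 2 ^+ n by rewrite divr_ge0// ltW.
by rewrite normrM ger0_norm// (ger0_norm r0); apply: ler_piMl => //; case: odd.
Qed.

Lemma dist_grid_center n (a : grid n) : norm2 (grid_point a - c) <= m%:R * rho.
Proof.
have p0 : 0 < 2 ^+ n :> R by rewrite exprn_gt0.
apply: le_trans (norm2_le_mx_norm _) _; rewrite ler_wpM2l//.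
apply: mx_norm_le => [|i]; first by rewrite ltW.
rewrite !mxE; have : 0 <= (a i)%:R / 2 ^+ n :> R by rewrite divr_ge0// ltW.
have : (a i)%:R / 2 ^+ n <= 1 :> R.
  by rewrite ler_pdivrMr// mul1r -natrX ler_nat -ltnS.
set u := _ / _ => u1 u0.
have h1 : 0 <= rho * u by rewrite mulr_ge0// ltW.
have h2 : rho * u <= rho by apply: ler_piMr => //; exact: ltW.
by rewrite ler_norml; apply/andP; split; lra.
Qed.

Section round.
Context (y : 'rV[R]_m).
Hypothesis yc : norm2 (y - c) <= rho.

Let u i : R := (y 0 i - c 0 i + rho) / (2 * rho).

Let u01 i : 0 <= u i <= 1.
Proof.
have := le_trans (coord_le_norm2 (y - c) i) yc.
rewrite !mxE ler_norml => /andP[? ?]; rewrite /u.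
have r2 : 0 < 2 * rho by rewrite mulr_gt0.
by apply/andP; split; [apply: divr_ge0; lra|rewrite ler_pdivrMr//; lra].
Qed.

Let roundP n i : (grid_round n y i)%:R <= 2 ^+ n * u i < (grid_round n y i)%:R + 1.
Proof.
have p0 : 0 < 2 ^+ n :> R by rewrite exprn_gt0.
have /andP[u0 u1] := u01 i.
have v0 : 0 <= 2 ^+ n * u i by rewrite mulr_ge0// ltW.
have /andP[t1 t2] := Num.Theory.truncn_itv v0.
rewrite ffunE inordK; first by rewrite t1 natr1.
rewrite ltnS -(ler_nat R) (le_trans t1)// natrX.
by apply: ler_piMr => //; exact: ltW.
Qed.

Lemma dist_grid_round n :
  norm2 (y - grid_point (grid_round n y)) <= m%:R * (2 * rho / 2 ^+ n).
Proof.
have p0 : 0 < 2 ^+ n :> R by rewrite exprn_gt0.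
apply: le_trans (norm2_le_mx_norm _) _; rewrite ler_wpM2l//.
apply: mx_norm_le => [|i]; first by rewrite divr_ge0 ?mulr_ge0// ltW.
have /andP[r1 r2] := roundP n i; rewrite [X in `|X|]mxE [X in _ + X]mxE [X in - X]mxE.
move: (_%:R) r1 r2 => r r1 r2.
have -> : y 0 i = c 0 i - rho + 2 * rho * u i by rewrite /u; field; rewrite gt_eqF.
rewrite (_ : _ - _ = 2 * rho / 2 ^+ n * (2 ^+ n * u i - r)); last first.
  by field; rewrite gt_eqF.
have r0 : 0 <= 2 * rho / 2 ^+ n by rewrite divr_ge0 ?mulr_ge0// ltW.
rewrite normrM (ger0_norm r0); apply: ler_piMr => //.
by rewrite ler_norml; apply/andP; split; lra.
Qed.

(** The integer part of 2 v, halved, is the integer part of v. Hence the increments along the chain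
    of [y] are determined by the finer points, and a level involves one function per finer point and
    coordinate. *)
Lemma grid_parent_round n : grid_parent (grid_round n.+1 y) = grid_round n y.
Proof.
apply/ffunP => i; apply/val_inj; rewrite [LHS]grid_parentE.
have half_round (r s : nat) (v : R) :
    r%:R <= 2 * v < r%:R + 1 -> s%:R <= v < s%:R + 1 -> r./2 = s.
  move=> /andP[r1 r2] /andP[s1 s2].
  have rE : r%:R = (odd r)%:R + 2 * (r./2)%:R :> R.
    by rewrite -natrM -natrD mul2n odd_double_half.
  have o1 : (odd r)%:R <= 1 :> R by case: odd.
  have o0 : 0 <= (odd r)%:R :> R by [].
  apply/eqP; rewrite eqn_leq -ltnS -[(s <= _)%N]ltnS -!(ltr_nat R) -!natr1.
  by apply/andP; split; lra.
by apply: half_round (roundP n i); rewrite mulrA -exprS; exact: roundP.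
Qed.

End round.

End dyadic_grids.

(** * Numerical bounds for the chaining sum *)

Section power_bounds.
Context {R : realType}.

(** Replaces powers of a radius by affine bounds, so that the estimates grow linearly with the
    radius. *)
Lemma powR_le1D (x p : R) : 0 <= x -> 0 < p <= 1 -> x `^ p <= 1 + x.
Proof.
move=> x0 /andP[p0 p1]; have [x1|/ltW x1] := leP x 1.
  rewrite (le_trans _ (_ : 1 <= 1 + x)) ?lerDl//.
  have := ge0_ler_powR (ltW p0) (x := x) (y := 1).
  by rewrite !nnegrE powR1; exact.
by rewrite (le_trans (ler_powR x1 p1))// powRr1// lerDr.
Qed.

Lemma powR_half_bounds (p : R) : 0 < p -> 0 < (2^-1 : R) `^ p < 1.
Proof.
move=> p0; rewrite powR_gt0//=.
by have := gt0_ltr_powR p0 (x := 2^-1) (y := 1); rewrite !nnegrE powR1; apply; lra.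
Qed.

Lemma powR_dyadic (x p : R) n : 0 <= x -> 0 < p <= 1 ->
  (x / 2 ^+ n) `^ p <= (1 + x) * (2^-1 `^ p) ^+ n.
Proof.
move=> x0 p01; rewrite powRM ?invr_ge0 ?exprn_ge0// -exprVn.
rewrite -(@powR_mulrn _ 2^-1)// -powRrM [n%:R * p]mulrC powRrM powR_mulrn ?powR_ge0//.
by rewrite ler_wpM2r ?powR_le1D// exprn_ge0// powR_ge0.
Qed.

Lemma sum_arith_geom_le (q : R) n : 0 <= q < 1 ->
  \sum_(l < n) l.+1%:R * q ^+ l <= (1 - q) ^- 2.
Proof.
move=> /andP[q0 q1]; have q2 : 0 < (1 - q) ^+ 2 by rewrite exprn_gt0// subr_gt0.
rewrite -[leRHS]mul1r ler_pdivlMr//.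
suff -> : (\sum_(l < n) l.+1%:R * q ^+ l) * (1 - q) ^+ 2 =
    1 - q ^+ n * (1 + n%:R * (1 - q)).
  rewrite lerBlDr lerDl mulr_ge0 ?exprn_ge0// addr_ge0// mulr_ge0// subr_ge0.
  exact: ltW.
elim: n => [|n IHn]; first by rewrite big_ord0; ring.
by rewrite big_ord_recr/= mulrDl IHn [q ^+ n.+1]exprS -natr1; ring.
Qed.

Lemma ln_natr_le (M k : nat) : (0 < M <= 2 ^ k)%N -> ln (M%:R : R) <= k%:R.
Proof.
move=> /andP[M0 Mk].
apply: (@le_trans _ _ (ln ((2 ^ k)%:R : R))).
  by rewrite ler_ln ?posrE ?ltr0n ?expn_gt0// ler_nat.
have ln2 : ln (2 : R) <= 1.
  by have := @le_ln1Dx R 1; rewrite -natr1; apply; lra.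
by rewrite natrX lnXn// -[leRHS]mulr1 mulr_natl lerMn2r ln2 orbT.
Qed.

(** One function per grid point and coordinate, with both signs, and the zero function. What matters
    is that the exponent is linear in [n], since the increments decay geometrically. *)
Lemma grid_cardinal_le (m n : nat) :
  (0 < 1 + #|{: @grid m n * 'I_m}|.*2 <= 2 ^ ((m + m).+1 * n.+1))%N.
Proof.
apply/andP; split => //; rewrite card_prod card_ffun !card_ord -muln2.
have A1 : (0 < (2 ^ n).+1 ^ m)%N by rewrite expn_gt0.
have A2 : ((2 ^ n).+1 ^ m <= 2 ^ (n.+1 * m))%N.
  rewrite expnM; case: (posnP m) => [->//|m0].
  by rewrite leq_exp2r// expnS mul2n -addnn -[X in (X <= _)%N]addn1 leq_add2l expn_gt0.
have A3 : (m < 2 ^ m)%N by exact: ltn_expl.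
apply: (@leq_trans (2 ^ (n.+1 * m) * 2 ^ m * 2)); last first.
  rewrite -expnD -expnSr leq_exp2l//; nia.
apply: (@leq_trans ((2 ^ n).+1 ^ m * 2 ^ m * 2)); last first.
  by rewrite !leq_mul2r A2 !orbT.
nia.
Qed.

End power_bounds.

(** * Suprema of sample sums over a ball *)

Section chaining.
Context {R : realType} {m : nat} {d d' : measure_display}.
Context {Xi : measurableType d} {Om : measurableType d'}.
Context {P : probability Xi R} {Pr : probability Om R}.
Context {I : choiceType} {Y : I -> {RV Pr >-> Xi}}.
Hypothesis indY : mutually_independent Y.
Hypothesis lawY : forall i A, measurable A -> distribution Pr (Y i) A = P A.
Context (phi : 'I_m -> 'rV[R]_m -> Xi -> R) (G : Xi -> R) (c : 'rV[R]_m).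
Context (delta g1 g2 : R).
Hypothesis delta01 : 0 < delta <= 1.
Hypothesis mphi : forall i y, measurable_fun setT (phi i y).
Hypothesis phi0 : forall i y, (\int[P]_x (phi i y x)%:E = 0)%E.
Hypothesis G0 : forall x, 0 <= G x.
Hypothesis phi_holder : forall i y z x,
  `|phi i y x - phi i z x| <= G x * norm2 (y - z) `^ delta.
Hypothesis phi_center : forall i x, `|phi i c x| <= G x.
Hypothesis Gg1 : mean_le P G g1.
Hypothesis Gg2 : mean_le P (fun x => G x ^+ 2) g2.

Let q : R := 2^-1 `^ delta.
Let K : R := 1 + m%:R.

Let q01 : 0 < q < 1.
Proof. by apply: powR_half_bounds; case/andP: delta01. Qed.

Let g20 : 0 <= g2.
Proof. by apply: mean_le_ge0 Gg2 => x; exact: sqr_ge0. Qed.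

Let K1 : 1 <= K. Proof. by rewrite lerDl. Qed.

Let phi_centered i y : P.-integrable setT (EFin \o phi i y).
Proof.
pose a := 1 + norm2 (y - c) `^ delta.
have a0 : 0 <= a by rewrite addr_ge0// powR_ge0.
have [] : mean_le P (phi i y) (a * g1) => //.
apply: mean_le_dom (mean_leZ a0 Gg1) => // x.
rewrite -(subrK (phi i c x) (phi i y x)) (le_trans (ler_normD _ _))//.
by rewrite mulrDl mul1r addrC lerD// mulrC.
Qed.

Section ball.
Context (rho : R) (s : seq I).
Hypothesis rho0 : 0 < rho.
Hypothesis us : uniq s.
Hypothesis s0 : (0 < size s)%N.

Let rs : R := Num.sqrt (size s)%:R.

Let rs0 : 0 < rs. Proof. by rewrite sqrtr_gt0 ltr0n. Qed.

(** The choice [t = rs * h], with [h] the scale of the level, gives both terms of the maximal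
    inequality the order [rs * h]. *)
Let level_bound (J : finType) (f : J -> Xi -> R) (B h : R) (k : nat) :
  0 < B -> 0 < h -> (0 < 1 + #|J|.*2 <= 2 ^ k)%N ->
  (forall j, measurable_fun setT (f j)) ->
  (forall j x, `|f j x| <= G x * (B * h)) -> (forall j, \int[P]_x (f j x)%:E = 0)%E ->
  exists2 M : Om -> R, mean_le Pr M (rs * h * (k%:R + 4 * g2 * B ^+ 2)) &
    forall j w, `|sample_sum Y s (f j) w| <= M w.
Proof.
move=> B0 h0 Jk mf fG f0.
have t0 : 0 < rs * h by rewrite mulr_gt0.
have gG0 x : 0 <= G x * (B * h) by rewrite mulr_ge0// mulr_ge0// ltW.
have gv : mean_le P (fun x => (G x * (B * h)) ^+ 2) ((B * h) ^+ 2 * g2).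
  under eq_fun do rewrite exprMn mulrC.
  by apply: mean_leZ => //; exact: sqr_ge0.
have [M M1 M2] := maximal_inequality indY lawY t0 gG0 mf fG f0 gv us.
exists M => //; apply: mean_leW M1; rewrite mulrDr lerD//.
  by rewrite ler_wpM2l ?(ltW t0)// ln_natr_le.
rewrite -[(size s)%:R]sqr_sqrtr// -/rs le_eqVlt; apply/orP; left; apply/eqP.
by field; rewrite !gt_eqF.
Qed.

Let pt n (a : grid n) := grid_point c rho a.

Let increment n (j : @grid m n.+1 * 'I_m) x :=
  phi j.2 (pt j.1) x - phi j.2 (pt (grid_parent j.1)) x.

(** The factor 2 comes from n + 2 <= 2 (n + 1), an increment of level n being indexed by the grid of
    level n + 1. *)
Let C1 : R := (m + m).+1%:R * 2 + 4 * g2 * K ^+ 2.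

Let mean0_sub i y z : (\int[P]_x (phi i y x - phi i z x)%:E = 0)%E.
Proof.
etransitivity; first exact: (integralB measurableT (phi_centered i y) (phi_centered i z)).
by rewrite /= !phi0 sube0.
Qed.

Let increment_bound n : exists2 M : Om -> R,
  mean_le Pr M (rs * (1 + rho) * C1 * (n.+1%:R * q ^+ n)) &
  forall j w, `|sample_sum Y s (@increment n j) w| <= M w.
Proof.
have /andP[q0 q1] := q01; have K0 : 0 < K := lt_le_trans ltr01 K1.
have h0 : 0 < (1 + rho) * q ^+ n by rewrite mulr_gt0 ?exprn_gt0// addr_gt0.
have fG (j : grid n.+1 * 'I_m) x : `|increment j x| <= G x * (K * ((1 + rho) * q ^+ n)).
  apply: le_trans (phi_holder _ _ _ _) _; rewrite ler_wpM2l//.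
  have /andP[d0 d1] := delta01.
  apply: (@le_trans _ _ ((m%:R * rho / 2 ^+ n) `^ delta)).
    apply: ge0_ler_powR; rewrite ?nnegrE ?norm2_ge0 ?(ltW d0)//.
      by rewrite divr_ge0 ?exprn_ge0// mulr_ge0// ltW.
    by rewrite -mulrA; exact: dist_grid_parent.
  apply: le_trans (powR_dyadic _ _ delta01) _; first by rewrite mulr_ge0// ltW.
  rewrite mulrA ler_wpM2r ?exprn_ge0 ?(ltW q0)//.
  have : 0 <= m%:R :> R by []. rewrite /K; move: rho0; nra.
have [||M M1 M2] := level_bound K0 h0 (grid_cardinal_le m n.+1) _ fG.
- by move=> j; exact: measurable_funB.
- by move=> j; exact: mean0_sub.
exists M => //; apply: mean_leW M1.
rewrite -!mulrA ler_wpM2l ?(ltW rs0)// ler_wpM2l ?addr_ge0 ?(ltW rho0)//.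
rewrite (_ : C1 * _ = q ^+ n * (C1 * n.+1%:R)); last by ring.
rewrite ler_wpM2l ?exprn_ge0 ?(ltW q0)//.
rewrite natrM -!natr1 /C1 mulrA.
have : 0 <= 4 * g2 * K ^+ 2 by rewrite !mulr_ge0 ?exprn_ge0 ?(ltW K0).
have : 0 <= n%:R :> R by [].
have : 0 <= (m + m)%:R :> R by [].
nra.
Qed.

Let base_bound : exists2 M : Om -> R,
  mean_le Pr M (rs * (1 + rho) * ((m + m).+1%:R + 4 * g2 * (2 * K) ^+ 2)) &
  forall (j : @grid m 0 * 'I_m) w, `|sample_sum Y s (phi j.2 (pt j.1)) w| <= M w.
Proof.
have K0 : 0 < 2 * K by rewrite mulr_gt0// (lt_le_trans ltr01 K1).
have h0 : 0 < 1 + rho by rewrite addr_gt0.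
have fG (j : grid 0 * 'I_m) x : `|phi j.2 (pt j.1) x| <= G x * (2 * K * (1 + rho)).
  rewrite -(subrK (phi j.2 c x) (phi _ _ _)) (le_trans (ler_normD _ _))//.
  apply: le_trans (lerD (phi_holder _ _ _ _) (phi_center _ _)) _.
  rewrite -[X in _ + X]mulr1 -mulrDr ler_wpM2l//.
  apply: (@le_trans _ _ ((1 + norm2 (pt j.1 - c)) + 1)).
    by rewrite lerD2r powR_le1D// norm2_ge0.
  have := dist_grid_center c rho0 j.1; rewrite -/(pt j.1) /K.
  have : 0 <= m%:R :> R by []. move: (norm2 _) rho0 => u; nra.
have [||M M1 M2] := level_bound K0 h0 (grid_cardinal_le m 0) _ fG.
- by move=> j; exact: mphi.
- by [].
by exists M => //; apply: mean_leW M1; rewrite muln1.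
Qed.

Let Gsum_le i y z w : `|sample_sum Y s (phi i y) w| <=
  `|sample_sum Y s (phi i z) w| + sample_sum Y s G w * norm2 (y - z) `^ delta.
Proof.
rewrite -[X in `|X|](subrK (sample_sum Y s (phi i z) w)) addrC.
rewrite (le_trans (ler_normD _ _))// lerD2l /sample_sum -sumrB mulr_suml.
by apply: le_trans (ler_norm_sum _ _ _) _; apply: ler_sum => k _; exact: phi_holder.
Qed.

(** Telescoping along the roundings of [y]: a base term, one maximal inequality per level, and
    beyond a cut-off level the Hölder bound summed over the sample. *)
Lemma chaining_ball : exists2 U : Om -> R,
  mean_le Pr U (((m + m).+1%:R + 4 * g2 * (2 * K) ^+ 2 + C1 * (1 - q) ^- 2 +
                 2 * K * g1) * (1 + rho) * rs) &
  forall y, norm2 (y - c) <= rho ->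
  forall i w, `|sample_sum Y s (phi i y) w| <= U w.
Proof.
have /andP[q0 q1] := q01; have K0 : 0 < K := lt_le_trans ltr01 K1.
have [B B1 B2] := base_bound.
have /choice[M /all_and2[M1 M2]] : forall n, exists M : Om -> R,
    mean_le Pr M (rs * (1 + rho) * C1 * (n.+1%:R * q ^+ n)) /\
    forall j w, `|sample_sum Y s (@increment n j) w| <= M w.
  by move=> n; have [M M1 M2] := increment_bound n; exists M.
(* The remainder beyond level n has mean of order g1 q^n rs^2; with q^n <= 1 / rs it is of order rs,
   like the other terms. *)
have [n qn] : exists n, q ^+ n * rs <= 1.
  have /cvgr0Pnorm_lt/(_ rs^-1) : q ^+ n @[n --> \oo] --> (0 : R).
    by apply: cvg_expr; rewrite ger0_norm// ltW.
  rewrite invr_gt0 => /(_ rs0)[n _ /(_ n (leqnn n))] /= qn.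
  exists n; rewrite -ler_pdivlMr// div1r ltW// (le_lt_trans _ qn)//.
  exact: ler_norm.
exists (fun w => B w + \sum_(l < n) M l w +
   (1 + rho) * 2 * K * q ^+ n * sample_sum Y s G w).
  have SG := mean_le_sample_sum lawY s Gg1.
  have SM := mean_le_sum (index_enum 'I_n) (fun l : 'I_n => M1 l).
  have r0 : 0 <= (1 + rho) * 2 * K * q ^+ n.
    by rewrite !mulr_ge0 ?exprn_ge0 ?(ltW q0) ?(ltW K0)// addr_ge0// ltW.
  apply: mean_leW (mean_leD (mean_leD B1 SM) (mean_leZ r0 SG)).
  rewrite -!mulr_sumr -[(size s)%:R]sqr_sqrtr// -/rs.
  have SUM : \sum_(l < n) l.+1%:R * q ^+ l <= (1 - q) ^- 2.
    by apply: sum_arith_geom_le; rewrite ltW.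
  have C10 : 0 <= rs * (1 + rho) * C1.
    by rewrite !mulr_ge0 ?(ltW rs0)// ?addr_ge0 ?mulr_ge0 ?sqr_ge0// ltW.
  have := ler_wpM2l C10 SUM.
  have g10 : 0 <= g1 by exact: mean_le_ge0 Gg1.
  have : (1 + rho) * 2 * K * g1 * rs * (q ^+ n * rs) <= (1 + rho) * 2 * K * g1 * rs * 1.
    by rewrite ler_wpM2l// !mulr_ge0 ?(ltW rs0) ?(ltW K0)// addr_ge0// ltW.
  move: (\sum_(l < n) _) ((1 - q) ^- 2) (q ^+ n) => S Q qn'.
  lra.
move=> y yc i w.
have chain l : `|sample_sum Y s (phi i (pt (grid_round c rho l y))) w| <=
    B w + \sum_(l' < l) M l' w.
  elim: l => [|l IHl].
    by rewrite big_ord0 addr0; exact: (B2 (grid_round c rho 0 y, i)).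
  rewrite big_ord_recr/= addrA.
  have := M2 l (grid_round c rho l.+1 y, i) w.
  rewrite {1}/sample_sum /increment/= sumrB (grid_parent_round rho0 yc) => Ml.
  apply: le_trans (lerD IHl Ml).
  by rewrite -[X in `|X| <= _](subrK (sample_sum Y s (phi i (pt (grid_round c rho l y))) w))
    addrC ler_normD.
apply: le_trans (Gsum_le i y (pt (grid_round c rho n y)) w) _.
rewrite lerD// mulrC ler_wpM2r//.
  by rewrite /sample_sum sumr_ge0.
have /andP[d0 d1] := delta01.
apply: (@le_trans _ _ ((m%:R * (2 * rho) / 2 ^+ n) `^ delta)).
  apply: ge0_ler_powR; rewrite ?nnegrE ?norm2_ge0 ?(ltW d0)//.
    by rewrite divr_ge0 ?exprn_ge0// !mulr_ge0// ltW.
  by rewrite -mulrA; exact: dist_grid_round.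
apply: le_trans (powR_dyadic _ _ delta01) _; first by rewrite !mulr_ge0// ltW.
rewrite ler_wpM2r ?exprn_ge0 ?(ltW q0)//.
have : 0 <= m%:R :> R by []. rewrite /K; move: rho0; nra.
Qed.

End ball.

Lemma chaining : exists2 C : R, 0 <= C &
  forall (rho : R) (s : seq I), 0 < rho -> uniq s -> (0 < size s)%N ->
  exists2 U : Om -> R,
    mean_le Pr U (C * (1 + rho) * Num.sqrt (size s)%:R) &
    forall y, norm2 (y - c) <= rho ->
    forall i w, `|sample_sum Y s (phi i y) w| <= U w.
Proof.
eexists; last by move=> rho s rho0 us s0; exact: chaining_ball.
have g10 : 0 <= g1 by exact: mean_le_ge0 Gg1.
have K0 : 0 <= K by rewrite (le_trans _ K1).
have gK B : 0 <= 4 * g2 * B ^+ 2 by rewrite mulr_ge0 ?sqr_ge0// mulr_ge0.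
have m0 : 0 <= (m + m).+1%:R :> R by [].
rewrite addr_ge0 ?(mulr_ge0 _ g10) ?mulr_ge0// addr_ge0// ?divr_ge0 ?sqr_ge0//.
  by rewrite addr_ge0.
by rewrite addr_ge0// mulr_ge0.
Qed.

End chaining.

(** * Deviation of the empirical means from the mean operator *)

Section deviations.
Context {R : realType} {m : nat} {d d' : measure_display}.
Context {Xi : measurableType d} {Om : measurableType d'}.
Context {P : probability Xi R} {Pr : probability Om R}.
Context {I : choiceType} (Y : I -> {RV Pr >-> Xi}).
Hypothesis indY : mutually_independent Y.
Hypothesis lawY : forall i A, measurable A -> distribution Pr (Y i) A = P A.
Context (F : Xi -> 'rV[R]_m -> 'rV[R]_m) (L : Xi -> R) (c : 'rV[R]_m).
Context (delta h1 h2 : R).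
Hypothesis delta01 : 0 < delta <= 1.
Hypothesis mF : measurable_fun setT
  (fun u : Xi * borel_rV R m => F u.1 u.2 : borel_rV R m).
Hypothesis mL : measurable_fun setT L.
Hypothesis L0 : forall x, 0 <= L x.
Hypothesis F_holder : forall x y z,
  norm2 (F x y - F x z) <= L x * norm2 (y - z) `^ delta.

Let T := mean_operator P F.

(* Bounds both the Hölder constant and the value at the reference point. *)
Definition envelope x := L x + norm2 (F x c).
Hypothesis Hh1 : mean_le P envelope h1.
Hypothesis Hh2 : mean_le P (fun x => envelope x ^+ 2) h2.

Let H0 x : 0 <= envelope x. Proof. by rewrite addr_ge0// norm2_ge0. Qed.

Let h10 : 0 <= h1. Proof. exact: mean_le_ge0 Hh1. Qed.

Lemma measurable_operator_at y : measurable_fun setT (fun x => F x y : borel_rV R m).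
Proof.
have my : measurable_fun setT (fun x : Xi => (x, y : borel_rV R m)).
  by apply: measurable_fun_pair => //; exact: measurable_cst.
exact: (measurableT_comp mF my).
Qed.

Lemma measurable_operator_coord i y : measurable_fun setT (fun x => F x y 0 i).
Proof. exact: (measurableT_comp (measurable_coord i) (measurable_operator_at y)). Qed.

Lemma operator_coord_holder i y z x :
  `|F x y 0 i - F x z 0 i| <= L x * norm2 (y - z) `^ delta.
Proof.
apply: le_trans (F_holder x y z).
by apply: le_trans (coord_le_norm2 (F x y - F x z) i); rewrite !mxE.
Qed.

Lemma operator_growth y x : norm2 (F x y) <= envelope x * (2 + norm2 (y - c)).
Proof.
rewrite -(subrK (F x c) (F x y)) (le_trans (norm2D _ _))//.
have := F_holder x y c; have := powR_le1D (norm2_ge0 (y - c)) delta01.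
have := L0 x; have := norm2_ge0 (F x c); have := norm2_ge0 (y - c).
rewrite /envelope; move: (norm2 (F x y - _)) (norm2 (y - c)) (norm2 (F x c)) (L x).
move=> a b e l b0 e0 l0 h; have := ler_wpM2l l0 h; nra.
Qed.

Lemma integrable_operator i y : P.-integrable setT (EFin \o (fun x => F x y 0 i)).
Proof.
have a0 : 0 <= 2 + norm2 (y - c) by rewrite addr_ge0// norm2_ge0.
have [] : mean_le P (fun x => F x y 0 i) ((2 + norm2 (y - c)) * h1) => //.
apply: mean_le_dom (mean_leZ a0 Hh1); first exact: measurable_operator_coord.
by move=> x; rewrite (le_trans (coord_le_norm2 _ _))// mulrC operator_growth.
Qed.

Lemma mean_operatorE i y : (\int[P]_x (F x y 0 i)%:E = (T y 0 i)%:E)%E.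
Proof.
rewrite /T /mean_operator mxE unlock fineK//.
exact: integrable_fin_num (integrable_operator i y).
Qed.

Lemma mean_inner_operator y v : mean_le P (fun x => inner (F x y) v) (inner (T y) v).
Proof.
rewrite /inner; apply: mean_le_sum => i; split.
  exact: (integrableZr measurableT (v 0 i) (integrable_operator i y)).
under eq_integral do rewrite EFinM.
by rewrite integralZr//; [rewrite mean_operatorE | exact: integrable_operator].
Qed.

Definition deviation i y x : R := F x y 0 i - T y 0 i.

Lemma measurable_deviation i y : measurable_fun setT (deviation i y).
Proof. by apply: measurable_funB => //; exact: measurable_operator_coord. Qed.

Lemma deviation_centered i y : (\int[P]_x (deviation i y x)%:E = 0)%E.
Proof.
etransitivity; first exact: (integralB measurableT (integrable_operator i y)
  (finite_measure_integrable_cst P (T y 0 i) measurableT)).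
rewrite /= mean_operatorE (integral_cst P measurableT (T y 0 i)%:E).
by have /= -> := probability_setT P; rewrite mule1 subee.
Qed.

Lemma mean_operator_holder i y z :
  `|T y 0 i - T z 0 i| <= h1 * norm2 (y - z) `^ delta.
Proof.
have bound u v : T u 0 i - T v 0 i <= h1 * norm2 (u - v) `^ delta.
  have [_] : mean_le P (fun x => F x u 0 i - F x v 0 i) (norm2 (u - v) `^ delta * h1).
    apply: mean_le_dom (mean_leZ (powR_ge0 _ _) Hh1).
      by apply: measurable_funB; exact: measurable_operator_coord.
    move=> x; rewrite (le_trans (operator_coord_holder _ _ _ _))// mulrC.
    by rewrite ler_wpM2l ?powR_ge0// lerDl norm2_ge0.
  have -> : (\int[P]_x (F x u 0 i - F x v 0 i)%:E = (T u 0 i - T v 0 i)%:E)%E.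
    etransitivity; first exact: (integralB measurableT (integrable_operator i u)
      (integrable_operator i v)).
    by rewrite /= !mean_operatorE.
  by rewrite lee_fin mulrC.
rewrite ler_norml lerNl opprB; apply/andP; split; last exact: bound.
by rewrite norm2_distC; exact: bound.
Qed.

Lemma mean_operator_holder2 y z :
  norm2 (T y - T z) <= m%:R * h1 * norm2 (y - z) `^ delta.
Proof.
apply: le_trans (norm2_le_mx_norm _) _; rewrite -mulrA ler_wpM2l//.
apply: mx_norm_le => [|i]; first by rewrite mulr_ge0// powR_ge0.
by rewrite coordB; exact: mean_operator_holder.
Qed.

Lemma mean_operator_growth i y : `|T y 0 i| <= 2 * h1 * (1 + norm2 (y - c)).
Proof.
have n0 := norm2_ge0 (y - c).
have a0 : 0 <= 2 + norm2 (y - c) by rewrite addr_ge0.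
have bound b : mean_le P (fun x => (-1) ^+ b * F x y 0 i) ((2 + norm2 (y - c)) * h1).
  apply: mean_le_dom (mean_leZ a0 Hh1).
    by apply: measurable_funM => //; exact: measurable_operator_coord.
  move=> x; rewrite normrM normrX normrN1 expr1n mul1r.
  by rewrite (le_trans (coord_le_norm2 _ _))// mulrC operator_growth.
have boundT b : (-1) ^+ b * T y 0 i <= 2 * h1 * (1 + norm2 (y - c)).
  have [_] := bound b; under eq_integral do rewrite EFinM.
  rewrite (integralZl measurableT (integrable_operator i y)) mean_operatorE -EFinM lee_fin.
  move=> /le_trans; apply; move: n0 h10; nra.
have := boundT 0%N; have := boundT 1%N; rewrite expr0 expr1 mul1r mulN1r.
by move=> T1 T2; rewrite ler_norml lerNl T1 T2.
Qed.

(** The added [2 * h1] covers the mean operator, both its Hölder constant and its value at [c]. *)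
Let G x := envelope x + 2 * h1.

Let G0 x : 0 <= G x. Proof. by rewrite addr_ge0// mulr_ge0. Qed.

Let deviation_holder i y z x :
  `|deviation i y x - deviation i z x| <= G x * norm2 (y - z) `^ delta.
Proof.
rewrite /deviation (_ : _ - _ = (F x y 0 i - F x z 0 i) - (T y 0 i - T z 0 i)); last by ring.
apply: le_trans (ler_normB _ _) _.
apply: le_trans (lerD (operator_coord_holder _ _ _ _) (mean_operator_holder _ _ _)) _.
rewrite -mulrDl ler_wpM2r ?powR_ge0// /G /envelope.
have := norm2_ge0 (F x c); have := h10; lra.
Qed.

Let deviation_center i x : `|deviation i c x| <= G x.
Proof.
apply: le_trans (ler_normB _ _) _; rewrite /G lerD//.
  by rewrite (le_trans (coord_le_norm2 _ _))// lerDr.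
by have := mean_operator_growth i c; rewrite subrr norm2_0 addr0 mulr1.
Qed.

Let G_g1 : mean_le P G (h1 + 2 * h1).
Proof. exact: mean_leD Hh1 (mean_le_cst P (2 * h1)). Qed.

Let mG : measurable_fun setT G.
Proof. exact: mean_le_measurable G_g1. Qed.

Let G_g2 : mean_le P (fun x => G x ^+ 2) (2 * h2 + 8 * h1 ^+ 2).
Proof.
apply: mean_le_dom (mean_leD (mean_leZ _ Hh2) (mean_le_cst P (8 * h1 ^+ 2))) => //.
  exact: measurable_funX.
move=> x /=; rewrite ger0_norm ?sqr_ge0// -subr_ge0.
rewrite [leRHS](_ : _ = (envelope x - 2 * h1) ^+ 2) ?sqr_ge0//.
by rewrite /G; ring.
Qed.

Definition empirical_deviation (s : seq I) (y : 'rV[R]_m) (w : Om) : 'rV[R]_m :=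
  (size s)%:R^-1 *: (\sum_(i <- s) F (Y i w) y) - T y.

Lemma empirical_deviation_coord s y w i : (0 < size s)%N ->
  empirical_deviation s y w 0 i = (size s)%:R^-1 * sample_sum Y s (deviation i y) w.
Proof.
move=> s0; rewrite /empirical_deviation coordB mxE /sample_sum sumrB summxE mulrBr.
congr (_ - _); rewrite big_const_seq count_predT iter_addr_0 -[T y 0 i *+ _]mulr_natl.
by rewrite mulrA mulVf ?mul1r// pnatr_eq0 -lt0n.
Qed.

Lemma measurable_empirical_deviation s y : (0 < size s)%N ->
  measurable_fun setT (empirical_deviation s y : Om -> borel_rV R m).
Proof.
move=> s0; apply: measurable_rowvec => i.
under eq_fun do rewrite empirical_deviation_coord//.
apply: measurable_funM; first exact: measurable_cst.
by apply: measurable_sample_sumT; exact: measurable_deviation.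
Qed.

Lemma uniform_deviation : exists2 C : R, 0 <= C &
  forall (rho : R) (s : seq I), 0 < rho -> uniq s -> (0 < size s)%N ->
  exists2 U : Om -> R,
    mean_le Pr U (C * (1 + rho) / Num.sqrt (size s)%:R) &
    forall y, norm2 (y - c) <= rho -> forall w, norm2 (empirical_deviation s y w) <= U w.
Proof.
have [C C0 chain] := chaining indY lawY delta01 measurable_deviation deviation_centered
  G0 deviation_holder deviation_center G_g1 G_g2.
exists (m%:R * C); first by rewrite mulr_ge0.
move=> rho s rho0 us s0; have [U U1 U2] := chain rho s rho0 us s0.
have N0 : 0 < (size s)%:R :> R by rewrite ltr0n.
have mN0 : 0 <= m%:R / (size s)%:R :> R by rewrite divr_ge0.
exists (fun w => m%:R / (size s)%:R * U w).
  apply: mean_leW (mean_leZ mN0 U1).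
  have r0 : 0 < Num.sqrt (size s)%:R :> R by rewrite sqrtr_gt0.
  rewrite -[X in _ / X * _]sqr_sqrtr ?(ltW N0)//.
  rewrite le_eqVlt; apply/orP; left; apply/eqP.
  by field; rewrite gt_eqF.
move=> y yrho w; apply: le_trans (norm2_le_sum _) _.
rewrite -mulrA -[m in m%:R]card_ord mulr_natl -sumr_const; apply: ler_sum => i _.
rewrite empirical_deviation_coord// normrM ger0_norm ?invr_ge0// ler_wpM2l ?invr_ge0//.
exact: U2.
Qed.

Lemma empirical_deviation_moment4 h4 : mean_le P (fun x => envelope x ^+ 4) h4 ->
  exists2 C : R, 0 <= C &
  forall y (s : seq I), uniq s -> (0 < size s)%N ->
  mean_le Pr (fun w => norm2 (empirical_deviation s y w) ^+ 4)
    (C * (1 + norm2 (y - c)) ^+ 4 / (size s)%:R ^+ 2).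
Proof.
move=> Hh4.
have G_g4 : mean_le P (fun x => G x ^+ 4) (8 * h4 + 128 * h1 ^+ 4).
  apply: mean_le_dom (mean_leD (mean_leZ _ Hh4) (mean_le_cst P (128 * h1 ^+ 4))) => //.
    exact: measurable_funX.
  move=> x /=; rewrite ger0_norm ?exprn_even_ge0// /G.
  move: (envelope x) (h1) (H0 x) h10 => e k e0 k0.
  have h (a b : R) : (a + b) ^+ 2 <= 2 * (a ^+ 2 + b ^+ 2).
    rewrite -subr_ge0 [leRHS](_ : _ = (a - b) ^+ 2) ?sqr_ge0//; ring.
  have sq : ((e + 2 * k) ^+ 2) ^+ 2 <= (2 * (e ^+ 2 + (2 * k) ^+ 2)) ^+ 2.
    by rewrite lerXn2r ?nnegrE ?sqr_ge0// mulr_ge0// addr_ge0// sqr_ge0.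
  have := h (e ^+ 2) ((2 * k) ^+ 2); move: sq; rewrite -!exprM !exprMn; lra.
have g40 : 0 <= 8 * h4 + 128 * h1 ^+ 4.
  by apply: mean_le_ge0 G_g4 => x; rewrite exprn_even_ge0.
set g4 := 8 * h4 + _ in G_g4 g40; have := G_g2; set g2 := 2 * h2 + _ => Gg2.
(* 64 and 48 are 2^4 times the constants of [sample_sum_moment4], the deviation being at most 2 A G;
   the powers of [m] come from [norm2_le_mx_norm] and from the sum over coordinates. *)
exists (m%:R ^+ 4 * (m%:R * (64 * g2 ^+ 2 + 48 * g4))).
  by rewrite mulr_ge0 ?exprn_ge0// mulr_ge0// addr_ge0// mulr_ge0// sqr_ge0.
move=> y s us s0; set A := 1 + norm2 (y - c).
have A0 : 0 <= A by rewrite addr_ge0// norm2_ge0.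
have dG i x : `|deviation i y x| <= 2 * A * G x.
  rewrite -(subrK (deviation i c x) (deviation i y x)) (le_trans (ler_normD _ _))//.
  apply: le_trans (lerD (deviation_holder _ _ _ _) (deviation_center _ _)) _.
  rewrite -[X in _ + X]mulr1 -mulrDr mulrC ler_wpM2r//.
  have := powR_le1D (norm2_ge0 (y - c)) delta01; have := norm2_ge0 (y - c).
  rewrite /A; lra.
have d2 i : mean_le P (fun x => deviation i y x ^+ 2) ((2 * A) ^+ 2 * g2).
  apply: mean_le_dom (mean_leZ (sqr_ge0 _) Gg2).
    by apply: measurable_funX; exact: measurable_deviation.
  by move=> x; rewrite normrX -exprMn lerXn2r ?nnegrE// mulr_ge0 ?mulr_ge0.
have A40 : 0 <= (2 * A) ^+ 4 by rewrite exprn_even_ge0.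
have d4 i : mean_le P (fun x => deviation i y x ^+ 4) ((2 * A) ^+ 4 * g4).
  apply: mean_le_dom (mean_leZ A40 G_g4).
    by apply: measurable_funX; exact: measurable_deviation.
  by move=> x; rewrite normrX -exprMn lerXn2r ?nnegrE// mulr_ge0 ?mulr_ge0.
have S4 i := sample_sum_moment4 indY lawY (measurable_deviation i y)
  (deviation_centered i y) (d2 i) (d4 i) us.
have N0 : 0 < (size s)%:R :> R by rewrite ltr0n.
have k0 : 0 <= m%:R ^+ 4 / (size s)%:R ^+ 4 :> R by rewrite divr_ge0 ?exprn_ge0.
have SS := mean_leZ k0 (mean_le_sum (index_enum 'I_m) S4).
apply: mean_leW (mean_le_dom _ _ SS).
- rewrite sumr_const card_ord -mulr_natl le_eqVlt; apply/orP; left; apply/eqP.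
  by field; rewrite gt_eqF.
- by apply: measurable_funX; apply: measurable_norm2; exact: measurable_empirical_deviation.
- move=> w; rewrite ger0_norm ?exprn_ge0 ?norm2_ge0//.
  set e := empirical_deviation s y w.
  have eE i : e 0 i = (size s)%:R^-1 * sample_sum Y s (deviation i y) w.
    exact: empirical_deviation_coord.
  rewrite -mulrA -exprVn mulr_sumr.
  under eq_bigr do rewrite -exprMn -eE.
  apply: (@le_trans _ _ ((m%:R * `|e|) ^+ 4)).
    by rewrite lerXn2r ?nnegrE ?norm2_ge0 ?mulr_ge0// norm2_le_mx_norm.
  rewrite exprMn ler_wpM2l ?exprn_ge0//.
  have S0 : 0 <= \sum_i e 0 i ^+ 4 by apply: sumr_ge0 => i _; rewrite exprn_even_ge0.
  rewrite -[leRHS](sqr_sqrtr S0) -(sqr_sqrtr (sqrtr_ge0 (\sum_i e 0 i ^+ 4))) -exprM.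
  rewrite lerXn2r ?nnegrE ?sqrtr_ge0//.
  apply: mx_norm_le => [|i]; first exact: sqrtr_ge0.
  rewrite -(@ler_pXn2r _ 4)// ?nnegrE ?sqrtr_ge0// -normrX ger0_norm ?exprn_even_ge0//.
  rewrite [leRHS](_ : _ = \sum_i e 0 i ^+ 4).
    by rewrite (bigD1 i)//= lerDl sumr_ge0// => j _; rewrite exprn_even_ge0.
  by rewrite (exprM _ 2 2) !sqr_sqrtr ?sqrtr_ge0.
Qed.

End deviations.

(** * One iteration of the algorithm *)

Section algorithm_step.
Context {R : realType} {m : nat} {d : measure_display} {Xi : measurableType d}.
Context (F : Xi -> 'rV[R]_m -> 'rV[R]_m) (X : set 'rV[R]_m).
Context (alphahat lambda theta : R) (beta : nat -> R) (N : nat -> nat).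
Context (s : forall k, 'I_(N k) -> Xi) (k : nat).
Hypotheses (X0 : X !=set0) (closedX : closed X) (convexX : convex_set X).
Hypotheses (alpha01 : 0 < alphahat <= 1) (lambda01 : 0 < lambda < 1).
Hypotheses (theta01 : 0 < theta < 1) (beta0 : 0 < beta k).

Local Notation Fhat := (empirical_mean F (@s k)).
Local Notation prox := (prox_point F X beta s k).
Local Notation trial := (trial_point F X beta s k).
Local Notation accepted := (accepted_steps F X alphahat lambda theta beta s k).
Local Notation is_step := (is_linesearch_step F X alphahat lambda theta beta s k).
Local Notation step := (linesearch_step F X alphahat lambda theta beta s k).
Local Notation next := (next_iterate F X alphahat lambda theta beta s k).

Context (x : 'rV[R]_m).
Hypothesis Xx : X x.

Lemma prox_in : X (prox x).
Proof. exact: proj_in. Qed.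

Lemma next_in : X (next x).
Proof. exact: proj_in. Qed.

(** The projection inequality tested at [x] itself; it amounts to the line-search test at step 0
    with 1 in place of [lambda]. *)
Lemma prox_inner : norm2 (x - prox x) ^+ 2 <= beta k * inner (Fhat x) (x - prox x).
Proof.
have := proj_inner X0 closedX convexX (x - beta k *: Fhat x) Xx.
rewrite -/(prox x) addrAC innerBl innerZl sqr_norm2 => h.
by rewrite -subr_le0.
Qed.

Lemma norm2_prox_le : norm2 (x - prox x) <= beta k * norm2 (Fhat x).
Proof.
have := prox_inner; have := inner_le (Fhat x) (x - prox x).
have := norm2_ge0 (x - prox x); have := norm2_ge0 (Fhat x).
move: (inner _ _) (norm2 (x - _)) (norm2 _) => i r f f0 r0 i1 i2.
have [->|rn0] := eqVneq r 0; first by rewrite mulr_ge0// ltW.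
have rp : 0 < r by rewrite lt0r rn0.
by rewrite -(ler_pM2r rp) -expr2 (le_trans i2)// -mulrA ler_wpM2l// ltW.
Qed.

Lemma sub_trial a : x - trial x a = a *: (x - prox x).
Proof.
by rewrite /trial_point; move: (prox x) => p; apply/rowP => i; rewrite !mxE; ring.
Qed.

Lemma trial_in a : 0 <= a <= 1 -> X (trial x a).
Proof. by move=> a01; apply: convex_set_comb => //; exact: prox_in. Qed.

Lemma accepted_bounds a : accepted x a -> 0 < a <= alphahat.
Proof.
move=> [[l ->] _]; have /andP[t0 t1] := theta01; have /andP[a0 a1] := alpha01.
by rewrite mulr_gt0 ?exprn_gt0//= ler_piMl ?exprn_ile1 ?ltW.
Qed.

Section holder.
Context (Lh delta : R).
Hypothesis delta0 : 0 < delta.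
Hypothesis Lh0 : 0 <= Lh.
Hypothesis Fhat_holder : forall y z, norm2 (Fhat y - Fhat z) <= Lh * norm2 (y - z) `^ delta.

(** The test of [prox_inner] at [x] is stronger than required, and by the Hölder bound it survives
    with [lambda] at nearby trial points. The largest accepted step is the one of least exponent. *)
Lemma linesearch_exists : exists a, is_step x a.
Proof.
have /andP[t0 t1] := theta01; have /andP[a0 a1] := alpha01.
have /andP[l0 l1] := lambda01.
set r := norm2 (x - prox x); have r0 : 0 <= r by exact: norm2_ge0.
suff [l al] : exists l, accepted x (theta ^+ l * alphahat).
  pose acc l := `[< accepted x (theta ^+ l * alphahat) >].
  have accP : exists l, acc l by exists l; exact/asboolP.
  have [i /asboolP iacc imin] := ex_minnP accP.
  exists (theta ^+ i * alphahat); split=> // b bacc.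
  have [[j bE] _] := bacc; rewrite bE ler_wpM2r ?(ltW a0)//.
  by apply: ler_wiXn2l; rewrite ?ltW// imin//; apply/asboolP; rewrite -bE.
have [r_eq0|r_neq0] := eqVneq r 0.
  exists 0%N; split; first by exists 0%N.
  by rewrite -/r r_eq0 expr0n mulr0 (norm2_eq0 r_eq0) innerr0.
have rp : 0 < r by rewrite lt0r r_neq0.
(* The slack between the tests with 1 and with [lambda], divided by r. *)
pose e := (1 - lambda) / beta k * r.
have e0 : 0 < e by rewrite mulr_gt0// divr_gt0// subr_gt0.
have [l le] : exists l, Lh * (theta ^+ l * alphahat * r) `^ delta <= e.
  have [Lh_eq0|Lh_neq0] := eqVneq Lh 0.
    by exists 0%N; rewrite Lh_eq0 mul0r ltW.
  have Lhp : 0 < Lh by rewrite lt0r Lh_neq0.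
  pose u := (e / Lh) `^ delta^-1; have u0 : 0 < u by rewrite powR_gt0// divr_gt0.
  have /cvgr0Pnorm_lt/(_ (u / (alphahat * r))) : theta ^+ n @[n --> \oo] --> (0 : R).
    by apply: cvg_expr; rewrite ger0_norm// ltW.
  rewrite divr_gt0 ?mulr_gt0// => /(_ isT)[n _ /(_ n (leqnn n))] /= tn.
  exists n; rewrite mulrC -ler_pdivlMr//.
  have -> : e / Lh = u `^ delta.
    by rewrite /u -powRrM mulVf ?gt_eqF// powRr1// divr_ge0// ltW.
  apply: ge0_ler_powR; rewrite ?nnegrE ?(ltW u0) ?(ltW delta0)//.
    by rewrite !mulr_ge0 ?exprn_ge0 ?(ltW t0) ?(ltW a0).
  rewrite -mulrA -ler_pdivlMr ?mulr_gt0// ltW// (le_lt_trans _ tn)//.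
  exact: ler_norm.
exists l; split; first by exists l.
set a := theta ^+ l * alphahat in le *.
have aa0 : 0 <= a by rewrite mulr_ge0 ?exprn_ge0 ?(ltW t0) ?(ltW a0).
rewrite -/r.
have : `|inner (Fhat (trial x a) - Fhat x) (x - prox x)| <= e * r.
  apply: le_trans (norm_inner_le _ _) _; rewrite -/r ler_wpM2r//.
  apply: le_trans le; apply: le_trans (Fhat_holder _ _) _.
  by rewrite norm2_distC sub_trial norm2Z ger0_norm.
rewrite innerBl ler_norml => /andP[h _].
have := prox_inner; rewrite -/r -ler_pdivrMl// => h2.
move: h h2; rewrite /e; move: (inner _ _) (inner _ _) => i1 i2.
have : 0 < (beta k)^-1 by rewrite invr_gt0.
move: (beta k)^-1 => b b0; nra.
Qed.

Lemma linesearchP : is_step x (step x).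
Proof. exact: (xgetPex 0 linesearch_exists). Qed.

Lemma step_bounds : 0 < step x <= alphahat.
Proof. by have [/accepted_bounds] := linesearchP. Qed.

(** Unless the exponent is 0, [step x / theta] is the preceding candidate, larger than the maximal
    accepted step, hence rejected. *)
Lemma step_rejected : step x = alphahat \/
  inner (Fhat (trial x (step x / theta))) (x - prox x) <
    lambda / beta k * norm2 (x - prox x) ^+ 2.
Proof.
have /andP[t0 t1] := theta01.
have [[[l aE] acc] amax] := linesearchP; case: l aE => [|l] aE.
  by left; rewrite aE expr0 mul1r.
right; rewrite ltNge; apply/negP => h.
have aE' : step x / theta = theta ^+ l * alphahat.
  by rewrite aE exprS; field; rewrite gt_eqF.
have /amax : accepted x (step x / theta) by split => //; exists l.
rewrite ler_pdivrMr// leNgt => /negP; apply.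
have /andP[a0 _] := step_bounds.
by rewrite -[ltRHS]mulr1 ltr_pM2l.
Qed.

Let z := trial x (step x).

(** The signed distance from [x] to the hyperplane through the trial point orthogonal to [Fhat]
    there; it is 0 when that vector vanishes, because 0^-1 = 0. *)
Definition displacement : R :=
  inner (Fhat (trial x (step x))) (x - trial x (step x)) /
  norm2 (Fhat (trial x (step x))).

Let step0 : 0 <= step x. Proof. by have /andP[/ltW] := step_bounds. Qed.

Let lb0 : 0 < lambda / beta k.
Proof. by have /andP[l0 _] := lambda01; rewrite divr_gt0. Qed.

Let accepted_step :
  lambda / beta k * norm2 (x - prox x) ^+ 2 <= inner (Fhat z) (x - prox x).
Proof. by have [[_ ]] := linesearchP. Qed.

Let accepted_step_trial :
  step x * (lambda / beta k * norm2 (x - prox x) ^+ 2) <= inner (Fhat z) (x - z).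
Proof. by rewrite sub_trial innerZr ler_wpM2l. Qed.

Let inner_step_ge0 : 0 <= inner (Fhat z) (x - z).
Proof.
apply: le_trans accepted_step_trial.
by rewrite mulr_ge0 ?step0// mulr_ge0 ?sqr_ge0// ltW.
Qed.

Let displacementM : displacement * norm2 (Fhat z) = inner (Fhat z) (x - z).
Proof.
rewrite /displacement -/z; have [f0|f0] := eqVneq (norm2 (Fhat z)) 0.
  by rewrite (norm2_eq0 f0) innerC innerr0 !mul0r.
by rewrite divfK.
Qed.

Lemma displacement_ge :
  step x * (lambda / beta k * norm2 (x - prox x) ^+ 2) <=
  displacement * norm2 (Fhat (trial x (step x))).
Proof. by rewrite displacementM. Qed.

Lemma displacement_ge0 : 0 <= displacement.
Proof. by rewrite divr_ge0 ?norm2_ge0. Qed.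

Let gamma := inner (Fhat z) (x - z) * norm2 (Fhat z) ^- 2.

Let gammaM : gamma * norm2 (Fhat z) = displacement.
Proof.
rewrite /gamma /displacement -/z; have [f0|f0] := eqVneq (norm2 (Fhat z)) 0.
  by rewrite f0 invr0 !mulr0.
by field.
Qed.

Let gamma_ge0 : 0 <= gamma.
Proof. by rewrite mulr_ge0// invr_ge0 sqr_ge0. Qed.

(* The accepted step keeps [Fhat z] bounded below by a multiple of the length of
   [x - prox x], while [inner (Fhat z) (x - z)] is at most that length times
   [norm2 (Fhat z)]: the quotient defining [gamma] cannot blow up. *)
Let gamma_le : gamma <= beta k / lambda.
Proof.
have /andP[l0 _] := lambda01.
have b0 : 0 <= beta k / lambda by rewrite divr_ge0// ltW.
have [f0|fn0] := eqVneq (norm2 (Fhat z)) 0.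
  by rewrite /gamma (norm2_eq0 f0) innerC innerr0 mul0r.
have f0 : 0 < norm2 (Fhat z) by rewrite lt0r fn0 norm2_ge0.
set r := norm2 (x - prox x); have r0 : 0 <= r := norm2_ge0 _.
have step1 : step x <= 1.
  by have /andP[_ /le_trans->] := step_bounds => //; case/andP: alpha01.
have lr : lambda / beta k * r <= norm2 (Fhat z).
  have := accepted_step; rewrite -/r => /le_trans/(_ (inner_le _ _)); rewrite -/r.
  have [->|rn0] := eqVneq r 0; first by rewrite !mulr0 => _; exact: ltW.
  by rewrite expr2 mulrA ler_pM2r// lt0r rn0.
rewrite /gamma ler_pdivrMr ?exprn_gt0// sub_trial innerZr.
apply: (@le_trans _ _ (norm2 (Fhat z) * r)).
  apply: le_trans (inner_le (Fhat z) (x - prox x)).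
  rewrite ler_piMl//; apply: le_trans accepted_step.
  by rewrite mulr_ge0 ?sqr_ge0// ltW.
rewrite mulrC expr2 mulrA ler_pM2r// mulrC.
by rewrite -ler_pdivrMr ?divr_gt0// invf_div mulrC.
Qed.

(** The projection being nonexpansive, expand the square of the distance before projecting. In the
    cross term [x - xs] is split at [z]: the first part contributes [gamma] times the squared norm
    of [Fhat z], the second the sign condition on [Tz] plus the sampling error, whose factor [gamma]
    is at most [beta k / lambda]. *)
Lemma next_fejer (xs Tz : 'rV[R]_m) : X xs -> 0 <= inner Tz (z - xs) ->
  norm2 (next x - xs) ^+ 2 + displacement ^+ 2 <=
  norm2 (x - xs) ^+ 2 + 2 * (beta k / lambda) * (norm2 (Fhat z - Tz) * norm2 (z - xs)).
Proof.
move=> Xxs Tz0.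
have nextE : next x = proj X (x - gamma *: Fhat z) by [].
have pr : norm2 (next x - xs) ^+ 2 <= norm2 (x - gamma *: Fhat z - xs) ^+ 2.
  rewrite nextE lerXn2r ?nnegrE ?norm2_ge0//.
  exact: proj_dist_le.
apply: le_trans (lerD pr (lexx _)) _.
rewrite addrAC sqr_norm2_subZ -gammaM.
rewrite [(gamma * norm2 _) ^+ 2]exprMn.
have h1 : inner (Fhat z) (x - xs) = inner (Fhat z) (x - z) + inner Tz (z - xs) +
    inner (Fhat z - Tz) (z - xs).
  by rewrite !innerE; ring.
have gM : gamma * norm2 (Fhat z) ^+ 2 = inner (Fhat z) (x - z).
  by rewrite expr2 mulrA gammaM displacementM.
have h2 : - (norm2 (Fhat z - Tz) * norm2 (z - xs)) <= inner (Fhat z - Tz) (z - xs).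
  by have := norm_inner_le (Fhat z - Tz) (z - xs); rewrite ler_norml => /andP[].
have e0 : 0 <= norm2 (Fhat z - Tz) * norm2 (z - xs) by rewrite mulr_ge0 ?norm2_ge0.
have h3 : gamma * (norm2 (Fhat z - Tz) * norm2 (z - xs)) <=
    beta k / lambda * (norm2 (Fhat z - Tz) * norm2 (z - xs)).
  by rewrite ler_wpM2r.
rewrite h1 -gM.
move: Tz0 h2 h3 e0.
move: (inner Tz _) (inner (_ - Tz) _) (_ * norm2 (z - xs)) => t i e t0 i0 e1 e2.
have gt : 0 <= gamma * t by rewrite mulr_ge0.
have ge : 0 <= gamma * (i + e) by rewrite mulr_ge0//; lra.
move: (norm2 (x - xs) ^+ 2) (norm2 (Fhat z) ^+ 2) (beta k / lambda) e1 => u f b e1.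
lra.
Qed.

Lemma dist_trial_le : norm2 (trial x (step x) - x) <= norm2 (x - prox x).
Proof.
rewrite norm2_distC sub_trial norm2Z ger0_norm// ler_piMl ?norm2_ge0//.
by have /andP[_ /le_trans->] := step_bounds => //; case/andP: alpha01.
Qed.

Lemma trial_step_in : X (trial x (step x)).
Proof.
apply: trial_in; rewrite step0/=.
by have /andP[_ /le_trans->] := step_bounds => //; case/andP: alpha01.
Qed.

End holder.

End algorithm_step.

(** * Measurability of one iteration *)

Section measurable_iterates.
Context {R : realType} {m : nat} {d d0 : measure_display}.
Context {Xi : measurableType d} {T0 : measurableType d0}.
Context (F : Xi -> 'rV[R]_m -> 'rV[R]_m) (X : set 'rV[R]_m).
Context (alphahat lambda theta : R) (beta : nat -> R) (N : nat -> nat) (k : nat).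
Hypotheses (X0 : X !=set0) (closedX : closed X) (convexX : convex_set X).
Hypothesis mF : measurable_fun setT
  (fun u : Xi * borel_rV R m => F u.1 u.2 : borel_rV R m).
Context (s : T0 -> forall k, 'I_(N k) -> Xi).
Hypothesis ms : forall j, measurable_fun setT (fun t => @s t k j).

Lemma measurable_empirical_mean (u : T0 -> borel_rV R m) : measurable_fun setT u ->
  measurable_fun setT (fun t => empirical_mean F (@s t k) (u t) : borel_rV R m).
Proof.
move=> mu; apply: measurable_rowvec => i; rewrite /empirical_mean.
under eq_fun do rewrite mxE summxE.
apply: measurable_funM => //; apply: measurable_sum => j.
have mp : measurable_fun setT (fun t => (@s t k j, u t)) by exact: measurable_fun_pair.
exact: measurable_rowvec_coord (measurableT_comp mF mp).
Qed.

Context (u : T0 -> borel_rV R m).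
Hypothesis mu : measurable_fun setT u.

Lemma measurable_prox_point :
  measurable_fun setT (fun t => prox_point F X beta (@s t) k (u t) : borel_rV R m).
Proof.
have mproj := continuous_measurable_rV2 (continuous_proj X0 closedX convexX).
apply: (measurableT_comp mproj).
apply: (measurable_rowvecB mu); apply: measurable_rowvecZ => //.
exact: measurable_empirical_mean.
Qed.

Lemma measurable_trial_point (a : T0 -> R) : measurable_fun setT a ->
  measurable_fun setT (fun t => trial_point F X beta (@s t) k (u t) (a t) : borel_rV R m).
Proof.
move=> ma; apply: measurable_rowvecD; apply: measurable_rowvecZ => //.
  exact: measurable_prox_point.
by apply: measurable_funB.
Qed.

Hypothesis stepP : forall t,
  is_linesearch_step F X alphahat lambda theta beta (@s t) k (u t)
    (linesearch_step F X alphahat lambda theta beta (@s t) k (u t)).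

(** The maximal accepted step exceeds [a] iff one of the countably many candidates above [a] is
    accepted. *)
Lemma measurable_linesearch_step :
  measurable_fun setT (fun t => linesearch_step F X alphahat lambda theta beta (@s t) k (u t)).
Proof.
apply: (measurability _ (RGenOInfty.measurableE R)) => _ [_ [a ->] <-].
rewrite setTI.
pose acc l : set T0 :=
  [set t | lambda / beta k * norm2 (u t - prox_point F X beta (@s t) k (u t)) ^+ 2 <=
    inner (empirical_mean F (@s t k) (trial_point F X beta (@s t) k (u t) (theta ^+ l * alphahat)))
      (u t - prox_point F X beta (@s t) k (u t))].
have macc l : measurable (acc l).
  have mup := measurable_rowvecB mu measurable_prox_point.
  have := measurable_fun_ler
    (measurable_funM (measurable_cst (lambda / beta k))
      (measurable_funX 2 (measurable_norm2 mup)))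
    (measurable_inner (measurable_empirical_mean (measurable_trial_point
      (measurable_cst (theta ^+ l * alphahat)))) mup).
  move=> /(_ measurableT [set true])/(_ I); rewrite setTI.
  by congr measurable; apply/seteqP; split.
rewrite (_ : _ @^-1` _ = \bigcup_(l in [set l | a < theta ^+ l * alphahat]) acc l).
  by apply: bigcup_measurable => l _; exact: macc.
apply/seteqP; split => [t|t [l /= al tl]]; rewrite /= in_itv/= andbT.
  by have [[[l ->] lacc] _] := stepP t => al; exists l.
have [_ tmax] := stepP t; apply: lt_le_trans al _; apply: tmax.
by split; [exists l|exact: tl].
Qed.

Lemma measurable_next_iterate : measurable_fun setT
  (fun t => next_iterate F X alphahat lambda theta beta (@s t) k (u t) : borel_rV R m).
Proof.
have mproj := continuous_measurable_rV2 (continuous_proj X0 closedX convexX).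
have mz := measurable_trial_point measurable_linesearch_step.
have mFz := measurable_empirical_mean mz.
apply: (measurableT_comp mproj).
apply: (measurable_rowvecB mu); apply: measurable_rowvecZ => //.
apply: measurable_funM; first exact: measurable_inner mFz (measurable_rowvecB mu mz).
have mn := measurable_funX 2 (measurable_norm2 mFz).
(* The factor [norm2 _ ^- 2] is the real power -1 of the squared norm. *)
have := measurableT_comp (measurable_powR (R := R) (-1)) mn.
by congr measurable_fun; apply/funext => t; rewrite /= powR_inv1// sqr_ge0.
Qed.

End measurable_iterates.

(** * Summable errors and real sequences *)

Section summability.
Context {R : realType} {d : measure_display} {T : measurableType d}.
Context (mu : probability T R).

(** By monotone convergence the whole series has finite mean, so it is finite almost everywhere and
    bounds its partial sums. *)
Lemma ae_bounded_series (M : nat -> T -> R) (e : nat -> R) (B : R) :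
  (forall k x, 0 <= M k x) -> (forall k, mean_le mu (M k) (e k)) ->
  (forall n, \sum_(k < n) e k <= B) ->
  \forall x \ae mu, exists b, forall n, \sum_(k < n) M k x <= b.
Proof.
move=> M0 Me eB.
have mM k : measurable_fun setT (fun x => (M k x)%:E).
  by apply/measurable_EFinP; exact: mean_le_measurable (Me k).
pose S x := (\sum_(k <oo) (M k x)%:E)%E.
have M0E k x : [set: T] x -> (0 <= (M k x)%:E)%E by rewrite lee_fin.
have mS : measurable_fun setT S.
  by apply: ge0_emeasurable_sum => // k x Tx _; exact: M0E.
have S0 x : (0 <= S x)%E by apply: nneseries_ge0 => k _ _; rewrite lee_fin.
have iS : mu.-integrable setT S.
  apply/integrableP; split=> //.
  under eq_integral do rewrite gee0_abs//.
  rewrite integral_nneseries//.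
  apply: (@le_lt_trans _ _ B%:E); last exact: ltry.
  apply: lime_le; first
    by apply: is_cvg_nneseries => k _ _; apply: integral_ge0 => x _; rewrite lee_fin.
  near=> n; apply: (@le_trans _ _ (\sum_(0 <= k < n) (e k)%:E)%E).
    by apply: lee_sum => k _; have [] := Me k.
  by rewrite sumEFin lee_fin big_mkord.
apply: filterS (integrable_ae measurableT iS) => x /(_ I) Sfin.
exists (fine (S x)) => n; rewrite -lee_fin fineK//.
have -> : (\sum_(k < n) M k x)%:E = (\sum_(0 <= k < n) (M k x)%:E)%E.
  by rewrite sumEFin big_mkord.
by apply: nneseries_lim_ge => k _; rewrite lee_fin.
Unshelve. all: by end_near. Qed.

End summability.

Section real_sequences.
Context {R : realType}.

Lemma cvgn_series_bounded (c : nat -> R) : (forall k, 0 <= c k) -> cvgn (series c) ->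
  exists B, forall n, \sum_(k < n) c k <= B.
Proof.
move=> c0 cc; exists (limn (series c)) => n.
rewrite -(big_mkord predT) -/(series c n); apply: nondecreasing_cvgn_le => //.
by apply: nondecreasing_series => k _ _.
Qed.

Lemma cvgn_bounded (u : nat -> R) (l : R) : u @ \oo --> l -> exists b, forall k, u k <= b.
Proof.
move=> ul; have /cvg_seq_bounded/= [c [_ /(_ (c + 1))]] := cvgP _ ul.
rewrite ltrDl ltr01 => /(_ isT) h; exists (c + 1) => k.
by apply: le_trans (ler_norm _) _; exact: h.
Qed.

Lemma bounded_series_cvg0 (u : nat -> R) (B : R) : (forall k, 0 <= u k) ->
  (forall n, \sum_(k < n) u k <= B) -> u @ \oo --> (0 : R).
Proof.
move=> u0 uB; apply: cvg_series_cvg_0.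
apply: nondecreasing_is_cvgn; first by apply: nondecreasing_series => k _ _.
by exists B => _ [n _ <-]; rewrite /series/= big_mkord.
Qed.

(** The recursion reads 1 + b_{k+1} = (1 + b_k)(1 + c_k), and 1 + c <= exp c. *)
Lemma discrete_gronwall (b c : nat -> R) (B : R) : (forall k, 0 <= c k) -> 0 <= b 0%N ->
  (forall k, b k.+1 = b k + c k * (1 + b k)) -> (forall n, \sum_(k < n) c k <= B) ->
  forall n, 0 <= b n /\ 1 + b n <= (1 + b 0%N) * expR B.
Proof.
move=> c0 b0 bS cB.
have bn0 n : 0 <= b n.
  by elim: n => // n IHn; rewrite bS addr_ge0// mulr_ge0// addr_ge0.
have bnE n : 1 + b n <= (1 + b 0%N) * expR (\sum_(k < n) c k).
  elim: n => [|n IHn]; first by rewrite big_ord0 expR0 mulr1.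
  rewrite big_ord_recr/= expRD mulrA bS.
  rewrite (_ : 1 + _ = (1 + b n) * (1 + c n)); last by ring.
  by rewrite ler_pM ?addr_ge0// expR_ge1Dx.
move=> n; split => //; apply: le_trans (bnE n) _.
by rewrite ler_wpM2l ?addr_ge0// ler_expR.
Qed.

Lemma cvg_powR0 {T : Type} (F : set_system T) {FF : Filter F} (u : T -> R) (p : R) :
  0 < p -> (forall t, 0 <= u t) -> u @ F --> (0 : R) -> (u t `^ p) @[t --> F] --> (0 : R).
Proof.
move=> p0 u0 /cvgr0Pnorm_lt ucvg; apply/cvgr0Pnorm_lt => e e0.
have := ucvg (e `^ p^-1); rewrite powR_gt0// => /(_ isT).
apply: filterS => t; rewrite ger0_norm// ger0_norm ?powR_ge0// => ut.
have -> : e = (e `^ p^-1) `^ p.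
  by rewrite -powRrM mulVf ?gt_eqF// powRr1// ltW.
by apply: gt0_ltr_powR; rewrite ?nnegrE ?powR_ge0.
Qed.

(** The sum of the squared deviations from the average is nonnegative. *)
Lemma sqr_sum_le (I : Type) (s : seq I) (f : I -> R) : (0 < size s)%N ->
  (\sum_(i <- s) f i) ^+ 2 <= (size s)%:R * \sum_(i <- s) f i ^+ 2.
Proof.
move=> s0; set S := \sum_(i <- s) f i; set Q := \sum_(i <- s) _.
have n0 : 0 < (size s)%:R :> R by rewrite ltr0n.
have : 0 <= \sum_(i <- s) (f i - S / (size s)%:R) ^+ 2.
  by apply: sumr_ge0 => i _; exact: sqr_ge0.
under eq_bigr do rewrite sqrrB.
rewrite big_split/= sumrB -/Q; under [X in _ - X]eq_bigr do rewrite -mulrnAr.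
rewrite -mulr_suml -/S big_const_seq count_predT iter_addr_0.
rewrite -[(S / _) ^+ 2 *+ _]mulr_natl => h.
rewrite -subr_ge0 [leRHS](_ : _ = (size s)%:R * (Q - S * (S / (size s)%:R *+ 2) +
   (size s)%:R * (S / (size s)%:R) ^+ 2)); first by rewrite mulr_ge0// ltW.
by rewrite -mulr_natr; field; rewrite gt_eqF.
Qed.

End real_sequences.

(** * Cluster points and distance to the solution set *)

Section limit_points.
Context {R : realType} {m : nat} (X : set 'rV[R]_m) (T : 'rV[R]_m -> 'rV[R]_m).
Context (x : nat -> 'rV[R]_m).
Hypotheses (closedX : closed X) (continuousT : continuous T) (Xx : forall k, X (x k)).
Hypothesis residual : forall y, X y -> exists2 e : nat -> R, e @ \oo --> (0 : R) &
  forall k, - e k <= inner (T (x k)) (y - x k).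

Local Notation Xstar := (VI_solutions T X).

Let continuous_gap y : continuous (fun v => inner (T v) (y - v)).
Proof.
apply: continuous_big => [|i _ v]; first exact: add_continuous.
have h1 : T v' 0 i @[v' --> v] --> T v 0 i.
  by apply: (@cvg_comp _ _ _ T (fun u : 'rV[R]_m => u 0 i) (nbhs v) (nbhs (T v)));
    [exact: continuousT|exact: coord_continuous].
have h2 : (y - v') 0 i @[v' --> v] --> (y - v) 0 i.
  apply: (@cvg_comp _ _ _ (fun v => y - v) (fun u : 'rV[R]_m => u 0 i) (nbhs v)
    (nbhs (y - v))); last exact: coord_continuous.
  by apply: cvgB; [exact: cvg_cst|exact: cvg_id].
exact: (cvgM h1 h2).
Qed.

(** If the gap at [c] were negative for some [y], continuity would keep it below half of that value
    near [c], against a lower bound by a null sequence. *)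
Lemma cluster_VI_solutions : cluster (x @ \oo) `<=` Xstar.
Proof.
move=> c cl; have Xc : X c.
  apply: closedX => B nB; have [|z [Xz Bz]] := cl X B _ nB; last by exists z.
  by exists 0%N => // k _; exact: Xx.
split=> // y Xy; rewrite leNgt; apply/negP => gap0.
have [e e0 xe] := residual Xy.
pose g : R := inner (T c) (y - c) / 2; have g0 : g < 0 by rewrite /g; lra.
have gE : inner (T c) (y - c) = 2 * g by rewrite /g; field.
have nB : nbhs c [set v | inner (T v) (y - v) < g].
  have /cvgrPdist_lt/(_ (- g)) := @continuous_gap y c.
  rewrite oppr_gt0 g0 => /(_ isT); apply: filterS => v.
  rewrite /= ltr_norml => /andP[h _]; move: h; rewrite gE; lra.
have ev : (x @ \oo) [set v | g < inner (T v) (y - v)].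
  have /cvgr0Pnorm_lt/(_ (- g)) := e0.
  rewrite oppr_gt0 g0 => /(_ isT); apply: filterS => k; rewrite ltr_norml => /andP[_ h].
  by rewrite /=; apply: lt_le_trans (xe k); rewrite ltrNr.
by have [v [/= v1 v2]] := cl _ _ ev nB; move: (lt_trans v1 v2); rewrite ltxx.
Qed.

Lemma dist2_ge0 C (v : 'rV[R]_m) : 0 <= dist2 v C.
Proof.
rewrite /dist2; have [->|C0] := eqVneq C set0; first by rewrite image_set0 inf0.
apply: lb_le_inf; first by apply/image_nonempty; exact/set0P.
by move=> _ [u _ <-]; exact: norm2_ge0.
Qed.

Lemma dist2_le (C : set 'rV[R]_m) (v u : 'rV[R]_m) : C u -> dist2 v C <= norm2 (v - u).
Proof.
move=> Cu; apply: ge_inf; last by exists u.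
by exists 0 => _ [z _ <-]; exact: norm2_ge0.
Qed.

(** Otherwise infinitely many iterates stay at distance at least [e]; lying in a compact box, they
    cluster at a point, which is a solution. The filter [x @ (within S \oo)] plays the part of the
    subsequence. *)
Lemma dist2_VI_solutions_cvg0 (c : 'rV[R]_m) (M : R) :
  (forall k, norm2 (x k - c) <= M) -> (fun k => dist2 (x k) Xstar) @ \oo --> (0 : R).
Proof.
move=> xM; apply/cvgr0Pnorm_lt => e e0; apply: contrapT => nev.
pose K := [set v : 'rV[R]_m | forall i, (`[c 0 i - M, c 0 i + M]%classic : set R) (v 0 i)].
have Kc : compact K.
  apply: (@rV_compact R m (fun i => `[c 0 i - M, c 0 i + M]%classic)) => i.
  exact: segment_compact.
have Kx k : K (x k).
  move=> i; rewrite /= in_itv/=; have := le_trans (coord_le_norm2 (x k - c) i) (xM k).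
  by rewrite coordB ler_norml; move: (x k 0 i) (c 0 i) => a b /andP[? ?]; apply/andP; split; lra.
pose S : set nat := [set k | e <= dist2 (x k) Xstar].
pose G : set_system 'rV[R]_m := x @ (within S \oo).
have GP : ProperFilter G.
  split=> [[n _ nB]|]; last by apply: fmap_filter; exact: within_filter.
  apply: nev; exists n => // k nk; rewrite /= ger0_norm ?dist2_ge0//.
  by rewrite ltNge; apply/negP => Sk; exact: (nB k nk Sk).
have GK : G K by exists 0%N => // k _ _; exact: Kx.
have [c' [_ clG]] := Kc G GP GK.
have Xc' : Xstar c'.
  apply: cluster_VI_solutions => A B [n _ nA] nB; apply: clG => //.
  by exists n => // k nk _; exact: nA.
have GS : G [set v | e <= dist2 v Xstar] by exists 0%N => // k _.
have nB : nbhs c' [set v | norm2 (v - c') < e].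
  have /cvgr0Pnorm_lt/(_ e e0) := cvg_norm2_nbhs c'.
  by apply: filterS => v; rewrite ger0_norm ?norm2_ge0.
have [v [/= v1 v2]] := clG _ _ GS nB.
by have := le_lt_trans (le_trans v1 (dist2_le v Xc')) v2; rewrite ltxx.
Qed.

End limit_points.

(** * Convergence along almost every path *)

Section stochastic_step.
Context {R : realType} {m : nat} {d d' : measure_display}.
Context {Xi : measurableType d} {Om : measurableType d'}.
Context {P : probability Xi R} {Pr : probability Om R}.
Context (X : set 'rV[R]_m) (F : Xi -> 'rV[R]_m -> 'rV[R]_m) (L : Xi -> R).
Context (delta : R) (N : nat -> nat) (xi : forall k, 'I_(N k) -> {RV Pr >-> Xi}).
Context (betatilde alphahat lambda theta : R) (beta : nat -> R).
Context (xs : 'rV[R]_m) (h1 h2 : R).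

Hypotheses (closedX : closed X) (convexX : convex_set X) (Xxs : X xs).
Hypotheses (alpha01 : 0 < alphahat <= 1) (lambda01 : 0 < lambda < 1).
Hypotheses (theta01 : 0 < theta < 1) (delta01 : 0 < delta <= 1).
Hypothesis beta_bounds : forall k, 0 < beta k <= betatilde.
Hypothesis N0 : forall k, (0 < N k)%N.
Hypothesis mF : measurable_fun setT
  (fun u : Xi * borel_rV R m => F u.1 u.2 : borel_rV R m).
Hypothesis mL : measurable_fun setT L.
Hypothesis L0 : forall x, 0 <= L x.
Hypothesis F_holder : forall x y z,
  norm2 (F x y - F x z) <= L x * norm2 (y - z) `^ delta.
Hypothesis Hh1 : mean_le P (envelope F L xs) h1.
Hypothesis Hh2 : mean_le P (fun x => envelope F L xs x ^+ 2) h2.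

Let index := {k : nat & 'I_(N k)}.
Let Y (i : index) := xi (tagged i).
Hypothesis indY : mutually_independent Y.
Hypothesis lawY : forall i A, measurable A -> distribution Pr (Y i) A = P A.

Local Notation T := (mean_operator P F).
Local Notation sample := (fun (w : Om) k (j : 'I_(N k)) => @xi k j w).

Definition block k : seq index :=
  [seq Tagged (fun k => 'I_(N k)) j | j <- enum 'I_(N k)].

Lemma size_block k : size (block k) = N k.
Proof. by rewrite size_map size_enum_ord. Qed.

Lemma mem_block k (i : index) : (i \in block k) = (tag i == k).
Proof.
apply/mapP/eqP => [[j _ ->]//|]; case: i => k' j /= kk'; case: _ / kk'.
by exists j; rewrite ?mem_enum.
Qed.

Lemma uniq_block k : uniq (block k).
Proof.
rewrite map_inj_uniq ?enum_uniq// => i j /eqP.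
by rewrite eq_Tagged => /eqP.
Qed.

Lemma empirical_meanE k w y :
  empirical_mean F (@sample w k) y - T y = empirical_deviation (P := P) Y F (block k) y w.
Proof.
rewrite /empirical_deviation size_block; congr (_ *: _ - _).
by rewrite big_map big_enum.
Qed.

Let X0 : X !=set0. Proof. by exists xs. Qed.

Let Fhat k w := empirical_mean F (@sample w k).

Lemma empirical_mean_holder k w y z : norm2 (Fhat k w y - Fhat k w z) <=
  ((N k)%:R^-1 * sample_sum Y (block k) L w) * norm2 (y - z) `^ delta.
Proof.
rewrite /Fhat /empirical_mean -scalerBr norm2Z ger0_norm ?invr_ge0// -mulrA.
rewrite ler_wpM2l ?invr_ge0// /sample_sum big_map big_enum mulr_suml -sumrB.
elim/big_ind2 : _ => [|u a v b ua vb|j _]; first by rewrite norm2_0.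
  by rewrite (le_trans (norm2D _ _))// lerD.
exact: F_holder.
Qed.

Let Lhat_ge0 k w : 0 <= (N k)%:R^-1 * sample_sum Y (block k) L w.
Proof. by rewrite mulr_ge0 ?invr_ge0// sumr_ge0. Qed.

Let beta0 k : 0 < beta k. Proof. by have /andP[] := beta_bounds k. Qed.

Let delta0 : 0 < delta. Proof. by have /andP[] := delta01. Qed.

Local Notation prox w k := (prox_point F X beta (sample w) k).
Local Notation trial w k := (trial_point F X beta (sample w) k).
Local Notation step w k := (linesearch_step F X alphahat lambda theta beta (sample w) k).

Lemma sample_linesearchP w k x : X x ->
  is_linesearch_step F X alphahat lambda theta beta (sample w) k x (step w k x).
Proof.
move=> Xx; apply: (linesearchP X0 closedX convexX _ lambda01 theta01 _ _ delta0
  (Lhat_ge0 k w)) => //; exact: empirical_mean_holder.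
Qed.

Definition sampling_error k x w : R :=
  let z := trial w k x (step w k x) in
  norm2 (Fhat k w z - T z) * norm2 (z - xs).

Lemma sampling_error_ge0 k x w : 0 <= sampling_error k x w.
Proof. by rewrite mulr_ge0 ?norm2_ge0. Qed.

Lemma mean_operator_cvg {S : Type} (G : set_system S) {FG : Filter G}
    (f : S -> 'rV[R]_m) x :
  norm2 (f t - x) @[t --> G] --> (0 : R) -> norm2 (T (f t) - T x) @[t --> G] --> (0 : R).
Proof.
move=> fx; have fxd := cvg_powR0 (FF := FG) delta0 (fun t => norm2_ge0 (f t - x)) fx.
have fxd0 : (m%:R * h1 * norm2 (f t - x) `^ delta) @[t --> G] --> (0 : R).
  by rewrite -(mulr0 (m%:R * h1)); exact: (cvgM (cvg_cst _) fxd).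
apply: (squeeze_cvgr _ (cvg_cst 0) fxd0); near=> t.
rewrite norm2_ge0/=.
exact: (mean_operator_holder2 delta01 mF L0 F_holder Hh1).
Unshelve. all: by end_near. Qed.

Lemma continuous_mean_operator : continuous (T : 'rV[R]_m -> 'rV[R]_m).
Proof.
move=> x; apply: (@norm2_cvg _ _ _ (nbhs x) _ T (T x)).
exact: (mean_operator_cvg (@cvg_norm2_nbhs _ _ x)).
Qed.

Section measurable_error.
Context {d0 : measure_display} {T0 : measurableType d0} (k : nat).
Context (v : T0 -> Om) (u : T0 -> borel_rV R m).
Hypothesis mv : forall j, measurable_fun setT (fun t => @xi k j (v t)).
Hypothesis mu : measurable_fun setT u.
Hypothesis Xu : forall t, X (u t).

Let stepP t := sample_linesearchP (v t) k (Xu t).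

(** The space [T0] is left free: the lemma serves at a fixed point, along the iterates, and on the
    product of the space of points and the fresh block. *)
Lemma measurable_sampling_error : measurable_fun setT (fun t => sampling_error k (u t) (v t)).
Proof.
have mstep := measurable_linesearch_step X0 closedX convexX mF (s := sample \o v) mv mu stepP.
have mz := measurable_trial_point beta X0 closedX convexX mF (s := sample \o v) mv mu mstep.
have mFz := measurable_empirical_mean mF (s := sample \o v) mv mz.
have mTz := measurableT_comp (continuous_measurable_rV2 continuous_mean_operator) mz.
by apply: measurable_funM; apply: measurable_norm2; apply: measurable_rowvecB.
Qed.

Lemma measurable_next_sample : measurable_fun setT (fun t =>
  next_iterate F X alphahat lambda theta beta (sample (v t)) k (u t) : borel_rV R m).
Proof.
exact: (measurable_next_iterate X0 closedX convexX mF (s := sample \o v) mv mu stepP).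
Qed.

Lemma measurable_prox_sample : measurable_fun setT (fun t =>
  prox (v t) k (u t) : borel_rV R m).
Proof.
exact: (measurable_prox_point beta X0 closedX convexX mF (s := sample \o v) mv mu).
Qed.

End measurable_error.

Let sqrtN0 k : 0 < Num.sqrt (N k)%:R :> R.
Proof. by rewrite sqrtr_gt0 ltr0n. Qed.

Let uniform_dev : exists2 C : R, 0 <= C &
  forall (rho : R) k, 0 < rho ->
  exists2 U : Om -> R,
    mean_le Pr U (C * (1 + rho) / Num.sqrt (N k)%:R) &
    forall y, norm2 (y - xs) <= rho -> forall w, norm2 (Fhat k w y - T y) <= U w.
Proof.
have [C C0 CU] := uniform_deviation indY lawY delta01 mF L0 F_holder Hh1 Hh2.
exists C => // rho k rho0.
have [|U U1 U2] := CU rho (block k) rho0 (uniq_block k); first by rewrite size_block.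
exists U; first by rewrite -[in N k](size_block k).
by move=> y yr w; rewrite empirical_meanE; exact: U2.
Qed.

Let measurable_error_at k x : X x -> measurable_fun setT (sampling_error k x).
Proof.
by move=> Xx; apply: (measurable_sampling_error (v := id) (u := cst x)).
Qed.

Let trial_in_X w k x : X x -> X (trial w k x (step w k x)).
Proof.
move=> Xx; exact: (trial_step_in X0 closedX convexX alpha01 lambda01 theta01 (beta0 k)
  Xx delta0 (Lhat_ge0 k w) (empirical_mean_holder k w)).
Qed.

Let dist_trial w k x : X x ->
  norm2 (trial w k x (step w k x) - x) <= betatilde * norm2 (Fhat k w x).
Proof.
move=> Xx; have /andP[_ bk] := beta_bounds k.
apply: (@le_trans _ _ (beta k * norm2 (Fhat k w x))).
  apply: (@le_trans _ _ (norm2 (x - prox w k x))); last first.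
    exact: norm2_prox_le.
  exact: (dist_trial_le X0 closedX convexX alpha01 lambda01 theta01 (beta0 k)
    Xx delta0 (Lhat_ge0 k w) (empirical_mean_holder k w)).
by rewrite ler_wpM2r ?norm2_ge0.
Qed.

(** When [X] is bounded the trial point never leaves a fixed ball, so one uniform deviation bound
    controls the whole error. *)
Lemma mean_error_bounded (D : R) : (forall x, X x -> norm2 (x - xs) <= D) ->
  exists2 C : R, 0 <= C & forall k x, X x ->
  mean_le Pr (sampling_error k x) (C * (1 + norm2 (x - xs) ^+ 2) / Num.sqrt (N k)%:R).
Proof.
move=> XD; have [C C0 CU] := uniform_dev.
have D0 : 0 <= D by apply: le_trans (XD xs Xxs); exact: norm2_ge0.
exists (D * (C * (2 + D))); first by rewrite !mulr_ge0// addr_ge0.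
move=> k x Xx.
(* The radius must be positive and [D] may be 0, hence [1 + D]. *)
have [|U U1 U2] := CU (1 + D) k; first by rewrite (lt_le_trans ltr01)// lerDl.
apply: mean_leW (mean_le_dom (measurable_error_at k Xx) _ (mean_leZ D0 U1)).
  rewrite !mulrA ler_wpM2r ?invr_ge0 ?sqrtr_ge0//.
  have := sqr_ge0 (norm2 (x - xs)); move: (_ ^+ 2) => n n0.
  rewrite (_ : 1 + (1 + D) = 2 + D); last by ring.
  by rewrite ler_peMr ?lerDl// !mulr_ge0// addr_ge0.
move=> w; rewrite ger0_norm ?sampling_error_ge0// /sampling_error mulrC.
set z := trial w k x _; have Xz : X z by exact: trial_in_X.
rewrite ler_pM ?norm2_ge0//; first exact: XD.
by apply: U2; rewrite (le_trans (XD z Xz))// lerDr.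
Qed.

Let tau : R := m%:R * (2 * h1).

Let h10 : 0 <= h1.
Proof. by apply: mean_le_ge0 Hh1 => x; rewrite addr_ge0// norm2_ge0. Qed.

Let tau0 : 0 <= tau. Proof. by rewrite !mulr_ge0. Qed.

Let mean_operator_le y : norm2 (T y) <= tau * (1 + norm2 (y - xs)).
Proof.
apply: le_trans (norm2_le_sum _) _.
rewrite /tau -mulrA -[m in m%:R]card_ord mulr_natl -sumr_const.
by apply: ler_sum => i _; exact: (mean_operator_growth delta01 mF L0 F_holder Hh1).
Qed.

Let Hhat k w := (N k)%:R^-1 * sample_sum Y (block k) (envelope F L xs) w.

Let Hhat_ge0 k w : 0 <= Hhat k w.
Proof.
rewrite mulr_ge0 ?invr_ge0//; apply: sumr_ge0 => i _.
by rewrite addr_ge0// norm2_ge0.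
Qed.

Let empirical_mean_le k w y : norm2 (Fhat k w y) <= Hhat k w * (2 + norm2 (y - xs)).
Proof.
rewrite /Fhat /empirical_mean norm2Z ger0_norm ?invr_ge0// /Hhat -mulrA.
rewrite ler_wpM2l ?invr_ge0// /sample_sum big_map big_enum mulr_suml.
elim/big_ind2 : _ => [|u a v b ua vb|j _]; first by rewrite norm2_0.
  by rewrite (le_trans (norm2D _ _))// lerD.
exact: (operator_growth xs delta01 L0 F_holder).
Qed.

Let mean_sqr_Hhat k : mean_le Pr (fun w => (Hhat k w + tau) ^+ 2) (2 * h2 + 2 * tau ^+ 2).
Proof.
have N0R : 0 < (N k)%:R :> R by rewrite ltr0n.
have i0 : 0 <= 2 / (N k)%:R :> R by rewrite divr_ge0// ltW.
have S2 := mean_leZ i0 (mean_le_sample_sum lawY (block k) Hh2).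
apply: mean_leW (mean_le_dom _ _ (mean_leD S2 (mean_le_cst Pr (2 * tau ^+ 2)))).
- by rewrite size_block mulrA divfK ?gt_eqF.
- apply: measurable_funX; apply: measurable_funD => //; apply: measurable_funM => //.
  by apply: measurable_sample_sumT; exact: mean_le_measurable Hh1.
- move=> w; rewrite ger0_norm ?sqr_ge0//=.
  have := @sqr_sum_le _ _ (block k) (fun i => envelope F L xs (Y i w)).
  rewrite size_block => /(_ (N0 k)); rewrite /Hhat /sample_sum.
  set S := \sum_(i <- _) envelope _ _ _ _; set Q := \sum_(i <- _) _ ^+ 2 => SQ.
  have {SQ} : ((N k)%:R^-1 * S) ^+ 2 <= (N k)%:R^-1 * Q.
    rewrite exprMn expr2 -mulrA ler_wpM2l ?invr_ge0// ?(ltW N0R)//.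
    by rewrite mulrC ler_pdivrMr// mulrC.
  move: (_^-1 * S) => a; rewrite mulrAC -mulrA mulrC => h.
  have := sqr_ge0 (a - tau); rewrite -[_ / _]mulrC in h *; nra.
Qed.

Lemma mean_error_moment4 h4 : mean_le P (fun x => envelope F L xs x ^+ 4) h4 ->
  exists2 C : R, 0 <= C & forall k x, X x ->
  mean_le Pr (sampling_error k x) (C * (1 + norm2 (x - xs) ^+ 2) / Num.sqrt (N k)%:R).
Proof.
move=> Hh4.
have [C C0 CU] := uniform_dev.
have [C4 C40 M4] := empirical_deviation_moment4 indY lawY delta01 mF L0 F_holder
  Hh1 Hh2 Hh4.
have bt0 : 0 <= betatilde.
  by have /andP[/ltW b0 /(le_trans b0)] := beta_bounds 0%N.
(* Chosen so that [norm2 (z - xs)] is at most [kappa] times the larger of [A] and the deviation [e]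
   at [x]. *)
pose kappa := 1 + betatilde * (tau + 1).
have tau1 : 0 <= tau + 1 by rewrite addr_ge0.
have kappa1 : 1 <= kappa by rewrite lerDl mulr_ge0.
have kappa0 : 0 < kappa := lt_le_trans ltr01 kappa1.
pose K := (2 + kappa) * kappa.
have K0 : 0 <= K by rewrite mulr_ge0 ?(ltW kappa0)// addr_ge0// ltW.
have h20 : 0 <= 2 * h2 + 2 * tau ^+ 2.
  by apply: mean_le_ge0 (mean_sqr_Hhat 0) => w; exact: sqr_ge0.
pose C' := kappa * (1 + kappa) * C + K * (2 * h2 + 2 * tau ^+ 2) + K * C4.
have C'0 : 0 <= C'.
  by rewrite !addr_ge0 ?mulr_ge0 ?(ltW kappa0)// addr_ge0// ltW.
(* The factor 2 comes from (1 + n)^2 <= 2 (1 + n^2). *)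
exists (C' * 2); first by rewrite mulr_ge0.
move=> k x Xx; set n := norm2 (x - xs); pose A := 1 + n.
have n0 : 0 <= n := norm2_ge0 _.
have A1 : 1 <= A by rewrite lerDl.
have A0 : 0 < A := lt_le_trans ltr01 A1.
pose q := Num.sqrt (N k)%:R : R; have q0 : 0 < q := sqrtN0 k.
have q1 : 1 <= q by rewrite -[leLHS]sqrtr1 ler_sqrt ?ler0n// ler1n.
have qE : (N k)%:R = q ^+ 2 by rewrite sqr_sqrtr.
have kA0 : 0 < kappa * A by rewrite mulr_gt0.
have [U U1 U2] := CU (kappa * A) k kA0.
have U0 w : 0 <= U w.
  by apply: le_trans (U2 xs _ w); rewrite ?norm2_ge0// subrr norm2_0 ltW.
(* The weight of the AM-GM step that bounds W e^2: s W^2 has mean of order A^2 / q, and e^4 / s has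
   mean of order A^2 / q^3, no larger as q >= 1. *)
pose s := A ^+ 2 / q; have s0 : 0 < s by rewrite divr_gt0// exprn_gt0.
have := M4 x (block k) (uniq_block k); rewrite size_block => /(_ (N0 k)) {}M4.
have si0 : 0 <= s^-1 by rewrite invr_ge0 ltW.
have Bnd := mean_leD (mean_leZ (ltW kA0) U1)
  (mean_leZ K0 (mean_leD (mean_leZ (ltW s0) (mean_sqr_Hhat k)) (mean_leZ si0 M4))).
apply: mean_leW (mean_le_dom (measurable_error_at k Xx) _ Bnd).
  rewrite -/q qE -/n -/A.
  apply: (@le_trans _ _ (C' * A ^+ 2 / q)); last first.
    rewrite ler_wpM2r ?invr_ge0 ?(ltW q0)// -mulrA ler_wpM2l//.
    rewrite /A; have := sqr_ge0 (n - 1); nra.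
  have qi0 : 0 <= q^-1 by rewrite invr_ge0 ltW.
  have qi1 : q^-1 <= 1 by rewrite invf_le1.
  have t1 : kappa * A * (C * (1 + kappa * A) / q) <= kappa * (1 + kappa) * C * A ^+ 2 / q.
    rewrite (_ : kappa * A * _ = kappa * A * C * (1 + kappa * A) / q); last by ring.
    rewrite [leRHS](_ : _ = kappa * A * C * ((1 + kappa) * A) / q); last by ring.
    rewrite ler_wpM2r// ler_wpM2l ?mulr_ge0 ?(ltW kappa0) ?(ltW A0)//.
    by rewrite [leRHS]mulrDl mul1r lerD2r.
  have t3 : s^-1 * (C4 * A ^+ 4 / q ^+ 2 ^+ 2) <= C4 * A ^+ 2 / q.
    rewrite (_ : s^-1 * _ = C4 * A ^+ 2 * (q^-1 * q^-1 * q^-1)); last first.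
      by rewrite /s -exprM; field; rewrite !gt_eqF.
    have CA0 : 0 <= C4 * A ^+ 2 by rewrite mulr_ge0// sqr_ge0.
    by rewrite ler_wpM2l// ler_piMl// -expr2 exprn_ile1.
  have t2 : s * (2 * h2 + 2 * tau ^+ 2) = (2 * h2 + 2 * tau ^+ 2) * A ^+ 2 / q.
    by rewrite /s; ring.
  rewrite t2 -subr_ge0; have := lerD t1 (ler_wpM2l K0 t3); rewrite -subr_ge0 => t.
  by apply: le_trans t _; rewrite le_eqVlt; apply/orP; left; apply/eqP; rewrite /C'; ring.
move=> w; rewrite ger0_norm ?sampling_error_ge0// /sampling_error.
rewrite -empirical_meanE -/(Fhat k w x).
have Tx := mean_operator_le x; have dz := dist_trial w k Xx.
set z := trial w k x _ in dz *; set e := norm2 (Fhat k w x - T x).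
have e0 : 0 <= e := norm2_ge0 _.
have zxs : norm2 (z - xs) <= betatilde * (tau * A + e) + n.
  apply: le_trans (norm2_triangle x z xs) _; rewrite lerD2r.
  apply: le_trans dz _; rewrite ler_wpM2l//.
  rewrite -(subrK (T x) (Fhat k w x)) (le_trans (norm2D _ _))// addrC lerD//.
have V0 : 0 <= K * (s * (Hhat k w + tau) ^+ 2 + s^-1 * e ^+ 4).
  by rewrite mulr_ge0// addr_ge0// mulr_ge0 ?sqr_ge0 ?(ltW s0)// exprn_even_ge0.
(* Either [z] stays in the ball of radius [kappa * A], controlled by [U], or [e > A >= 1] and every
   factor is bounded through [e]. *)
have [eA|Ae] := leP e A.
  have zk : norm2 (z - xs) <= kappa * A.
    apply: le_trans zxs _; rewrite /kappa [leRHS]mulrDl mul1r addrC lerD//.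
      by rewrite lerDr.
    by rewrite -mulrA ler_wpM2l// mulrDl mul1r lerD2l.
  rewrite -[leLHS]addr0 lerD// mulrC.
  by rewrite ler_pM ?norm2_ge0//; exact: U2.
have e1 : 1 <= e by rewrite ltW// (le_lt_trans A1).
have zk : norm2 (z - xs) <= kappa * e.
  apply: le_trans zxs _; rewrite /kappa [leRHS]mulrDl mul1r addrC lerD//.
    by rewrite (le_trans _ (ltW Ae))// lerDr.
  by rewrite -mulrA ler_wpM2l// mulrDl mul1r lerD2r ler_wpM2l// ltW.
have Fz : norm2 (Fhat k w z - T z) <= (Hhat k w + tau) * ((2 + kappa) * e).
  apply: le_trans (norm2B _ _) _.
  apply: le_trans (lerD (empirical_mean_le k w z) (mean_operator_le z)) _.
  have zb : 2 + norm2 (z - xs) <= (2 + kappa) * e.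
    rewrite [leRHS]mulrDl lerD// -[leLHS]mulr1 ler_wpM2l//.
  rewrite mulrDl lerD// ler_wpM2l ?Hhat_ge0//.
  by apply: le_trans zb; rewrite lerD2r ler1n.
set W := Hhat k w + tau in Fz V0 *.
have W0 : 0 <= W by rewrite addr_ge0// Hhat_ge0.
apply: (@le_trans _ _ (K * (W * e ^+ 2))).
  rewrite (_ : K * _ = W * ((2 + kappa) * e) * (kappa * e)); last by rewrite /K; ring.
  by rewrite ler_pM ?norm2_ge0.
rewrite (le_trans (y := K * (s * W ^+ 2 + s^-1 * e ^+ 4)))//; last first.
  by rewrite lerDr mulr_ge0// ltW.
rewrite ler_wpM2l//.
(* AM-GM *)
have := sqr_ge0 (s * W - e ^+ 2).
rewrite sqrrB -exprM => h.
have hs : 0 <= s^-1 * ((s * W) ^+ 2 - s * W * e ^+ 2 *+ 2 + e ^+ 4) by rewrite mulr_ge0.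
have We : 0 <= W * e ^+ 2 by rewrite mulr_ge0// sqr_ge0.
move: hs; rewrite (_ : s^-1 * _ = s * W ^+ 2 - 2 * (W * e ^+ 2) + s^-1 * e ^+ 4).
  by lra.
by field; rewrite gt_eqF.
Qed.

Context (x0 : 'rV[R]_m).
Hypothesis Xx0 : X x0.

Let iter k w := iterate F X alphahat lambda theta beta x0 (sample w) k.

Lemma iterate_in k w : X (iter k w).
Proof. by case: k => [|k] //; exact: next_in. Qed.

Let before k : set index := [set i | (tag i < k)%N].

(** Measurability with respect to the samples of the earlier blocks, not merely on [Om]:
    independence from the fresh block rests on it. *)
Lemma measurable_iterate k :
  measurable_fun [set: sigma_of Y (before k)] (iter k : sigma_of Y (before k) -> borel_rV R m).
Proof.
elim: k => [|k IHk]; first exact: measurable_cst.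
apply: (measurable_next_sample (v := id : sigma_of Y (before k.+1) -> Om) (u := iter k)).
- move=> j; apply: (measurable_sample (Y := Y) (D := before k.+1)
    (i := Tagged (fun k => 'I_(N k)) j)).
  exact: ltnSn.
- apply: (measurableT_comp IHk); apply: measurable_sigma_ofS => i /=.
  exact: ltnW.
- by move=> w; exact: iterate_in.
Qed.

Lemma measurable_iterateT k : measurable_fun [set: Om] (iter k : Om -> borel_rV R m).
Proof.
exact: (measurableT_comp (@measurable_iterate k) (measurable_of_subfamily (Y:=Y) (D:=before k))).
Qed.

Lemma independent_block k :
  independent_maps Pr (id : Om -> sigma_of Y (before k)) (id : Om -> sigma_of Y [set` block k]).
Proof.
apply: independent_sigma_of => //; apply/seteqP; split => // i [/= ik].
by rewrite mem_block => /eqP ik'; move: ik; rewrite /before /= ik' ltnn.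
Qed.

Let independent_iterate k :
  independent_maps Pr (iter k : Om -> borel_rV R m) (id : Om -> sigma_of Y [set` block k]).
Proof.
move=> A B mA mB.
have mi := @measurable_iterate k measurableT _ mA; rewrite setTI in mi.
exact: (independent_block mi mB).
Qed.

Let measurable_block_sample k (j : 'I_(N k)) :
  measurable_fun [set: sigma_of Y [set` block k]] (@xi k j : sigma_of Y [set` block k] -> Xi).
Proof.
apply: (measurable_sample (Y := Y) (D := [set` block k])
  (i := Tagged (fun k => 'I_(N k)) j)).
by rewrite /= mem_block.
Qed.

Definition path_error k w := sampling_error k (iter k w) w.

Let dist2_path k w := norm2 (iter k w - xs) ^+ 2.

Let measurable_dist2_path k : measurable_fun setT (dist2_path k).
Proof.
apply: measurable_funX; apply: measurable_norm2; apply: measurable_rowvecB => //.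
exact: measurable_iterateT.
Qed.

Let measurable_path_error k : measurable_fun setT (path_error k).
Proof.
apply: (measurable_sampling_error (v := id) (u := iter k)) => //.
- exact: measurable_iterateT.
- by move=> w; exact: iterate_in.
Qed.

Context (C : R).
Hypothesis C0 : 0 <= C.
Hypothesis mean_error : forall k x, X x ->
  mean_le Pr (sampling_error k x) (C * (1 + norm2 (x - xs) ^+ 2) / Num.sqrt (N k)%:R).

(* The iterate of index k is independent of the k-th block of samples, so the
   bound at a deterministic point can be integrated along the path. *)
Lemma mean_path_error k A : mean_le Pr (dist2_path k) A ->
  mean_le Pr (path_error k) (C / Num.sqrt (N k)%:R * (1 + A)).
Proof.
move=> meanA; apply: ge0_mean_leP => //.
  by move=> w; exact: sampling_error_ge0.
(* The sampling error is known to be measurable only at points of [X], hence the projection; at the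
   iterates it is the identity. *)
pose h (z : borel_rV R m * sigma_of Y [set` block k]) : \bar R :=
  (sampling_error k (proj X z.1) z.2)%:E.
have mh : measurable_fun setT h.
  apply/measurable_EFinP; apply: (measurable_sampling_error
    (v := fun z : borel_rV R m * sigma_of Y [set` block k] => z.2 : Om)
    (u := fun z : borel_rV R m * sigma_of Y [set` block k] => proj X z.1 : borel_rV R m)).
  - by move=> j; apply: measurableT_comp => //; exact: measurable_block_sample.
  - apply: measurableT_comp => //.
    exact: continuous_measurable_rV2 (continuous_proj X0 closedX convexX).
  - by move=> z; exact: proj_in.
have -> : (\int[Pr]_w (path_error k w)%:E = \int[Pr]_w h (iter k w, w))%E.
  apply: eq_integral => w _; rewrite /h /path_error /= proj_id//.
  exact: iterate_in.
rewrite (ge0_integral_independent (h := h) (@measurable_iterateT k)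
  (measurable_of_subfamily (Y := Y) (D := [set` block k]))
  (@independent_iterate k) mh)//; last first.
  by move=> z; rewrite lee_fin sampling_error_ge0.
have cN0 : 0 <= C / Num.sqrt (N k)%:R by rewrite divr_ge0// sqrtr_ge0.
have [_] := mean_leZ cN0 (mean_leD (mean_le_cst Pr 1) meanA).
apply: le_trans; apply: ge0_le_integral => //=.
- by move=> w _; apply: integral_ge0 => w' _; rewrite lee_fin sampling_error_ge0.
- have mI := measurable_integral_section Pr (h := h)
    (measurable_of_subfamily (Y := Y) (D := [set` block k])) mh.
  apply: (measurableT_comp (mI _) (@measurable_iterateT k)) => z.
  by rewrite lee_fin sampling_error_ge0.
- apply/measurable_EFinP; apply: measurable_funM => //.
  by apply: measurable_funD => //; exact: measurable_dist2_path.
- move=> w _; rewrite /h /= proj_id//; last exact: iterate_in.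
  have [_ /le_trans->//] := mean_error k (iterate_in k w).
  by rewrite lee_fin mulrAC.
Qed.

Hypothesis monT : forall y, X y -> 0 <= inner (T y) (y - xs).
Hypothesis sumN : cvgn (series (fun k => (Num.sqrt (N k)%:R : R)^-1)).

Definition path_displacement k w : R :=
  displacement F X alphahat lambda theta beta (sample w) k (iter k w).

Lemma path_fejer k w : dist2_path k.+1 w + path_displacement k w ^+ 2 <=
  dist2_path k w + 2 * (betatilde / lambda) * path_error k w.
Proof.
have Xk := iterate_in k w.
have := next_fejer X0 closedX convexX alpha01 lambda01 theta01 (beta0 k) Xk delta0
  (Lhat_ge0 k w) (empirical_mean_holder k w) Xxs (monT (trial_in_X w k Xk)).
move=> /le_trans; apply; rewrite lerD2l ler_wpM2r ?sampling_error_ge0//.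
have /andP[l0 _] := lambda01; have /andP[_ bk] := beta_bounds k.
by rewrite ler_wpM2l// ler_wpM2r// invr_ge0 ltW.
Qed.

Let noise k : R := 2 * (betatilde / lambda) * (C / Num.sqrt (N k)%:R).

Let kappa0 : 0 <= 2 * (betatilde / lambda).
Proof.
have /andP[l0 _] := lambda01; have /andP[/ltW b0 /(le_trans b0) bt0] := beta_bounds 0%N.
by rewrite mulr_ge0// divr_ge0// ltW.
Qed.

Let noise_ge0 k : 0 <= noise k.
Proof. by rewrite mulr_ge0// divr_ge0// sqrtr_ge0. Qed.

Let sumN_bounded : exists B : R, forall n, \sum_(k < n) (Num.sqrt (N k)%:R : R)^-1 <= B.
Proof. by apply: (cvgn_series_bounded _ sumN) => k; rewrite invr_ge0 sqrtr_ge0. Qed.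

Let mean_dist2_path : exists A : R, forall k, mean_le Pr (dist2_path k) A.
Proof.
(* The recursion obtained by integrating [path_fejer], the displacement dropped and the error
   bounded by [mean_path_error]. *)
pose fix b k := if k is j.+1 then b j + noise j * (1 + b j) else norm2 (x0 - xs) ^+ 2.
have [B sB] := sumN_bounded.
have cB n : \sum_(k < n) noise k <= 2 * (betatilde / lambda) * C * B.
  under eq_bigr do rewrite /noise mulrA.
  by rewrite -mulr_sumr ler_wpM2l// mulr_ge0.
exists ((1 + b 0%N) * expR (2 * (betatilde / lambda) * C * B)) => k.
have [_ bk] := discrete_gronwall noise_ge0 (sqr_ge0 _ : 0 <= b 0%N) (fun k => erefl) cB k.
apply: (@mean_leW _ _ _ _ _ (b k)); first by rewrite (le_trans _ bk)// lerDr.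
elim: k {bk} => [|k IHk]; first exact: (mean_le_cst Pr (b 0%N)).
have me := mean_path_error IHk.
apply: mean_leW (mean_le_dom (@measurable_dist2_path k.+1) _
  (mean_leD IHk (mean_leZ kappa0 me))).
  by rewrite /= /noise !mulrA.
move=> w; rewrite ger0_norm ?sqr_ge0//; apply: le_trans (path_fejer k w).
by rewrite lerDl sqr_ge0.
Qed.

Lemma ae_path_error_bounded :
  \forall w \ae Pr, exists B : R, forall n, \sum_(k < n) path_error k w <= B.
Proof.
have [A meanA] := mean_dist2_path; have [B sB] := sumN_bounded.
have A0 : 0 <= A by apply: mean_le_ge0 (meanA 0%N) => w; exact: sqr_ge0.
apply: (ae_bounded_series (e := fun k => C / Num.sqrt (N k)%:R * (1 + A))
  (B := C * B * (1 + A))).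
- by move=> k w; exact: sampling_error_ge0.
- by move=> k; exact: mean_path_error.
- by move=> n; rewrite -mulr_suml -mulr_sumr ler_wpM2r ?addr_ge0// ler_wpM2l.
Qed.

(** Balls of integer radius catch every bounded path and, being countably many, share one null set.
    On each ball the bounds have summable means, so almost surely their series converges and they
    tend to 0. *)
Lemma ae_uniform_deviation : \forall w \ae Pr, forall rho : nat,
  exists2 u : nat -> R, u @ \oo --> (0 : R) &
  forall k y, norm2 (y - xs) <= rho%:R -> norm2 (Fhat k w y - T y) <= u k.
Proof.
have [K K0 KU] := uniform_dev; have [B sB] := sumN_bounded.
apply: ae_foralln => rho.
have rho0 : 0 < rho%:R + 1 :> R by rewrite ltr_wpDl.
have /choice[U UP] : forall k, exists U : Om -> R,
    mean_le Pr U (K * (1 + (rho%:R + 1)) / Num.sqrt (N k)%:R) /\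
    forall y, norm2 (y - xs) <= rho%:R + 1 ->
      forall w, norm2 (Fhat k w y - T y) <= U w.
  by move=> k; have [U] := KU _ k rho0; exists U.
have U0 k w : 0 <= U k w.
  have [_ /(_ xs _ w)] := UP k; rewrite subrr norm2_0 ltW// => /(_ isT).
  exact: le_trans (norm2_ge0 _).
have /(_ (K * (1 + (rho%:R + 1)) * B)) := ae_bounded_series U0 (fun k => proj1 (UP k)).
have cB n : \sum_(k < n) K * (1 + (rho%:R + 1)) / Num.sqrt (N k)%:R <=
    K * (1 + (rho%:R + 1)) * B.
  by rewrite -mulr_sumr ler_wpM2l// mulr_ge0// addr_ge0// ltW.
move=> /(_ cB); apply: filterS => w [b sb].
exists (fun k => U k w); first exact: bounded_series_cvg0 sb.
move=> k y yr; have [_] := UP k; apply.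
by rewrite (le_trans yr)// lerDl.
Qed.

(* The stopping test at the iterate of index k succeeds almost surely for a fresh
   block of samples as well, so that its conclusion can be averaged. *)
Lemma ae_stop_solution k (A : set Om) : measurable (A : set (sigma_of Y (before k))) ->
  (\forall w \ae Pr, A w -> iter k w = prox w k (iter k w)) ->
  \forall w \ae Pr, A w -> VI_solutions T X (iter k w).
Proof.
move=> mA stopA.
pose S1 := sigma_of Y (before k); pose S2 := sigma_of Y [set` block k].
pose r (z : S1 * S2) := norm2 (iter k z.1 - prox z.2 k (iter k z.1)).
pose B : set (S1 * S2) := [set z | A z.1 -> r z = 0].
have mr : measurable_fun setT r.
  have miter : measurable_fun setT (fun z : S1 * S2 => iter k z.1 : borel_rV R m).
    exact: measurableT_comp (@measurable_iterate k) _.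
  apply: measurable_norm2; apply: measurable_rowvecB => //.
  apply: (measurable_prox_sample (v := fun z : S1 * S2 => z.2 : Om)
    (u := fun z : S1 * S2 => iter k z.1 : borel_rV R m)) => //.
  by move=> j; apply: measurableT_comp => //; exact: measurable_block_sample.
have mB : measurable B.
  rewrite (_ : B = (fst @^-1` ~` (A : set S1)) `|` r @^-1` [set 0]).
    apply: measurableU; last by rewrite -[X in measurable X]setTI; exact: mr.
    rewrite -[X in measurable X]setTI; apply: measurable_fst => //.
    exact: measurableC.
  apply/seteqP; split => z /=.
    by move=> Bz; have [Az|nAz] := pselect (A z.1); [right; exact: Bz|left].
  by rewrite /B /=; move=> [nAz /nAz|].
have aeB : \forall w \ae Pr, B ((w : S1), (w : S2)).
  by apply: filterS stopA => w h /h; rewrite /r /= => {1}->; rewrite subrr norm2_0.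
have := ae_independent (measurable_of_subfamily (Y := Y) (D := before k))
  (measurable_of_subfamily (Y := Y) (D := [set` block k])) (@independent_block k) mB aeB.
apply: filterS => w aew' Aw; set x := iter k w.
have Xx : X x by exact: iterate_in.
split => // y Xy.
(* At a fixed point of the test the projection inequality reduces to
   [0 <= inner (Fhat k w' x) (y - x)]; multiplied by [N k], this is a sum over the block. *)
have ge0 : \forall w' \ae Pr,
    0 <= sample_sum Y (block k) (fun z => inner (F z x) (y - x)) w'.
  apply: filterS aew' => w' /(_ Aw)/norm2_eq0/eqP; rewrite subr_eq0 => /eqP /= xE.
  have := proj_inner X0 closedX convexX (x - beta k *: Fhat k w' x) Xy.
  rewrite -[proj X _]/(prox w' k x) -xE addrAC subrr add0r innerNl innerZl oppr_le0.
  rewrite pmulr_rge0// /Fhat /empirical_mean innerZl pmulr_rge0 ?invr_gt0 ?ltr0n//.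
  rewrite /sample_sum big_map big_enum.
  rewrite (big_morph (fun u => inner u (y - x)) (id1 := 0) (op1 := +%R))//.
    by move=> u v; exact: innerDl.
  by rewrite innerC innerr0.
have [ig le] := mean_le_sample_sum lawY (block k)
  (mean_inner_operator delta01 mF L0 F_holder Hh1 x (y - x)).
move: le; rewrite size_block => /(le_trans _) le.
suff : (0 <= ((N k)%:R * inner (T x) (y - x))%:E)%E.
  by rewrite lee_fin pmulr_rge0// ltr0n.
apply: le.
have mS : measurable_fun setT (sample_sum Y (block k) (fun z => inner (F z x) (y - x))).
  by case/integrableP : ig => /measurable_EFinP.
rewrite (ae_eq_integral (fun w' =>
    `|sample_sum Y (block k) (fun z => inner (F z x) (y - x)) w'|%:E))//.
- by apply: integral_ge0 => w' _; rewrite lee_fin.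
- exact/measurable_EFinP.
- by apply/measurable_EFinP; exact: measurableT_comp.
- by apply: filterS ge0 => w' h _; rewrite ger0_norm.
Qed.

Context (betahat : R).
Hypothesis betahat0 : 0 < betahat.
Hypothesis betahat_le : forall k, betahat <= beta k.

(** * Deterministic analysis of a single path *)

Section path.
Context (w : Om) (B : R).
Hypothesis error_bounded : forall n, \sum_(k < n) path_error k w <= B.
Hypothesis unif_dev : forall rho : nat, exists2 u : nat -> R, u @ \oo --> (0 : R) &
  forall k y, norm2 (y - xs) <= rho%:R -> norm2 (Fhat k w y - T y) <= u k.

Let x k := iter k w.
Let p k := prox w k (x k).
Let a k := step w k (x k).
Let r k := norm2 (x k - p k).
Let D k := path_displacement k w.

Let Xx k : X (x k). Proof. exact: iterate_in. Qed.

Let r0 k : 0 <= r k. Proof. exact: norm2_ge0. Qed.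

Let a_bounds k : 0 < a k <= alphahat.
Proof.
exact: (step_bounds X0 closedX convexX alpha01 lambda01 theta01 (beta0 k) (Xx k) delta0
  (Lhat_ge0 k w) (empirical_mean_holder k w)).
Qed.

Let a0 k : 0 < a k. Proof. by have /andP[] := a_bounds k. Qed.

Let D0 k : 0 <= D k.
Proof.
exact: (displacement_ge0 X0 closedX convexX alpha01 lambda01 theta01 (beta0 k) (Xx k) delta0
  (Lhat_ge0 k w) (empirical_mean_holder k w)).
Qed.

Let fejer n : dist2_path n w + \sum_(k < n) D k ^+ 2 <=
  norm2 (x0 - xs) ^+ 2 + 2 * (betatilde / lambda) * B.
Proof.
suff h : dist2_path n w + \sum_(k < n) D k ^+ 2 <=
    dist2_path 0 w + 2 * (betatilde / lambda) * \sum_(k < n) path_error k w.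
  by apply: le_trans h _; rewrite lerD2l ler_wpM2l.
elim: n => [|n IHn]; first by rewrite !big_ord0 mulr0.
rewrite !big_ord_recr/= mulrDr.
have := path_fejer n w; rewrite -/(D n); lra.
Qed.

Lemma path_bounded : exists M : nat, forall k, norm2 (x k - xs) <= M%:R.
Proof.
pose b := norm2 (x0 - xs) ^+ 2 + 2 * (betatilde / lambda) * B.
have hb k : dist2_path k w <= b.
  by apply: le_trans (fejer k); rewrite lerDl sumr_ge0// => i _; exact: sqr_ge0.
have b0 : 0 <= b by apply: le_trans (hb 0%N); exact: sqr_ge0.
exists (Num.bound (1 + b)) => k.
apply: (@le_trans _ _ (1 + b)); last by apply/ltW/archi_boundP; rewrite addr_ge0.
apply: le_trans (_ : 1 + dist2_path k w <= _); last by rewrite lerD2l.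
have := sqr_ge0 (norm2 (x k - xs) - 1); rewrite /dist2_path -/(x k); nra.
Qed.

Let D_cvg0 : D @ \oo --> (0 : R).
Proof.
have D2 : (fun k => D k ^+ 2) @ \oo --> (0 : R).
  apply: (bounded_series_cvg0 (B := norm2 (x0 - xs) ^+ 2 + 2 * (betatilde / lambda) * B)).
    by move=> k; exact: sqr_ge0.
  by move=> n; apply: le_trans (fejer n); rewrite lerDr sqr_ge0.
move/cvgr0Pnorm_lt : D2 => D2; apply/cvgr0Pnorm_lt => e e0.
apply: filterS (D2 _ (exprn_gt0 2 e0)) => k.
rewrite ger0_norm ?sqr_ge0// ger0_norm//.
by rewrite ltr_pXn2r ?nnegrE ?D0// ltW.
Qed.

Let le_r k : r k <= betatilde * norm2 (Fhat k w (x k)).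
Proof.
have /andP[_ bk] := beta_bounds k.
apply: le_trans (_ : beta k * norm2 (Fhat k w (x k)) <= _).
  exact: norm2_prox_le.
by rewrite ler_wpM2r ?norm2_ge0.
Qed.

Let bt0 : 0 < betatilde.
Proof. by have /andP[b0 /(lt_le_trans b0)] := beta_bounds 0%N. Qed.

(* All the points at which the algorithm evaluates the empirical means, including
   the last rejected trial point, stay in one ball. *)
Let evaluation_ball : exists rho : nat, [/\
  forall k, norm2 (x k - xs) <= rho%:R,
  forall k, norm2 (trial w k (x k) (a k) - xs) <= rho%:R &
  forall k, norm2 (trial w k (x k) (a k / theta) - xs) <= rho%:R].
Proof.
have [M xM] := path_bounded; have [u u0 dev] := unif_dev M.
have [b ub] := cvgn_bounded u0.
have b0 : 0 <= b := le_trans (norm2_ge0 _) (le_trans (dev 0%N _ (xM 0%N)) (ub 0%N)).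
pose K := betatilde * (b + tau * (1 + M%:R)).
have K0 : 0 <= K by rewrite mulr_ge0 ?(ltW bt0)// addr_ge0// mulr_ge0// addr_ge0.
have rK k : r k <= K.
  apply: le_trans (le_r k) _; rewrite ler_wpM2l ?(ltW bt0)//.
  rewrite -(subrK (T (x k)) (Fhat k w (x k))) (le_trans (norm2D _ _))// lerD//.
    by rewrite (le_trans _ (ub k))//; exact: dev.
  by apply: le_trans (mean_operator_le _) _; rewrite ler_wpM2l// lerD2l.
have /andP[t0 t1] := theta01; have /andP[_ ah1] := alpha01.
have trialK k c : 0 <= c <= theta^-1 ->
    norm2 (trial w k (x k) c - xs) <= theta^-1 * K + M%:R.
  move=> /andP[c0 c1]; apply: le_trans (norm2_triangle (x k) _ xs) _.
  apply: lerD => //; rewrite norm2_distC sub_trial norm2Z ger0_norm//.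
  by apply: ler_pM => //; [exact: norm2_ge0|exact: rK].
have ti1 : 1 <= theta^-1 by rewrite invf_ge1// ltW.
have tK0 : 0 <= theta^-1 * K by rewrite mulr_ge0// invr_ge0 ltW.
have a1 k : a k <= 1 by have /andP[_ /le_trans->] := a_bounds k.
have rhoP c : c <= theta^-1 * K + M%:R -> c <= (Num.bound (theta^-1 * K + M%:R))%:R.
  by move=> /le_trans; apply; apply/ltW/archi_boundP; rewrite addr_ge0.
exists (Num.bound (theta^-1 * K + M%:R)); split => k; apply: rhoP.
- by rewrite (le_trans (xM k))// lerDr.
- by apply: trialK; rewrite ltW//= (le_trans (a1 k)).
- by apply: trialK; rewrite divr_ge0 ?(ltW t0) ?(ltW (a0 k))//= ler_piMl// invr_ge0 ltW.
Qed.


(* If the residual [r k] stayed above [e], the vanishing displacement would force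
   the step to vanish, so that a trial point ever closer to [x k] would have been
   rejected, against the Hölder continuity of the mean operator. *)
Lemma residual_cvg0 : r @ \oo --> (0 : R).
Proof.
have [rho [xrho zrho vrho]] := evaluation_ball; have [u u0 dev] := unif_dev rho.
have [b ub] := cvgn_bounded u0.
have b0 : 0 <= b := le_trans (norm2_ge0 _) (le_trans (dev 0%N _ (xrho 0%N)) (ub 0%N)).
pose K := b + tau * (1 + rho%:R).
have K0 : 0 <= K by rewrite addr_ge0// mulr_ge0// addr_ge0.
have /andP[t0 t1] := theta01; have /andP[l0 l1] := lambda01.
have /andP[ah0 _] := alpha01.
pose q k := betatilde / lambda * K * D k.
have bl0 : 0 <= betatilde / lambda by rewrite divr_ge0 ?(ltW bt0) ?(ltW l0).
have q0 k : 0 <= q k by exact: mulr_ge0 (mulr_ge0 bl0 K0) (D0 k).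
have qcvg : q @ \oo --> (0 : R).
  by rewrite -(mulr0 (betatilde / lambda * K)); exact: (cvgM (cvg_cst _) D_cvg0).
(* By [displacement_ge], a k (lambda / beta k) r k^2 is at most the displacement times the norm of
   [Fhat] at the trial point, itself at most K. *)
have arq k : a k * r k ^+ 2 <= q k.
  have h := displacement_ge X0 closedX convexX alpha01 lambda01 theta01 (beta0 k) (Xx k)
    delta0 (Lhat_ge0 k w) (empirical_mean_holder k w).
  have hK : norm2 (Fhat k w (trial w k (x k) (a k))) <= K.
    rewrite -(subrK (T (trial w k (x k) (a k))) (Fhat k w _)) (le_trans (norm2D _ _))// lerD//.
      by rewrite (le_trans _ (ub k))//; exact: dev.
    by apply: le_trans (mean_operator_le _) _; rewrite ler_wpM2l// lerD2l.
  have {h} h : a k * (lambda / beta k * r k ^+ 2) <= D k * K.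
    by apply: le_trans h _; rewrite ler_wpM2l ?D0.
  have /andP[bk0 bk] := beta_bounds k.
  have lb : lambda / betatilde <= lambda / beta k.
    by rewrite ler_pM2l// lef_pV2.
  have -> : q k = betatilde / lambda * (D k * K) by rewrite /q; ring.
  have -> : a k * r k ^+ 2 = betatilde / lambda * (a k * (lambda / betatilde * r k ^+ 2)).
    by field; rewrite !gt_eqF.
  rewrite ler_wpM2l//; apply: le_trans h.
  by rewrite ler_wpM2l ?(ltW (a0 k))// ler_wpM2r ?sqr_ge0.
apply/cvgr0Pnorm_lt => e e0.
have q2 : (fun k => q k / (e * theta)) @ \oo --> (0 : R).
  by rewrite -(mul0r (e * theta)^-1); exact: (cvgM qcvg (cvg_cst _)).
have q2d := cvg_powR0 (FF := eventually_filter) delta0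
  (fun k => divr_ge0 (q0 k) (mulr_ge0 (ltW e0) (ltW t0))) q2.
have vcvg : (fun k => 2 * u k + m%:R * h1 * (q k / (e * theta)) `^ delta) @ \oo --> (0 : R).
  rewrite [X in _ --> X](_ : 0 = 2 * 0 + m%:R * h1 * 0); last by ring.
  exact: (cvgD (cvgM (cvg_cst _) u0) (cvgM (cvg_cst _) q2d)).
have gap0 : 0 < (1 - lambda) / betatilde * e by rewrite mulr_gt0// divr_gt0// subr_gt0.
have ae0 : 0 < alphahat * e ^+ 2 by rewrite mulr_gt0// exprn_gt0.
move/cvgr0Pnorm_lt/(_ _ ae0) : qcvg => qcvg.
move/cvgr0Pnorm_lt/(_ _ gap0) : vcvg => vcvg.
near=> k; rewrite ger0_norm// ltNge; apply/negP => er.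
have qk : q k < alphahat * e ^+ 2.
  by apply: le_lt_trans (ler_norm _) _; near: k.
have vk : 2 * u k + m%:R * h1 * (q k / (e * theta)) `^ delta < (1 - lambda) / betatilde * e.
  by apply: le_lt_trans (ler_norm _) _; near: k.
have rk0 : 0 < r k := lt_le_trans e0 er.
(* A step equal to [alphahat] is impossible here: with [e <= r k] it would give alphahat e^2 <= q k,
   against [qk]. So the preceding trial point was rejected. *)
have [aE|rej] := step_rejected X0 closedX convexX alpha01 lambda01 theta01 (beta0 k) (Xx k)
    delta0 (Lhat_ge0 k w) (empirical_mean_holder k w).
  have := le_lt_trans (arq k) qk; rewrite {1}/a aE ltr_pM2l// ltNge.
  by rewrite lerXn2r ?nnegrE// ltW.
move: rej; rewrite -/(a k) -/(p k) -/(r k) -/(Fhat k w) => rej.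
set v := trial w k (x k) (a k / theta) in rej.
have pr : r k ^+ 2 <= beta k * inner (Fhat k w (x k)) (x k - p k).
  exact: prox_inner.
have bk0 := beta0 k.
(* [prox_inner] minus the failed test at [v]. *)
have gap : (1 - lambda) / beta k * r k ^+ 2 <= inner (Fhat k w (x k) - Fhat k w v) (x k - p k).
  rewrite innerBl; move: pr; rewrite -ler_pdivrMl// => pr.
  rewrite mulrBl mulrBl mul1r lerB//; exact: ltW.
(* As [e <= r k], the length a k r k / theta is at most a k r k^2 / (e theta). *)
have xv : norm2 (x k - v) <= q k / (e * theta).
  rewrite sub_trial norm2Z ger0_norm ?divr_ge0 ?(ltW (a0 k)) ?(ltW t0)//.
  rewrite -/(p k) -/(r k) invfM mulrA mulrAC ler_pM2r ?invr_gt0// ler_pdivlMr//.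
  apply: le_trans (arq k); rewrite -mulrA ler_wpM2l ?(ltW (a0 k))// expr2.
  by rewrite ler_wpM2l.
have Fxv : norm2 (Fhat k w (x k) - Fhat k w v) <=
    2 * u k + m%:R * h1 * (q k / (e * theta)) `^ delta.
  have e1 := dev k _ (xrho k); have e2 := dev k _ (vrho k).
  have e3 := mean_operator_holder2 delta01 mF L0 F_holder Hh1 (x k) v.
  have {}e3 : norm2 (T (x k) - T v) <= m%:R * h1 * (q k / (e * theta)) `^ delta.
    apply: (le_trans e3); rewrite ler_wpM2l ?mulr_ge0//.
    by apply: ge0_ler_powR; rewrite ?nnegrE ?norm2_ge0 ?(ltW delta0)// (le_trans (norm2_ge0 _) xv).
  apply: le_trans (norm2_triangle (T (x k)) _ _) _.
  apply: le_trans (lerD e1 (norm2_triangle (T v) _ _)) _.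
  rewrite (norm2_distC (T v)); move: (lerD e3 e2); move: (m%:R * h1 * _) => *; lra.
have := le_lt_trans Fxv vk; rewrite ltNge => /negP; apply.
rewrite -(ler_pM2r rk0); apply: le_trans (le_trans gap (inner_le _ _)).
rewrite expr2 mulrA ler_wpM2r//.
have bb : (1 - lambda) / betatilde <= (1 - lambda) / beta k.
  have /andP[_ bk] := beta_bounds k.
  by rewrite ler_wpM2l ?subr_ge0 ?(ltW l1)// lef_pV2.
apply: ler_pM => //; first by rewrite divr_ge0 ?(ltW bt0)// subr_ge0 ltW.
exact: ltW.
Unshelve. all: by end_near. Qed.

(** The projection inequality bounds [inner (Fhat k w (x k)) (y - p k)] from below. The three
    summands of the null sequence pay for this bound, for replacing [p k] by [x k], and for
    replacing [Fhat] by the mean operator; [betahat] controls the factor 1 / beta k. *)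
Lemma path_residual y : X y -> exists2 e : nat -> R, e @ \oo --> (0 : R) &
  forall k, - e k <= inner (T (x k)) (y - x k).
Proof.
move=> Xy; have [M xM] := path_bounded; have [u u0 dev] := unif_dev M.
pose dy := norm2 (y - xs) + M%:R.
have yd k : norm2 (y - x k) <= dy.
  by apply: le_trans (norm2_triangle xs _ _) _; rewrite lerD// norm2_distC.
pose K := tau * (1 + M%:R).
exists (fun k => betahat^-1 * r k * (dy + r k) + (u k + K) * r k + u k * dy).
  have r0c := residual_cvg0.
  rewrite [X in _ --> X](_ : 0 = betahat^-1 * 0 * (dy + 0) + (0 + K) * 0 + 0 * dy); last by ring.
  apply: cvgD; last exact: (cvgM u0 (cvg_cst _)).
  apply: cvgD; last exact: (cvgM (cvgD u0 (cvg_cst _)) r0c).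
  exact: (cvgM (cvgM (cvg_cst _) r0c) (cvgD (cvg_cst _) r0c)).
move=> k.
have h := proj_inner X0 closedX convexX (x k - beta k *: Fhat k w (x k)) Xy.
have {h} : inner (x k - p k) (y - p k) <= beta k * inner (Fhat k w (x k)) (y - p k).
  move: h; rewrite -[proj X _]/(p k) addrAC (innerBl (x k - p k)).
  by rewrite (innerZl (beta k)) subr_le0.
have yp : norm2 (y - p k) <= dy + r k.
  by apply: le_trans (norm2_triangle (x k) _ _) _; rewrite lerD2r.
have g1 : - (r k * (dy + r k)) <= inner (x k - p k) (y - p k).
  have := norm_inner_le (x k - p k) (y - p k); rewrite ler_norml => /andP[+ _].
  by apply: le_trans; rewrite lerN2; apply: ler_wpM2l => //; exact: r0.
move=> /(le_trans g1) {}g1.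
have bk0 := beta0 k; have bk := betahat_le k.
have g2 : - (betahat^-1 * r k * (dy + r k)) <= inner (Fhat k w (x k)) (y - p k).
  move: g1; rewrite -ler_pdivrMl// mulrN => /(le_trans _); apply.
  rewrite lerN2 -mulrA ler_wpM2r//; last by rewrite lef_pV2.
  by rewrite mulr_ge0// (le_trans (norm2_ge0 _) yp).
have Fx := dev k _ (xM k).
have Fk : norm2 (Fhat k w (x k)) <= u k + K.
  rewrite -(subrK (T (x k)) (Fhat k w (x k))) (le_trans (norm2D _ _))// lerD//.
  by apply: le_trans (mean_operator_le _) _; rewrite ler_wpM2l// lerD2l.
have g3 : - ((u k + K) * r k) <= - inner (Fhat k w (x k)) (x k - p k).
  rewrite lerN2; apply: le_trans (inner_le _ _) _.
  by rewrite ler_wpM2r ?norm2_ge0.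
have g4 : - (u k * dy) <= - inner (Fhat k w (x k) - T (x k)) (y - x k).
  rewrite lerN2; apply: le_trans (inner_le _ _) _.
  by rewrite ler_pM ?norm2_ge0.
have -> : inner (T (x k)) (y - x k) = inner (Fhat k w (x k)) (y - p k) -
    inner (Fhat k w (x k)) (x k - p k) - inner (Fhat k w (x k) - T (x k)) (y - x k).
  by rewrite !innerE; ring.
by rewrite !opprD; apply: lerD => //; exact: lerD.
Qed.

End path.

Lemma ae_path_residual : \forall w \ae Pr,
  (exists M : nat, forall k, norm2 (iter k w - xs) <= M%:R) /\
  forall y, X y -> exists2 e : nat -> R, e @ \oo --> (0 : R) &
    forall k, - e k <= inner (T (iter k w)) (y - iter k w).
Proof.
apply: filterS2 ae_path_error_bounded ae_uniform_deviation => w [B sB] dev.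
by split=> [|y]; [exact: path_bounded sB | exact: path_residual sB dev y].
Qed.

Local Notation stops := (stops_at F X alphahat lambda theta beta x0).
Local Notation continues := (continues_at F X alphahat lambda theta beta x0).

(** [iterate] is defined beyond a stop, so the path estimates hold in both cases; the least index at
    which the test succeeds is where the algorithm stops. *)
Lemma ae_stop_or_converge : \forall w \ae Pr,
  (exists k, stops (sample w) k) \/
  [/\ forall k, continues (sample w) k,
      exists M : R, forall k, norm2 (iter k w) <= M,
      (fun k => dist2 (iter k w) (VI_solutions T X)) @ \oo --> (0 : R) &
      cluster ((fun k => iter k w) @ \oo) `<=` VI_solutions T X].
Proof.
apply: filterS ae_path_residual => w [[M xM] res].
pose fixed k := `[< iter k w = prox w k (iter k w) >].
have step_ex k : exists a,
    is_linesearch_step F X alphahat lambda theta beta (sample w) k (iter k w) a.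
  by exists (step w k (iter k w)); apply: sample_linesearchP; exact: iterate_in.
have [ex_fixed|nfixed] := pselect (exists k, fixed k).
  left; have [k /asboolP fixk kmin] := ex_minnP ex_fixed.
  exists k; split=> // j jk; split; last exact: step_ex.
  by move=> /asboolP /kmin; rewrite leqNgt jk.
right; split.
- move=> k; split; last exact: step_ex.
  by move=> fixk; apply: nfixed; exists k; exact/asboolP.
- exists (M%:R + norm2 xs) => k; rewrite -[X in norm2 X](subrK xs).
  by rewrite (le_trans (norm2D _ _))// lerD2r.
- apply: (dist2_VI_solutions_cvg0 closedX continuous_mean_operator _ res xM) => k.
  exact: iterate_in.
- by apply: (cluster_VI_solutions closedX continuous_mean_operator _ res) => k; exact: iterate_in.
Qed.

Lemma past_stop_solution k (A : set Om) : past xi k A ->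
  (\forall w \ae Pr, A w -> stops (sample w) k) ->
  \forall w \ae Pr, A w -> VI_solutions T X (iter k w).
Proof.
move=> pastA stopA; apply: ae_stop_solution; last first.
  by apply: filterS stopA => w h /h[].
suff : <<s events_of Y (before k) >> A by [].
apply: sub_smallest2r pastA; first exact: smallest_sigma_algebra.
move=> _ [j [i [B [jk mB ->]]]]; exists (Tagged (fun k => 'I_(N k)) i), B.
by split.
Qed.

End stochastic_step.

(** * Removing an exceptional null set *)

Section same_empirical_means.
Context {R : realType} {m : nat} {d : measure_display} {Xi : measurableType d}.
Context (F G : Xi -> 'rV[R]_m -> 'rV[R]_m) (X : set 'rV[R]_m).
Context (alphahat lambda theta : R) (beta : nat -> R) (N : nat -> nat).
Context (s : forall k, 'I_(N k) -> Xi) (x0 : 'rV[R]_m).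
Hypotheses (X0 : X !=set0) (closedX : closed X) (convexX : convex_set X).
Hypotheses (alpha01 : 0 < alphahat <= 1) (theta01 : 0 < theta < 1) (Xx0 : X x0).
Hypothesis FG : forall k y, X y -> empirical_mean F (@s k) y = empirical_mean G (@s k) y.

Let prox_eq k x : X x -> prox_point F X beta s k x = prox_point G X beta s k x.
Proof. by move=> Xx; rewrite /prox_point FG. Qed.

Let trial_eq k x a : X x -> trial_point F X beta s k x a = trial_point G X beta s k x a.
Proof. by move=> Xx; rewrite /trial_point prox_eq. Qed.

Let is_step_eq k x : X x -> is_linesearch_step F X alphahat lambda theta beta s k x =
  is_linesearch_step G X alphahat lambda theta beta s k x.
Proof.
move=> Xx; rewrite /is_linesearch_step.
suff -> : accepted_steps F X alphahat lambda theta beta s k x =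
  accepted_steps G X alphahat lambda theta beta s k x by [].
have trialX l : X (trial_point G X beta s k x (theta ^+ l * alphahat)).
  apply: trial_in => //; have /andP[t0 t1] := theta01; have /andP[a0 a1] := alpha01.
  rewrite mulr_ge0 ?exprn_ge0 ?(ltW t0) ?(ltW a0)//=.
  by rewrite mulr_ile1 ?exprn_ge0 ?exprn_ile1 ?(ltW t0) ?(ltW t1) ?(ltW a0).
have FGl l : empirical_mean F (@s k) (trial_point F X beta s k x (theta ^+ l * alphahat)) =
    empirical_mean G (@s k) (trial_point G X beta s k x (theta ^+ l * alphahat)).
  by rewrite (trial_eq _ _ Xx) (FG k (trialX l)).
apply/seteqP; split => a [[l aE] h]; (split; first by exists l); move: h.
  by rewrite aE (prox_eq k Xx) FGl.
by rewrite aE -(prox_eq k Xx) -FGl.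
Qed.

Let step_eq k x : X x -> linesearch_step F X alphahat lambda theta beta s k x =
  linesearch_step G X alphahat lambda theta beta s k x.
Proof. by move=> Xx; rewrite /linesearch_step is_step_eq. Qed.

Let step01 k x : 0 <= linesearch_step F X alphahat lambda theta beta s k x <= 1.
Proof.
(* If no step qualifies, the default value is 0, which is in range. *)
rewrite /linesearch_step; case: xgetP => [a _ [/accepted_bounds h _]|_]; last by rewrite lexx ler01.
have /andP[a0 a1] := h alpha01 theta01; rewrite ltW//= (le_trans a1)//.
by case/andP: alpha01.
Qed.

Let next_eq k x : X x -> next_iterate F X alphahat lambda theta beta s k x =
  next_iterate G X alphahat lambda theta beta s k x.
Proof.
move=> Xx; have Xz := trial_in F beta s k X0 closedX convexX Xx (step01 k x).
rewrite /next_iterate (FG k Xz).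
by rewrite (trial_eq k _ Xx) (step_eq k Xx).
Qed.

Lemma iterate_same k : iterate F X alphahat lambda theta beta x0 s k =
    iterate G X alphahat lambda theta beta x0 s k /\
  X (iterate F X alphahat lambda theta beta x0 s k).
Proof.
elim: k => [//|k [IHk Xk]] /=; split; last exact: next_in.
by rewrite -IHk next_eq.
Qed.

Lemma continues_at_same k : continues_at F X alphahat lambda theta beta x0 s k =
  continues_at G X alphahat lambda theta beta x0 s k.
Proof.
by rewrite /continues_at; have [<- Xk] := iterate_same k; rewrite (prox_eq k Xk) (is_step_eq k Xk).
Qed.

Lemma stops_at_same k : stops_at F X alphahat lambda theta beta x0 s k =
  stops_at G X alphahat lambda theta beta x0 s k.
Proof.
rewrite /stops_at; have [<- Xk] := iterate_same k; rewrite (prox_eq k Xk).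
by have /funext-> := continues_at_same.
Qed.

End same_empirical_means.

(** * Moments of sums and powers *)

Section moments.
Context {R : realType} {d : measure_display} {T : measurableType d}.
Context (mu : probability T R).

Lemma expr_le_powR (t s : R) q : 0 <= t -> q%:R <= s -> t ^+ q <= 1 + t `^ s.
Proof.
move=> t0 qs; have [t1|/ltW t1] := leP t 1.
  by rewrite (le_trans (exprn_ile1 q t0 t1))// lerDl powR_ge0.
by rewrite -powR_mulrn// (le_trans (ler_powR t1 qs))// lerDr.
Qed.

Lemma exprD_le (a b : R) q : 0 <= a -> 0 <= b -> (a + b) ^+ q <= 2 ^+ q * (a ^+ q + b ^+ q).
Proof.
wlog ab : a b / a <= b => [hw a0 b0|a0 b0].
  have [ab|/ltW ba] := leP a b; first exact: hw.
  by rewrite addrC [X in _ * X]addrC; exact: hw.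
rewrite mulrDr (le_trans (y := 2 ^+ q * b ^+ q))//; last first.
  by rewrite lerDr mulr_ge0 ?exprn_ge0.
by rewrite -exprMn lerXn2r ?nnegrE ?addr_ge0 ?mulr_ge0//; lra.
Qed.

Lemma mean_le_moment (f g : T -> R) (c s : R) q :
  measurable_fun setT f -> measurable_fun setT g ->
  (forall x, 0 <= f x) -> (forall x, 0 <= g x) -> 0 <= c -> q%:R <= s ->
  ('E_mu[(fun x => f x `^ s)%R] < +oo)%E -> ('E_mu[(fun x => g x `^ s)%R] < +oo)%E ->
  exists h, mean_le mu (fun x => (c * g x + f x) ^+ q) h.
Proof.
move=> mf mg f0 g0 c0 qs; rewrite unlock => fs gs.
have powP u : measurable_fun setT u -> (\int[mu]_x (u x `^ s)%:E < +oo)%E ->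
    exists a, mean_le mu (fun x => u x `^ s) a.
  move=> mu_ us; apply: mean_le_finite => // [|x]; last exact: powR_ge0.
  exact: (measurableT_comp (measurable_powR s) mu_).
have [a fa] := powP f mf fs; have [b gb] := powP g mg gs.
have q0 : 0 <= 2 ^+ q :> R by rewrite exprn_ge0.
have cq0 : 0 <= c ^+ q by rewrite exprn_ge0.
have M := mean_leZ q0 (mean_leD (mean_leZ cq0 (mean_leD (mean_le_cst mu 1) gb))
  (mean_leD (mean_le_cst mu 1) fa)).
eexists; apply: mean_le_dom M.
  by apply: measurable_funX; apply: measurable_funD => //; exact: measurable_funM.
move=> x; have cg0 : 0 <= c * g x by rewrite mulr_ge0.
rewrite ger0_norm ?exprn_ge0 ?addr_ge0//.
apply: le_trans (exprD_le q cg0 (f0 x)) _; rewrite ler_wpM2l// exprMn lerD//=.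
  by rewrite ler_wpM2l// expr_le_powR.
exact: expr_le_powR.
Qed.

End moments.

(** * An operator regular everywhere *)

Section modification.
Context {R : realType} {m : nat} {d : measure_display} {Xi : measurableType d}.
Context (P : probability Xi R) (X : set 'rV[R]_m) (F : Xi -> 'rV[R]_m -> 'rV[R]_m).
Context (L : Xi -> R) (delta : R) (B : set Xi).
Hypotheses (X0 : X !=set0) (closedX : closed X) (convexX : convex_set X).
Hypotheses (mF : measurable_operator F X) (mL : measurable_fun setT L).
Hypotheses (L0 : forall x, 0 <= L x) (mB : measurable B) (PB0 : P B = 0%E).
Hypothesis delta0 : 0 < delta.
Hypothesis F_holder : forall x, ~ B x -> forall y z, X y -> X z ->
  norm2 (F x y - F x z) <= L x * norm2 (y - z) `^ delta.

(* Agrees with [F] on [X] outside the null set [B], but is measurable and Hölder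
   continuous everywhere. *)
Definition regular_operator x y : 'rV[R]_m := \1_(~` B) x *: F x (proj X y).

Definition regular_bound x : R := \1_(~` B) x * L x.

Let indicC x : ~ B x -> \1_(~` B) x = 1 :> R.
Proof. by move=> Bx; rewrite indicE mem_set. Qed.

Let indic0 x : B x -> \1_(~` B) x = 0 :> R.
Proof. by move=> Bx; rewrite indicE memNset//= => /(_ Bx). Qed.

Let mX : measurable (X : set (borel_rV R m)).
Proof.
rewrite -[X]setCK; apply: measurableC; apply: sub_sigma_algebra.
exact: closed_openC.
Qed.

Lemma measurable_regular_operator : measurable_fun setT
  (fun u : Xi * borel_rV R m => regular_operator u.1 u.2 : borel_rV R m).
Proof.
apply: measurable_rowvecZ.
  by apply: (measurableT_comp _ measurable_fst); apply: measurable_indic; exact: measurableC.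
have mh : measurable_fun setT (fun u : Xi * borel_rV R m => (u.1, proj X u.2 : borel_rV R m)).
  apply: measurable_fun_pair => //; apply: measurableT_comp => //.
  exact: continuous_measurable_rV2 (continuous_proj X0 closedX convexX).
apply: (measurable_comp _ _ mF mh); first exact: measurableX.
by move=> _ [u _ <-]; split => //; exact: proj_in.
Qed.

Lemma measurable_regular_bound : measurable_fun setT regular_bound.
Proof. by apply: measurable_funM => //; apply: measurable_indic; exact: measurableC. Qed.

Lemma regular_bound_ge0 x : 0 <= regular_bound x.
Proof. by rewrite mulr_ge0// indicE. Qed.

Lemma regular_operator_holder x y z :
  norm2 (regular_operator x y - regular_operator x z) <=
  regular_bound x * norm2 (y - z) `^ delta.
Proof.
rewrite /regular_operator /regular_bound; have [Bx|Bx] := pselect (B x).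
  by rewrite indic0// !scale0r subr0 norm2_0 !mul0r.
rewrite indicC// !scale1r mul1r; apply: le_trans (F_holder Bx _ _) _; try exact: proj_in.
apply: (ler_wpM2l (L0 x)).
apply: (ge0_ler_powR (ltW delta0) (norm2_ge0 _) (norm2_ge0 _)).
exact: proj_nonexpansive.
Qed.

Lemma regular_operatorE x y : ~ B x -> X y -> regular_operator x y = F x y.
Proof. by move=> Bx Xy; rewrite /regular_operator indicC// scale1r proj_id. Qed.

Let measurable_at y : X y -> measurable_fun setT (fun x => F x y : borel_rV R m).
Proof.
move=> Xy; have mh : measurable_fun setT (fun x : Xi => (x, y : borel_rV R m)).
  by apply: measurable_fun_pair => //; exact: measurable_cst.
apply: (measurable_comp _ _ mF mh); first exact: measurableX.
by move=> _ [u _ <-].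
Qed.

Lemma mean_regular_operator y : X y -> mean_operator P regular_operator y = mean_operator P F y.
Proof.
move=> Xy; apply/rowP => i; rewrite !mxE unlock; congr fine.
apply: ae_eq_integral => //.
- apply/measurable_EFinP; exact: (measurable_operator_coord measurable_regular_operator).
- apply/measurable_EFinP; apply: measurable_rowvec_coord; exact: measurable_at.
- exists B; split => // x /= nB; apply: contrapT => Bx; apply: nB => _.
  by rewrite regular_operatorE.
Qed.

(** The moment hypothesis is made at some [x1], while the envelope is taken at [xs]; the Hölder
    bound moves the reference point, whence the constant [c]. *)
Lemma regular_envelope_moment (s : R) (q : nat) (x1 xs : 'rV[R]_m) : X x1 -> X xs ->
  q%:R <= s ->
  ('E_P[(fun x => norm2 (F x x1) `^ s)%R] < +oo)%E -> ('E_P[(fun x => L x `^ s)%R] < +oo)%E ->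
  exists h, mean_le P (fun x => envelope regular_operator regular_bound xs x ^+ q) h.
Proof.
move=> Xx1 Xxs qs Fs Ls; pose c := 1 + norm2 (xs - x1) `^ delta.
have c0 : 0 <= c by rewrite addr_ge0// powR_ge0.
have mFx1 : measurable_fun setT (fun x => norm2 (F x x1)).
  by apply: measurable_norm2; exact: measurable_at.
have [h Mh] := mean_le_moment mFx1 mL (fun x => norm2_ge0 _) L0 c0 qs Fs Ls.
have e0 x : 0 <= envelope regular_operator regular_bound xs x.
  by rewrite addr_ge0 ?norm2_ge0// regular_bound_ge0.
exists h; apply: mean_le_dom Mh.
  apply: measurable_funX; apply: measurable_funD; first exact: measurable_regular_bound.
  by apply: measurable_norm2; exact: (measurable_operator_at measurable_regular_operator).
move=> x; rewrite ger0_norm ?exprn_ge0// lerXn2r ?nnegrE ?addr_ge0 ?mulr_ge0 ?norm2_ge0//.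
rewrite /envelope; have [Bx|Bx] := pselect (B x).
  rewrite /regular_bound /regular_operator indic0// scale0r norm2_0 mul0r addr0.
  by rewrite addr_ge0 ?mulr_ge0 ?norm2_ge0.
rewrite regular_operatorE// /regular_bound indicC// mul1r mulrDl mul1r -addrA lerD2l.
rewrite -[X in norm2 X](subrK (F x x1)) (le_trans (norm2D _ _))// lerD2r mulrC.
exact: F_holder.
Qed.

End modification.

(** * Transfer to the original operator *)

Theorem theorem5p7 (R : realType) (m : nat) (d d' : measure_display)
    (Xi : measurableType d) (Om : measurableType d')
    (P : probability Xi R) (Pr : probability Om R)
    (X : set 'rV[R]_m) (F : Xi -> 'rV[R]_m -> 'rV[R]_m) (delta p : R)
    (N : nat -> nat) (xi : forall k, 'I_(N k) -> {RV Pr >-> Xi})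
    (x0 : 'rV[R]_m) (betahat betatilde alphahat lambda theta : R)
    (beta : nat -> R)
    (T := mean_operator P F)
    (Xstar := VI_solutions T X)
    (sample := fun (w : Om) k (j : 'I_(N k)) => @xi k j w)
    (x := fun (k : nat) (w : Om) =>
       iterate F X alphahat lambda theta beta x0 (sample w) k)
    (stops := fun (k : nat) (w : Om) =>
       stops_at F X alphahat lambda theta beta x0 (sample w) k)
    (continues := fun (k : nat) (w : Om) =>
       continues_at F X alphahat lambda theta beta x0 (sample w) k) :
  X !=set0 -> closed X -> convex_set X ->
  measurable_operator F X ->
  0 < delta <= 1 -> 2 <= p -> heavy_tailed_holder P F X delta p ->
  Xstar !=set0 ->
  pseudo_monotone T X ->
  X x0 ->
  0 < betahat <= betatilde -> 0 < alphahat <= 1 ->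
  0 < lambda < 1 -> 0 < theta < 1 ->
  (forall k, betahat <= beta k <= betatilde) ->
  (forall k, (0 < N k)%N) ->
  iid_sample P xi ->
  cvgn (series (fun k => (Num.sqrt (N k)%:R : R)^-1)) ->
  (forall (k : nat) (A : set Om), past xi k A ->
     (\forall w \ae Pr, A w -> stops k w) ->
     \forall w \ae Pr, A w -> Xstar (x k w)) /\
  (\forall w \ae Pr,
     (exists k, stops k w) \/
     [/\ forall k, continues k w,
         exists M : R, forall k, norm2 (x k w) <= M,
         (fun k => dist2 (x k w) Xstar) @ \oo --> (0 : R) &
         cluster ((fun k => x k w) @ \oo) `<=` Xstar]).
Proof.
move=> X0 closedX convexX mF delta01 p2 [L [L0 aeL [x1 Xx1 [Fm Lm]]]] [xs Xsxs] pmT Xx0.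
move=> /andP[betahat0 _] alpha01 lambda01 theta01 betaP N0 [lawxi indY] sumN.
have Xxs : X xs by case: Xsxs.
have delta0 : 0 < delta by case/andP: delta01.
have beta_bounds k : 0 < beta k <= betatilde.
  by have /andP[b1 ->] := betaP k; rewrite (lt_le_trans betahat0).
have betahat_le k : betahat <= beta k by have /andP[] := betaP k.
have lawY (i : {k : nat & 'I_(N k)}) (A : set Xi) : measurable A ->
    distribution Pr (xi (tag i) (tagged i)) A = P A by exact: lawxi.
(* [B] is a measurable null set containing every failure of the Hölder bound. *)
have [B [mB PB0 nB]] := aeL.
have F_holder z : ~ B z -> forall y y', X y -> X y' ->
    norm2 (F z y - F z y') <= L z * norm2 (y - y') `^ delta.
  move=> Bz; have [_ //] : 1 <= L z /\ forall x y, X x -> X y ->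
      norm2 (F z x - F z y) <= L z * norm2 (x - y) `^ delta.
  by apply: contrapT => nLz; exact/Bz/nB.
have mL : measurable_fun setT L by [].
pose G := regular_operator X F B; pose LG := regular_bound L B.
have mG := measurable_regular_operator X0 closedX convexX mF mB.
have mLG := measurable_regular_bound mL mB.
have LG0 := regular_bound_ge0 B L0.
have G_holder := regular_operator_holder X0 closedX convexX L0 delta0 F_holder.
have TE y : X y -> mean_operator P G y = T y.
  by move=> Xy; exact: (mean_regular_operator X0 closedX convexX mF mB PB0).
have XsE : VI_solutions (mean_operator P G) X = Xstar.
  apply/seteqP; split => y [Xy gapy]; split => // v Xv.
    by rewrite -TE//; exact: gapy.
  by rewrite TE//; exact: gapy.
have monG y : X y -> 0 <= inner (mean_operator P G y) (y - xs).
  by move=> Xy; rewrite TE//; apply: pmT => //; case: Xsxs => _; exact.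
have moment q : q%:R <= moment_factor X * p ->
    exists h, mean_le P (fun z => envelope G LG xs z ^+ q) h.
  by move=> qp; exact: (regular_envelope_moment X0 closedX convexX mF mL L0 mB F_holder Xx1 Xxs qp).
have factor1 : 1 <= moment_factor X :> R.
  by rewrite /moment_factor; case: ifP => _; rewrite // ler1n.
have p_le : 2 <= moment_factor X * p.
  by apply: (le_trans p2); rewrite ler_peMl// (le_trans _ p2).
have [h1 Hh1] := moment 1%N (le_trans (ler1n _ 2) p_le).
have [h2 Hh2] := moment 2%N p_le.
have [C C0 mean_error] : exists2 C : R, 0 <= C & forall k y, X y ->
    mean_le Pr (sampling_error (P := P) X G xi alphahat lambda theta beta xs k y)
      (C * (1 + norm2 (y - xs) ^+ 2) / Num.sqrt (N k)%:R).
  (* For compact [X] the moments assumed are of order p >= 2 and boundedness is used; otherwise they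
     are of order 2 p >= 4, as the fourth-moment bound requires. *)
  have [compactX|ncompactX] := pselect (compact X).
    (* [XM] bounds [X] by every number above [M]; [M + 1] is the one taken. *)
    have [M [_ XM]] := compact_bounded compactX.
    apply: (mean_error_bounded closedX convexX Xxs alpha01 lambda01 theta01 delta01
      beta_bounds N0 mG LG0 G_holder Hh1 Hh2 indY lawY
      (D := m%:R * (M + 1) + norm2 xs)) => y Xy.
    apply: le_trans (norm2B _ _) _; rewrite lerD2r.
    apply: le_trans (norm2_le_mx_norm _) _; rewrite ler_wpM2l//.
    by apply: XM => //; rewrite ltrDl.
  have [|h4 Hh4] := moment 4%N.
    rewrite /moment_factor; case: asboolP => // _.
    by rewrite (_ : 4 = 2 * 2 :> R) ?ler_pM2l// -natrM.
  exact: (mean_error_moment4 closedX convexX Xxs alpha01 lambda01 theta01 delta01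
    beta_bounds N0 mG LG0 G_holder Hh1 Hh2 indY lawY Hh4).
(* There are countably many samples, so almost surely none falls in [B]. *)
have ae_regular : \forall w \ae Pr, forall k (j : 'I_(N k)), ~ B (xi k j w).
  apply: ae_foralln => k.
  (* The index runs over [nat] with its bound as a premise, so that [ae_foralln] applies. *)
  suff : \forall w \ae Pr, forall i (iN : (i < N k)%N), ~ B (xi k (Ordinal iN) w).
    by apply: filterS => w h [i iN].
  apply: ae_foralln => i; have [iN|Ni] := pselect (i < N k)%N; last first.
    by apply: aeW => w iN; case: (Ni iN).
  exists (xi k (Ordinal iN) @^-1` B); split.
  - by rewrite -[X in measurable X]setTI; exact: measurable_funP.
  - by have := lawxi k (Ordinal iN) B mB; rewrite PB0.
  - move=> w /= nw; apply: contrapT => Bw; apply: nw => iN'.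
    by rewrite (bool_irrelevance iN' iN).
have same w : (forall k (j : 'I_(N k)), ~ B (xi k j w)) -> forall k y, X y ->
    empirical_mean F (@sample w k) y = empirical_mean G (@sample w k) y.
  move=> nBw k y Xy; congr (_ *: _); apply: eq_bigr => j _.
  by apply/esym/regular_operatorE => //; exact: nBw.
split=> [k A pastA stopA|].
  have stopA' : \forall w \ae Pr, A w ->
      stops_at G X alphahat lambda theta beta x0 (sample w) k.
    apply: filterS2 ae_regular stopA => w /same FG h /h.
    by rewrite /stops (stops_at_same lambda beta X0 closedX convexX alpha01 theta01 Xx0 FG).
  have := past_stop_solution closedX convexX Xxs alpha01 lambda01 theta01 delta01
    beta_bounds N0 mG LG0 G_holder Hh1 indY lawY Xx0 pastA stopA'.
  apply: filterS2 ae_regular => w /same FG h /h; rewrite XsE /x.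
  by have [->] := iterate_same lambda beta X0 closedX convexX alpha01 theta01 Xx0 FG k.
have := ae_stop_or_converge closedX convexX Xxs alpha01 lambda01 theta01 delta01
  beta_bounds N0 mG LG0 G_holder Hh1 Hh2 indY lawY Xx0 C0 mean_error monG sumN
  betahat0 betahat_le.
apply: filterS2 ae_regular => w /same FG.
have xE k : x k w = iterate G X alphahat lambda theta beta x0 (sample w) k.
  by have [] := iterate_same lambda beta X0 closedX convexX alpha01 theta01 Xx0 FG k.
rewrite XsE => -[[k stopk]|[cont [M xM] dist clus]].
  left; exists k.
  by rewrite /stops (stops_at_same lambda beta X0 closedX convexX alpha01 theta01 Xx0 FG).
right; split.
- move=> k.
  by rewrite /continues (continues_at_same lambda beta X0 closedX convexX alpha01 theta01 Xx0 FG).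
- by exists M => k; rewrite xE; exact: xM.
- by under eq_fun => k do rewrite xE; exact: dist.
- by under eq_fun => k do rewrite xE; exact: clus.
Qed.
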